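(* Let $D\subset\mathbb{C}^n$ be a bounded homogeneous domain with $0\in D$ and $\psi\in H(D)$. (a) If $M_\psi$ is bounded on $\mathcal{B}(D)$, then $\max\{\|\psi\|_{\mathcal{B}},\|\psi\|_\infty\}\le\|M_\psi\|\le\max\{\|\psi\|_{\mathcal{B}},\|\psi\|_\infty+\sigma_\psi\}$. (b) If $M_\psi$ is bounded on $\mathcal{B}_{0^*}(D)$, then $\max\{\|\psi\|_{\mathcal{B}},\|\psi\|_\infty\}\le\|M_\psi\|\le\max\{\|\psi\|_{\mathcal{B}},\|\psi\|_\infty+\sigma_{0,\psi}\}$.
   Context: A domain $D\subset\mathbb{C}^n$ is homogeneous if its group of biholomorphic self-maps acts transitively on $D$. $H(D)$ denotes the holomorphic functions $D\to\mathbb{C}$; $\|\psi\|_\infty=\sup_{z\in D}|\psi(z)|$. For $f\in H(D)$ and $z\in D$, $Q_f(z)=\sup_{u\in\mathbb{C}^n\setminus\{0\}}\frac{|\nabla f(z)u|}{H_z(u,\bar u)^{1/2}}$, where $\nabla f(z)u=\sum_{j=1}^n\frac{\partial f}{\partial z_j}(z)u_j$ and $H_z$ is the Bergman metric of $D$; $\beta_f=\sup_{z\in D}Q_f(z)$. The Bloch space $\mathcal{B}(D)$ is the set of $f\in H(D)$ with $\beta_f<\infty$, with norm $\|f\|_{\mathcal{B}}=|f(0)|+\beta_f$. The $*$-little Bloch space is $\mathcal{B}_{0^*}(D)=\{f\in\mathcal{B}(D):\lim_{z\to\partial^*D}Q_f(z)=0\}$ with the same norm, where $\partial^*D$ is the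 distinguished boundary of $D$. Define $\omega(z)=\sup\{|f(z)|: f\in\mathcal{B}(D), f(0)=0, \|f\|_{\mathcal{B}}\le1\}$, $\omega_0(z)=\sup\{|f(z)|: f\in\mathcal{B}_{0^*}(D), f(0)=0, \|f\|_{\mathcal{B}}\le1\}$, $\sigma_\psi=\sup_{z\in D}\omega(z)Q_\psi(z)$ and $\sigma_{0,\psi}=\sup_{z\in D}\omega_0(z)Q_\psi(z)$. $M_\psi f=\psi f$ and $\|M_\psi\|$ is its operator norm. *)

(* Defs.v *)
From HB Require Import structures.
From mathcomp Require Import all_boot all_order all_algebra.
From mathcomp Require Import complex.
From mathcomp Require Import all_classical all_reals all_analysis.
Set Implicit Arguments. Unset Strict Implicit. Unset Printing Implicit Defensive.
Import Order.TTheory GRing.Theory Num.Theory.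
Import numFieldNormedType.Exports.
Local Open Scope classical_set_scope.
Local Open Scope ring_scope.

Section SCV.
Variable R : realType.
Local Notation C := (R[i]).
Variable n : nat.
Local Notation Cn := ('rV[C^o]_n).

Definition cabs (z : C) : R := Num.sqrt (complex.Re z ^+ 2 + complex.Im z ^+ 2).

Definition ebasis (j : 'I_n) : Cn := delta_mx 0 j.

Definition cdiff (f : Cn -> C) z := differentiable (f : _ -> C^o) z.
Definition cdiff_map (g : Cn -> Cn) z := differentiable g z.

Definition holo (D : set Cn) (f : Cn -> C) : Prop :=
  forall z, D z -> cdiff f z.

Definition holo_map (D : set Cn) (g : Cn -> Cn) : Prop :=
  forall z, D z -> cdiff_map g z.

Definition biholo (D : set Cn) (g : Cn -> Cn) : Prop :=
  holo_map D g /\ g @` D = D /\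
  exists h : Cn -> Cn, holo_map D h /\ h @` D = D /\
    (forall z, D z -> h (g z) = z) /\ (forall z, D z -> g (h z) = z).

Definition domain (D : set Cn) : Prop := open D /\ connected D /\ D !=set0.

Definition homogeneous (D : set Cn) : Prop :=
  forall z w, D z -> D w -> exists g, biholo D g /\ g z = w.

Definition pderiv (f : Cn -> C) (j : 'I_n) (z : Cn) : C :=
  'D_(ebasis j) (f : _ -> C^o) z.

Definition gradu (f : Cn -> C) (z u : Cn) : C :=
  \sum_(j < n) pderiv f j z * u 0 j.

(* Lebesgue integral over C^n = R^{2n}, as iterated integrals over the real
   and imaginary parts of the coordinates (integrands are nonnegative). *)
Fixpoint iint (k : nat) (g : (nat -> C) -> \bar R) : \bar R :=
  match k with
  | 0 => g (fun _ => 0)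
  | k'.+1 =>
    (\int[@lebesgue_measure R]_x \int[@lebesgue_measure R]_y
       iint k' (fun v => g (fun j => if j == k' then (x +i* y)%C else v j)))%E
  end.

Definition vol_int (F : Cn -> \bar R) : \bar R :=
  iint n (fun v => F (\row_(j < n) v (nat_of_ord j))).

Definition L2sq (D : set Cn) (f : Cn -> C) : \bar R :=
  vol_int (fun z => ((\1_D z : R) * cabs (f z) ^+ 2)%:E).

Definition bergman_diag (D : set Cn) (z : Cn) : \bar R :=
  ereal_sup [set (cabs (f z) ^+ 2)%:E | f in
     [set f | holo D f /\ (L2sq D f <= 1)%E]].

Definition logK (D : set Cn) (z : Cn) : R := ln (fine (bergman_diag D z)).

Definition dx (j : 'I_n) (g : Cn -> R) (p : Cn) : R :=
  derive1 (fun t : R => g (p + (t%:C)%C *: ebasis j)) 0.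
Definition dy (j : 'I_n) (g : Cn -> R) (p : Cn) : R :=
  derive1 (fun t : R => g (p + ((0 +i* t)%C) *: ebasis j)) 0.

(* d^2 g / dz_j d(conj z_k)
   = 1/4 (d/dx_j - i d/dy_j)(d/dx_k + i d/dy_k) g *)
Definition wirt2 (g : Cn -> R) (j k : 'I_n) (p : Cn) : C :=
  ((dx j (dx k g) p + dy j (dy k g) p) +i*
   (dx j (dy k g) p - dy j (dx k g) p))%C / 4%:R.

Definition bergman_metric (D : set Cn) (z u : Cn) : C :=
  \sum_(j < n) \sum_(k < n) wirt2 (logK D) j k z * u 0 j * (u 0 k)^*.

Definition Qf (D : set Cn) (f : Cn -> C) (z : Cn) : \bar R :=
  ereal_sup [set (cabs (gradu f z u) / Num.sqrt (complex.Re (bergman_metric D z u)))%:E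
            | u in [set u : Cn | u != 0]].

Definition beta (D : set Cn) (f : Cn -> C) : \bar R := ereal_sup (Qf D f @` D).

Definition bloch (D : set Cn) (f : Cn -> C) : Prop :=
  holo D f /\ (beta D f < +oo)%E.

Definition bnorm (D : set Cn) (f : Cn -> C) : \bar R := ((cabs (f 0))%:E + beta D f)%E.

Definition topo_boundary (D : set Cn) : set Cn := closure D `\` D.

Definition is_max_boundary (D : set Cn) (S : set Cn) : Prop :=
  closed S /\ S `<=` topo_boundary D /\
  forall F : Cn -> C^o, {within closure D, continuous F} -> holo D F ->
    forall z, closure D z -> exists2 w, S w & cabs (F z) <= cabs (F w).

Definition distinguished_boundary (D : set Cn) : set Cn :=
  \bigcap_(S in is_max_boundary D) S.

Definition vanishes_at_dboundary (D : set Cn) (h : Cn -> \bar R) : Prop :=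
  forall eps : R, 0 < eps -> exists2 delta : R, 0 < delta &
    forall z, D z -> (exists2 w, distinguished_boundary D w & `|z - w| < (delta%:C)%C) ->
      (h z < eps%:E)%E.

Definition little_bloch (D : set Cn) (f : Cn -> C) : Prop :=
  bloch D f /\ vanishes_at_dboundary D (Qf D f).

Definition omega_gen (X : (Cn -> C) -> Prop) (D : set Cn) (z : Cn) : \bar R :=
  ereal_sup [set (cabs (f z))%:E | f in [set f | X f /\ f 0 = 0 /\ (bnorm D f <= 1)%E]].

Definition omega (D : set Cn) := omega_gen (bloch D) D.
Definition omega0 (D : set Cn) := omega_gen (little_bloch D) D.

Definition sigma_gen (om : Cn -> \bar R) (D : set Cn) (psi : Cn -> C) : \bar R :=
  ereal_sup [set (om z * Qf D psi z)%E | z in D].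

Definition sigma (D : set Cn) psi := sigma_gen (omega D) D psi.
Definition sigma0 (D : set Cn) psi := sigma_gen (omega0 D) D psi.

Definition supnorm (D : set Cn) (psi : Cn -> C) : \bar R :=
  ereal_sup [set (cabs (psi z))%:E | z in D].

Definition mult (psi f : Cn -> C) : Cn -> C := fun z => psi z * f z.

Definition mult_bounded (X : (Cn -> C) -> Prop) (D : set Cn) (psi : Cn -> C) : Prop :=
  (forall f, X f -> X (mult psi f)) /\
  exists c : R, forall f, X f -> (bnorm D (mult psi f) <= c%:E * bnorm D f)%E.

Definition mult_opnorm (X : (Cn -> C) -> Prop) (D : set Cn) (psi : Cn -> C) : \bar R :=
  ereal_sup [set bnorm D (mult psi f) | f in [set f | X f /\ (bnorm D f <= 1)%E]].

End SCV.

(* Main.v *)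
Require Import Defs.
From HB Require Import structures.
From mathcomp Require Import all_boot all_order all_algebra.
From mathcomp Require Import complex.
From mathcomp Require Import all_classical all_reals all_analysis.
From mathcomp Require Import measurable_realfun.
From mathcomp Require Import ring lra.
Set Implicit Arguments. Unset Strict Implicit. Unset Printing Implicit Defensive.
Import Order.TTheory GRing.Theory Num.Theory.
Import numFieldNormedType.Exports.
Local Open Scope classical_set_scope.
Local Open Scope ring_scope.

(* Applying M_psi to the constant 1 gives ||psi|| <= ||M_psi||, and applying its powers to 1 gives
   |psi(z)|^k <= K_z ||M_psi||^k, hence |psi(z)| <= ||M_psi||. For the upper bound,
   Q_(psi f) <= |psi| Q_f + |f| Q_psi, where |f(z) - f(0)| <= beta_f omega(z).

   Both halves need point evaluations to be bounded on the Bloch space modulo constants, that is,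
   |f(z) - f(0)| <= C_z beta_f. This follows by connectedness of D once the Bergman metric is
   positive definite and locally bounded by a multiple of the Euclidean one. Let q be the squared
   dual norm of the Bergman space, e the evaluation at z, so that K(z, z) = q(e), and A_u the
   functional f |-> grad f(z) u. Differentiating log q(e) twice gives
     H_z(u, u) = q(A_u - lambda e) / q(e),   lambda = <A_u, e> / q(e).
   A linear function vanishing at z bounds this below, and Cauchy's estimates for A_u bound it
   above. The inner product of the dual is recovered from q by polarization (Jordan-von Neumann), so
   that neither completeness of the Bergman space nor a reproducing kernel is needed. *)

(** * Complex numbers and complex line integrals *)

(** The function [log q(e)] can be differentiated because [z |-> ev z] is differentiable in the dual
    norm: a Taylor remainder that is at most [K * t ^+ 2] uniformly on the unit ball of the Bergman
    space is a remainder of squared dual norm at most [K ^+ 2 * t ^+ 4]. The uniformity rests on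
    Cauchy's estimates and on the local domination of |f|^2 by the squared L2 norm. The
    parallelogram law of the dual norm is inherited from that of the L2 norm, and to scale and add
    L2 integrals one must know that the iterated integrands are measurable. Boundedness of [D] puts
    constants and affine functions into the Bergman space: the constants keep [K(z, z)] away from 0,
    the affine functions separate directions. Point evaluations serve the lower bound by turning
    norms of powers of [psi] into values; in the upper bound they show that a function with
    [beta_f = 0], which cannot be normalized, is constant. Since the norms of [R[i]] and of [C^n]
    take values in [R[i]], estimates are stated with real radii and the real modulus [cabs]. *)

Section Cabs.
Variable R : realType.
Local Notation C := (R[i]).
Implicit Types z w : C.

Lemma cabsE z : `|z| = ((cabs z)%:C)%C.
Proof. exact: normc_def. Qed.

Lemma cabs_ge0 z : 0 <= cabs z.
Proof. exact: sqrtr_ge0. Qed.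

Lemma cabs0 : cabs (0 : C) = 0.
Proof. by apply/complexI; rewrite -cabsE normr0. Qed.

Lemma cabs1 : cabs (1 : C) = 1.
Proof. by apply/complexI; rewrite -cabsE normr1. Qed.

Lemma cabsM z w : cabs (z * w) = cabs z * cabs w.
Proof. by apply/complexI; rewrite rmorphM /= -!cabsE normrM. Qed.

Lemma cabsN z : cabs (- z) = cabs z.
Proof. by apply/complexI; rewrite -!cabsE normrN. Qed.

Lemma cabsD z w : cabs (z + w) <= cabs z + cabs w.
Proof. by rewrite -lecR rmorphD /= -!cabsE ler_normD. Qed.

Lemma cabsB z w : cabs (z - w) <= cabs z + cabs w.
Proof. by rewrite (le_trans (cabsD _ _))// cabsN. Qed.

Lemma cabs_distC z w : cabs (z - w) = cabs (w - z).
Proof. by rewrite -cabsN opprB. Qed.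

Lemma cabs_eq0 z : (cabs z == 0) = (z == 0).
Proof.
by rewrite -(normr_eq0 z) cabsE -[0 in RHS]/((0 : R)%:C)%C (inj_eq (@complexI _)).
Qed.

Lemma cabsV z : cabs (z^-1) = (cabs z)^-1.
Proof. by apply/complexI; rewrite fmorphV /= -!cabsE normfV. Qed.

Lemma cabsX z k : cabs (z ^+ k) = cabs z ^+ k.
Proof. by apply/complexI; rewrite rmorphXn /= -!cabsE normrX. Qed.

Lemma cabsR (x : R) : cabs (x%:C)%C = `|x|.
Proof. by rewrite /cabs /= expr0n addr0 sqrtr_sqr. Qed.

Lemma sqr_cabs z : cabs z ^+ 2 = complex.Re z ^+ 2 + complex.Im z ^+ 2.
Proof. by rewrite sqr_sqrtr// addr_ge0// sqr_ge0. Qed.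

Lemma Re_le_cabs z : `|complex.Re z| <= cabs z.
Proof. by rewrite -[leLHS]sqrtr_sqr ler_wsqrtr// lerDl sqr_ge0. Qed.

Lemma Im_le_cabs z : `|complex.Im z| <= cabs z.
Proof. by rewrite -[leLHS]sqrtr_sqr ler_wsqrtr// lerDr sqr_ge0. Qed.

Lemma cabs_le_ReIm z : cabs z <= `|complex.Re z| + `|complex.Im z|.
Proof.
rewrite -(ler_pXn2r (n:=2)) ?nnegrE ?cabs_ge0 ?addr_ge0//.
rewrite sqr_cabs sqrrD !real_normK ?num_real//.
by rewrite addrAC lerDl mulrn_wge0// mulr_ge0.
Qed.

Lemma cabs_conj z : cabs (Num.conj z) = cabs z.
Proof. by apply/complexI; rewrite -!cabsE norm_conjC. Qed.

Lemma mulCconj z : z * Num.conj z = ((cabs z ^+ 2)%:C)%C.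
Proof. by rewrite rmorphXn /= -cabsE normCK. Qed.

Lemma cReD z w : complex.Re (z + w) = complex.Re z + complex.Re w.
Proof. by case: z; case: w. Qed.
Lemma cImD z w : complex.Im (z + w) = complex.Im z + complex.Im w.
Proof. by case: z; case: w. Qed.
Lemma cReN z : complex.Re (- z) = - complex.Re z.
Proof. by case: z. Qed.
Lemma cImN z : complex.Im (- z) = - complex.Im z.
Proof. by case: z. Qed.
Lemma cReB z w : complex.Re (z - w) = complex.Re z - complex.Re w.
Proof. by rewrite cReD cReN. Qed.
Lemma cImB z w : complex.Im (z - w) = complex.Im z - complex.Im w.
Proof. by rewrite cImD cImN. Qed.
Lemma cReM z w : complex.Re (z * w) =
  complex.Re z * complex.Re w - complex.Im z * complex.Im w.
Proof. by case: z; case: w. Qed.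
Lemma cImM z w : complex.Im (z * w) =
  complex.Re z * complex.Im w + complex.Im z * complex.Re w.
Proof. by case: z; case: w => a b c d /=. Qed.

Lemma complex_ext z w : complex.Re z = complex.Re w -> complex.Im z = complex.Im w -> z = w.
Proof. by case: z; case: w => a b c d /= -> ->. Qed.

End Cabs.

(** * Integrals of complex-valued functions over a real interval *)

Section Cint.
Variable R : realType.
Local Notation C := (R[i]).
Notation mu := (@lebesgue_measure R).

(** The epsilon-delta form with [cabs] keeps every bound in [R], whereas the norm of [R[i]] is
    itself an element of [R[i]]. *)
Definition ccontat (f : R -> C) (x : R) :=
  forall e : R, 0 < e -> exists2 d : R, 0 < d &
    forall y, `|y - x| < d -> cabs (f y - f x) < e.

(** Continuity at the end points is two-sided, which spares one-sided limits; the integrands below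
    are defined beyond the interval. *)
Definition ccont (f : R -> C) (a b : R) := forall x, a <= x <= b -> ccontat f x.

Definition cint (f : R -> C) (a b : R) : C :=
  Complex (\int[mu]_(x in `[a, b]) complex.Re (f x)) (\int[mu]_(x in `[a, b]) complex.Im (f x)).

Lemma cvg_epsdelta (f : R -> R) (x l : R) :
  (forall e : R, 0 < e -> exists2 d : R, 0 < d &
    forall y, `|y - x| < d -> `|f y - l| < e) -> f y @[y --> x] --> l.
Proof.
move=> H; apply/cvgrPdist_lt => e /H[d d0 Hd].
by apply/nbhs_ballP; exists d => //= y xy; rewrite distrC Hd// distrC.
Qed.

Lemma ccontat_Re f x : ccontat f x -> {for x, continuous (fun t => complex.Re (f t))}.
Proof.
move=> cf; apply: cvg_epsdelta => e /cf[d d0 H]; exists d => // y yx.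
by rewrite -cReB; apply: le_lt_trans (Re_le_cabs _) _; apply: H.
Qed.

Lemma ccontat_Im f x : ccontat f x -> {for x, continuous (fun t => complex.Im (f t))}.
Proof.
move=> cf; apply: cvg_epsdelta => e /cf[d d0 H]; exists d => // y yx.
by rewrite -cImB; apply: le_lt_trans (Im_le_cabs _) _; apply: H.
Qed.

Lemma integrable_itv_cont (f : R -> R) a b :
  (forall x, a <= x <= b -> {for x, continuous f}) ->
  mu.-integrable `[a, b] (EFin \o f).
Proof.
move=> cf; apply: continuous_compact_integrable; first exact: segment_compact.
by apply: continuous_in_subspaceT => x; rewrite inE /= in_itv /= => /cf.
Qed.

Lemma integrable_Re f a b : ccont f a b ->
  mu.-integrable `[a, b] (EFin \o (fun t => complex.Re (f t))).
Proof. by move=> cf; apply: integrable_itv_cont => x /cf/ccontat_Re. Qed.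

Lemma integrable_Im f a b : ccont f a b ->
  mu.-integrable `[a, b] (EFin \o (fun t => complex.Im (f t))).
Proof. by move=> cf; apply: integrable_itv_cont => x /cf/ccontat_Im. Qed.

Lemma ccontatD f g x : ccontat f x -> ccontat g x -> ccontat (fun t => f t + g t) x.
Proof.
move=> cf cg e e0; have e2 : 0 < e / 2 by rewrite divr_gt0.
have [d d0 H] := cf _ e2; have [d' d'0 H'] := cg _ e2.
exists (Num.min d d'); first by rewrite lt_min d0.
move=> y; rewrite lt_min => /andP[/H ? /H' ?].
rewrite opprD addrACA (le_lt_trans (cabsD _ _))//; lra.
Qed.

Lemma ccontat_cst (c : C) x : ccontat (fun=> c) x.
Proof. by move=> e e0; exists 1 => // y _; rewrite subrr cabs0. Qed.

Lemma ccontatM f g x : ccontat f x -> ccontat g x -> ccontat (fun t => f t * g t) x.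
Proof.
move=> cf cg e e0.
pose A := cabs (f x) + 1; pose B := cabs (g x) + 1.
have A0 : 0 < A by rewrite ltr_wpDl ?cabs_ge0.
have B0 : 0 < B by rewrite ltr_wpDl ?cabs_ge0.
have [d d0 H] := cf (e / 2 / B) (divr_gt0 (divr_gt0 e0 (ltr0Sn _ 1)) B0).
have [d1 d10 H1] := cg (e / 2 / A) (divr_gt0 (divr_gt0 e0 (ltr0Sn _ 1)) A0).
have [d2 d20 H2] := cg 1 ltr01.
exists (Num.min d (Num.min d1 d2)); first by rewrite !lt_min d0 d10.
move=> y; rewrite !lt_min => /and3P[/H Hf /H1 Hg /H2 Hg1].
have -> : f y * g y - f x * g x = (f y - f x) * g y + f x * (g y - g x) by ring.
rewrite (le_lt_trans (cabsD _ _))// !cabsM.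
have gB : cabs (g y) <= B.
  by rewrite -[g y](subrK (g x)) (le_trans (cabsD _ _))// addrC lerD2l ltW.
have h1 : cabs (f y - f x) * cabs (g y) <= e / 2 / B * B.
  by apply: ler_pM; rewrite ?cabs_ge0// ltW.
have h2 : cabs (f x) * cabs (g y - g x) < A * (e / 2 / A).
  rewrite (@le_lt_trans _ _ (cabs (f x) * (e / 2 / A)))//.
    by rewrite ler_wpM2l ?cabs_ge0// ltW.
  by rewrite ltr_pM2r ?ltrDl// !divr_gt0.
rewrite divfK ?gt_eqF// in h1; rewrite [A * _]mulrC divfK ?gt_eqF// in h2.
lra.
Qed.

Lemma cintD f g a b : ccont f a b -> ccont g a b ->
  cint (fun t => f t + g t) a b = cint f a b + cint g a b.
Proof.
move=> cf cg; apply: complex_ext; rewrite ?cReD ?cImD /=.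
- rewrite -RintegralD//; [|exact: integrable_Re|exact: integrable_Re].
  by apply: eq_Rintegral => x _; rewrite cReD.
- rewrite -RintegralD//; [|exact: integrable_Im|exact: integrable_Im].
  by apply: eq_Rintegral => x _; rewrite cImD.
Qed.

Lemma integrableZ_itv (f : R -> R) k a b : mu.-integrable `[a, b] (EFin \o f) ->
  mu.-integrable `[a, b] (EFin \o (fun x => k * f x)).
Proof. by move=> fi; apply: (eq_integrable _ _ _ _ (integrableZl _ k fi)). Qed.

Lemma cintZ c f a b : ccont f a b -> cint (fun t => c * f t) a b = c * cint f a b.
Proof.
move=> cf; have iR := integrable_Re cf; have iI := integrable_Im cf.
apply: complex_ext; rewrite ?cReM ?cImM /=.
- rewrite -RintegralZl// -RintegralZl// -RintegralB//; try exact: integrableZ_itv.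
  by apply: eq_Rintegral => x _; rewrite cReM.
- rewrite -RintegralZl// -RintegralZl// -RintegralD//; try exact: integrableZ_itv.
  by apply: eq_Rintegral => x _; rewrite cImM.
Qed.

Lemma cintB f g a b : ccont f a b -> ccont g a b ->
  cint (fun t => f t - g t) a b = cint f a b - cint g a b.
Proof.
move=> cf cg.
have -> : (fun t => f t - g t) = (fun t => f t + (-1) * g t).
  by apply/funext => t; rewrite mulN1r.
rewrite cintD ?cintZ ?mulN1r// => x xab.
by apply: ccontatM; [exact: ccontat_cst|exact: cg].
Qed.

Lemma cint_split f a b c : a <= c -> c <= b -> ccont f a b ->
  cint f a b = cint f a c + cint f c b.
Proof.
move=> ac cb cf; apply: complex_ext; rewrite ?cReD ?cImD /=.
- rewrite -(Rintegral_itv_obnd_cbnd (r := c)); last first.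
    by apply: integrableS (integrable_Re cf) => //; apply: subset_itv; rewrite bnd_simp.
  rewrite -(@Rintegral_itvB _ _ (BLeft a) (BRight b) c) ?bnd_simp//.
    by rewrite addrC subrK.
  exact: integrable_Re.
- rewrite -(Rintegral_itv_obnd_cbnd (r := c)); last first.
    by apply: integrableS (integrable_Im cf) => //; apply: subset_itv; rewrite bnd_simp.
  rewrite -(@Rintegral_itvB _ _ (BLeft a) (BRight b) c) ?bnd_simp//.
    by rewrite addrC subrK.
  exact: integrable_Im.
Qed.

Lemma Rint_FTC (f F : R -> R) (a b : R) : a <= b -> (forall x : R, {for x, continuous f}) ->
  (forall x : R, is_derive x (1 : R) F (f x)) -> \int[mu]_(x in `[a, b]) f x = F b - F a.
Proof.
rewrite le_eqVlt => /predU1P[<-|ab] cf dF.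
  by rewrite set_itv1 Rintegral_set1 subrr.
rewrite /Rintegral (@continuous_FTC2 _ f F)//.
- exact: continuous_subspaceT.
- split=> [x _||].
  + by have [] := dF x.
  + apply: cvg_at_right_filter; apply: differentiable_continuous.
    by apply/derivable1_diffP; have [] := dF a.
  + apply: cvg_at_left_filter; apply: differentiable_continuous.
    by apply/derivable1_diffP; have [] := dF b.
- by move=> x _; rewrite derive1E; apply: derive_val.
Qed.

Lemma Rint_cst (k a b : R) : a <= b -> \int[mu]_(x in `[a, b]) k = (b - a) * k.
Proof.
move=> ab; pose F := k \*: (id : R -> R).
have dF (x : R) : is_derive x (1 : R) F k.
  by apply: is_derive_eq (is_deriveZ k (is_derive_id x (1:R))) _; rewrite /GRing.scale /= mulr1.
rewrite (Rint_FTC ab (f := fun=> k) _ dF); last by move=> x; exact: cvg_cst.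
transitivity (k * b - k * a); [by []|ring].
Qed.

Lemma Rint_bound (f : R -> R) a b M : a <= b -> mu.-integrable `[a, b] (EFin \o f) ->
  (forall x, a <= x <= b -> `|f x| <= M) ->
  `|\int[mu]_(x in `[a, b]) f x| <= M * (b - a).
Proof.
move=> ab fi fM; rewrite (le_trans (le_normr_Rintegral _ _))//.
have -> : M * (b - a) = \int[mu]_(x in `[a, b]) M.
  by rewrite Rint_cst// mulrC.
apply: le_Rintegral => //.
- exact: integrable_norm fi.
- by apply: integrable_itv_cont => x _; exact: cvg_cst.
Qed.

(** The factor 2 comes from bounding real and imaginary parts separately; it reappears in all of the
    Cauchy estimates. *)
Lemma cint_bound f a b M : a <= b -> ccont f a b ->
  (forall x, a <= x <= b -> cabs (f x) <= M) -> cabs (cint f a b) <= 2 * M * (b - a).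
Proof.
move=> ab cf fM; rewrite (le_trans (cabs_le_ReIm _))//= -mulrA mulr2n mulrDl !mul1r.
apply: lerD; apply: Rint_bound => //.
- exact: integrable_Re.
- by move=> x /fM; apply: le_trans; exact: Re_le_cabs.
- exact: integrable_Im.
- by move=> x /fM; apply: le_trans; exact: Im_le_cabs.
Qed.

Lemma eq_cint f g a b : (forall x, a <= x <= b -> f x = g x) -> cint f a b = cint g a b.
Proof.
by move=> fg; rewrite /cint; congr Complex; apply: eq_Rintegral => x;
  rewrite inE /= in_itv /= => /fg ->.
Qed.

Lemma cint_cst (c : C) a b : a <= b -> cint (fun=> c) a b = ((b - a)%:C)%C * c.
Proof.
by move=> ab; apply: complex_ext; rewrite ?cReM ?cImM /= Rint_cst//; ring.
Qed.

Lemma cint_id a b : a <= b ->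
  cint (fun t => (t%:C)%C) a b = (((b ^+ 2 - a ^+ 2) / 2)%:C)%C.
Proof.
move=> ab; apply: complex_ext => /=; last by rewrite Rint_cst// mulr0.
pose F := 2^-1 \*: ((id : R -> R) ^+ 2).
have dF (x : R) : is_derive x (1 : R) F x.
  apply: is_derive_eq (is_deriveZ (2^-1) (is_deriveX 2 (is_derive_id x (1:R)))) _.
  by rewrite /GRing.scale /=; field.
rewrite (Rint_FTC ab (f := id) _ dF); last by move=> x; exact: cvg_id.
transitivity (2^-1 * b ^+ 2 - 2^-1 * a ^+ 2); [by []|ring].
Qed.

End Cint.

(** * Goursat's theorem and Cauchy's formula *)

Section Goursat.
Variable R : realType.
Local Notation C := (R[i]).

Lemma ccontatB (f g : R -> C) x : ccontat f x -> ccontat g x -> ccontat (fun t => f t - g t) x.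
Proof.
move=> cf cg; rewrite (_ : (fun t => _) = (fun t => f t + (-1) * g t)).
  apply: ccontatD => //; apply: ccontatM => //; exact: ccontat_cst.
by apply/funext => t; rewrite mulN1r.
Qed.

(** Complex differentiability at [s + it] of a function given in real coordinates: the linear part
    is multiplication by [A], so the Cauchy-Riemann equations are built in. *)
Definition cderat (g : R -> R -> C) (s t : R) (A : C) :=
  forall e : R, 0 < e -> exists2 d : R, 0 < d &
    forall h k, `|h| < d -> `|k| < d ->
      cabs (g (s + h) (t + k) - g s t - A * Complex h k) <= e * (`|h| + `|k|).

(** The contour integral along the boundary of the rectangle with lower left corner [a + ic],
    counterclockwise; ['i] is the velocity on the vertical sides. *)
Definition rectint (g : R -> R -> C) (a c w h : R) : C :=
  cint (fun s => g s c) a (a + w) - cint (fun s => g s (c + h)) a (a + w)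
  + 'i%C * (cint (g (a + w)) c (c + h) - cint (g a) c (c + h)).

Lemma cderat_conts g s t A : cderat g s t A -> ccontat (fun x => g x t) s.
Proof.
move=> dg e e0; have [d d0 H] := dg 1 ltr01.
pose M := 1 + cabs A; have M0 : 0 < M by rewrite ltr_wpDr ?cabs_ge0.
exists (Num.min d (e / M)); first by rewrite lt_min d0 divr_gt0.
move=> y; rewrite lt_min => /andP[yd ye].
have := H (y - s) 0 yd; rewrite normr0 d0 => /(_ isT).
rewrite !addr0 mul1r [s + _]addrC subrK => H1.
have -> : g y t - g s t = (g y t - g s t - A * Complex (y - s) 0) + A * Complex (y - s) 0.
  by rewrite subrK.
rewrite (le_lt_trans (cabsD _ _))// cabsM -[Complex _ 0]/((y - s)%:C)%C cabsR.
rewrite (@le_lt_trans _ _ (M * `|y - s|))//.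
  by rewrite /M mulrDl mul1r lerD2r.
by rewrite mulrC -ltr_pdivlMr.
Qed.

Lemma cderat_contt g s t A : cderat g s t A -> ccontat (g s) t.
Proof.
move=> dg e e0; have [d d0 H] := dg 1 ltr01.
pose M := 1 + cabs A; have M0 : 0 < M by rewrite ltr_wpDr ?cabs_ge0.
exists (Num.min d (e / M)); first by rewrite lt_min d0 divr_gt0.
move=> y; rewrite lt_min => /andP[yd ye].
have := H 0 (y - t); rewrite normr0 d0 => /(_ isT yd).
rewrite addr0 add0r mul1r [t + _]addrC subrK => H1.
have -> : g s y - g s t = (g s y - g s t - A * Complex 0 (y - t)) + A * Complex 0 (y - t).
  by rewrite subrK.
rewrite (le_lt_trans (cabsD _ _))// cabsM.
have -> : cabs (Complex 0 (y - t)) = `|y - t|.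
  by rewrite /cabs /= expr0n add0r sqrtr_sqr.
rewrite (@le_lt_trans _ _ (M * `|y - t|))//.
  by rewrite /M mulrDl mul1r lerD2r.
by rewrite mulrC -ltr_pdivlMr.
Qed.

Definition rcont (g : R -> R -> C) (a c w h : R) :=
  forall s t, a <= s <= a + w -> c <= t <= c + h ->
    ccontat (fun x => g x t) s /\ ccontat (g s) t.

Lemma rcont_h g a c w h t : rcont g a c w h -> c <= t <= c + h ->
  ccont (fun x => g x t) a (a + w).
Proof. by move=> gc ct s sa; have [] := gc _ _ sa ct. Qed.

Lemma rcont_v g a c w h s : rcont g a c w h -> a <= s <= a + w ->
  ccont (g s) c (c + h).
Proof. by move=> gc sa t ct; have [] := gc _ _ sa ct. Qed.

(** Each inner edge is traversed twice in opposite directions, so only the outer boundary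
    survives. *)
Lemma rectint_quarter (g : R -> R -> C) (a c w h : R) : 0 <= w -> 0 <= h -> rcont g a c (w + w) (h + h) ->
  rectint g a c (w + w) (h + h) =
  rectint g a c w h + rectint g (a + w) c w h +
  rectint g a (c + h) w h + rectint g (a + w) (c + h) w h.
Proof.
move=> w0 h0 gc; rewrite /rectint -!(addrA a w w) -!(addrA c h h).
have cc : c <= c <= c + (h + h) by lra.
have ch : c <= c + h <= c + (h + h) by lra.
have chh : c <= c + (h + h) <= c + (h + h) by lra.
have aa : a <= a <= a + (w + w) by lra.
have aw : a <= a + w <= a + (w + w) by lra.
have aww : a <= a + (w + w) <= a + (w + w) by lra.
have [/andP[aw1 aw2] /andP[ch1 ch2]] := (aw, ch).
rewrite (cint_split aw1 aw2 (rcont_h gc cc)) (cint_split aw1 aw2 (rcont_h gc chh)).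
rewrite (cint_split ch1 ch2 (rcont_v gc aa)) (cint_split ch1 ch2 (rcont_v gc aww)).
ring.
Qed.

Lemma ccontat_real (x : R) : ccontat (fun y => (y%:C)%C) x.
Proof. by move=> e e0; exists e => // y; rewrite -rmorphB /= cabsR. Qed.

Lemma cint_affine (al be : C) (a w : R) : 0 <= w ->
  cint (fun s => al + be * (s%:C)%C) a (a + w) =
  (w%:C)%C * al + be * ((w%:C)%C * ((a%:C)%C + (w%:C)%C / 2%:R)).
Proof.
move=> w0; have aw : a <= a + w by rewrite lerDl.
have c1 : ccont (fun=> al) a (a + w) by move=> x _; exact: ccontat_cst.
have c2 : ccont (fun s => (s%:C)%C) a (a + w) by move=> x _; exact: ccontat_real.
have c3 : ccont (fun s => be * (s%:C)%C) a (a + w).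
  by move=> x _; apply: ccontatM; [exact: ccontat_cst|exact: ccontat_real].
rewrite (cintD c1 c3) (cintZ _ c2) (cint_cst _ aw) (cint_id aw).
have -> : a + w - a = w by ring.
have -> : ((a + w) ^+ 2 - a ^+ 2) / 2 = w * (a + w / 2) by field.
by rewrite rmorphM rmorphD /= rmorphM /= fmorphV rmorph_nat.
Qed.

Lemma rectint_affine (al be : C) (a c w h : R) : 0 <= w -> 0 <= h ->
  rectint (fun s t => al + be * Complex s t) a c w h = 0.
Proof.
move=> w0 h0.
have H1 t : cint (fun s => al + be * Complex s t) a (a + w) =
    (w%:C)%C * (al + be * 'i%C * (t%:C)%C) + be * ((w%:C)%C * ((a%:C)%C + (w%:C)%C / 2%:R)).
  rewrite -cint_affine//; apply: eq_cint => s _.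
  rewrite (complexE (Complex s t)) /=; ring.
have H2 s : cint (fun t => al + be * Complex s t) c (c + h) =
    (h%:C)%C * (al + be * (s%:C)%C) + be * 'i%C * ((h%:C)%C * ((c%:C)%C + (h%:C)%C / 2%:R)).
  rewrite -cint_affine//; apply: eq_cint => t _.
  rewrite (complexE (Complex s t)) /=; ring.
rewrite /rectint !H1 !H2 !rmorphD /=; ring.
Qed.

Lemma rectintD (f g : R -> R -> C) (a c w h : R) : 0 <= w -> 0 <= h -> rcont f a c w h -> rcont g a c w h ->
  rectint (fun s t => f s t + g s t) a c w h = rectint f a c w h + rectint g a c w h.
Proof.
move=> w0 h0 cf cg; rewrite /rectint.
have cc : c <= c <= c + h by rewrite lexx lerDl.
have ch : c <= c + h <= c + h by rewrite lexx lerDl h0.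
have aa : a <= a <= a + w by rewrite lexx lerDl.
have aw : a <= a + w <= a + w by rewrite lexx lerDl w0.
rewrite (cintD (rcont_h cf cc) (rcont_h cg cc)) (cintD (rcont_h cf ch) (rcont_h cg ch)).
rewrite (cintD (rcont_v cf aa) (rcont_v cg aa)) (cintD (rcont_v cf aw) (rcont_v cg aw)).
ring.
Qed.

(** Subtracting the affine function leaves the contour integral unchanged by [rectint_affine]; then
    each of the four sides contributes at most [2 * M] times its length. *)
Lemma rectint_small (g : R -> R -> C) (al be : C) (a c w h M : R) : 0 <= w -> 0 <= h -> rcont g a c w h ->
  (forall s t, a <= s <= a + w -> c <= t <= c + h ->
    cabs (g s t - (al + be * Complex s t)) <= M) ->
  cabs (rectint g a c w h) <= 4 * M * (w + h).
Proof.
move=> w0 h0 gc gM.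
pose f s t : C := al + be * Complex s t; pose u s t : C := g s t - f s t.
have cf s t : ccontat (fun x => f x t) s /\ ccontat (f s) t.
  have cs : ccontat (fun x => Complex x t) s.
    move=> e e0; exists e => // y; suff -> : Complex y t - Complex s t = ((y - s)%:C)%C.
      by rewrite cabsR.
    by apply: complex_ext; rewrite ?cReB ?cImB //= subrr.
  have ct : ccontat (fun x => Complex s x) t.
    move=> e e0; exists e => // y; suff -> : Complex s y - Complex s t = Complex 0 (y - t).
      by rewrite /cabs /= expr0n add0r sqrtr_sqr.
    by apply: complex_ext; rewrite ?cReB ?cImB //= subrr.
  by split; apply: ccontatD (ccontat_cst _ _) (ccontatM (ccontat_cst _ _) _).
have cu : rcont u a c w h.
  move=> s t sa tc; have [? ?] := gc _ _ sa tc; have [? ?] := cf s t.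
  by split; exact: ccontatB.
have cc : c <= c <= c + h by lra.
have ch : c <= c + h <= c + h by lra.
have aa : a <= a <= a + w by lra.
have aw : a <= a + w <= a + w by lra.
have -> : rectint g a c w h = rectint u a c w h.
  rewrite -[RHS]addr0 -(rectint_affine al be a c w0 h0) -/f.
  rewrite -(rectintD w0 h0 cu); last by move=> s t _ _; exact: cf.
  have gE : g = fun s t => u s t + f s t.
    by apply/funext => s; apply/funext => t; rewrite /u subrK.
  by rewrite {1}gE.
rewrite /rectint.
have b1 t : c <= t <= c + h -> cabs (cint (fun s => u s t) a (a + w)) <= 2 * M * w.
  move=> tc; rewrite (le_trans (@cint_bound _ _ a (a + w) M _ _ _)) ?lerDl//.
  - exact: rcont_h cu tc.
  - by move=> x ax; exact: gM.
  - by rewrite [a + w]addrC addrK.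
have b2 s : a <= s <= a + w -> cabs (cint (u s) c (c + h)) <= 2 * M * h.
  move=> sa; rewrite (le_trans (@cint_bound _ _ c (c + h) M _ _ _)) ?lerDl//.
  - exact: rcont_v cu sa.
  - by move=> x ax; exact: gM.
  - by rewrite [c + h]addrC addrK.
rewrite (le_trans (cabsD _ _))// cabsM.
have -> : cabs ('i%C : C) = 1 by rewrite /cabs /= expr0n add0r expr1n sqrtr1.
rewrite mul1r; have := cabsB (cint (fun s => u s c) a (a + w)) (cint (fun s => u s (c + h)) a (a + w)).
have := cabsB (cint (u (a + w)) c (c + h)) (cint (u a) c (c + h)).
have := b1 _ cc; have := b1 _ ch; have := b2 _ aa; have := b2 _ aw.
move: (cabs _) (cabs _) (cabs _) (cabs _) (cabs _) (cabs _) => x1 x2 x3 x4 x5 x6.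
clear; lra.
Qed.

Lemma two_pow_gt (x : R) : exists n : nat, x < 2 ^+ n.
Proof.
have [n xn] : exists n : nat, x < n%:R.
  exists (Num.truncn `|x|).+1; rewrite (le_lt_trans (ler_norm _))//.
  by have /andP[] := truncn_itv (normr_ge0 x).
exists n; rewrite (lt_le_trans xn)// -natrX ler_nat ltnW//; exact: ltn_expl.
Qed.

Lemma quarter_le (l x1 x2 x3 x4 : R) : l <= x1 + x2 + x3 + x4 ->
  l <= 4 * x1 \/ l <= 4 * x2 \/ l <= 4 * x3 \/ l <= 4 * x4.
Proof.
move=> H; case: (leP l (4 * x1)) => ?; first by left.
case: (leP l (4 * x2)) => ?; first by right; left.
case: (leP l (4 * x3)) => ?; first by right; right; left.
by right; right; right; lra.
Qed.

Lemma bisect_itv (x w w' X W : R) : 0 < w' -> w = w' + w' -> X <= x -> x + w <= W ->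
  [/\ x + w' <= W, X <= x + w', x + w' + w' <= W, x + w' <= x + w &
      x + w' + w' <= x + w /\ x <= x + w'].
Proof. by move=> *; split; [lra..|split; lra]. Qed.

(* Bisection: a rectangle with nonzero boundary integral contains, at every
   scale, one carrying at least a quarter of it; at the limit point the
   affine approximation makes the integral negligible against the area. *)
Theorem goursat (g : R -> R -> C) (a c W H : R) : 0 < W -> 0 < H ->
  (forall s t, a <= s <= a + W -> c <= t <= c + H -> exists A, cderat g s t A) ->
  rectint g a c W H = 0.
Proof.
move=> W0 H0 dg.
have gc : rcont g a c W H.
  move=> s t sa tc; have [A dA] := dg _ _ sa tc.
  by split; [exact: cderat_conts dA|exact: cderat_contt dA].
pose w n := W / 2 ^+ n; pose h n := H / 2 ^+ n.
have p2 n : 0 < 2 ^+ n :> R by rewrite exprn_gt0.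
have w0 n : 0 < w n by rewrite divr_gt0.
have h0 n : 0 < h n by rewrite divr_gt0.
have wS n : w n = w n.+1 + w n.+1.
  by rewrite /w exprS invfM; field; rewrite gt_eqF.
have hS n : h n = h n.+1 + h n.+1.
  by rewrite /h exprS invfM; field; rewrite gt_eqF.
pose inR n (p : R * R) := [/\ a <= p.1, p.1 + w n <= a + W, c <= p.2 & p.2 + h n <= c + H].
pose L n (p : R * R) := cabs (rectint g p.1 p.2 (w n) (h n)).
(* The premise [inR n p] sits inside the existential, so that [choice] yields a total selection
   function. *)
have step n p : exists q : R * R, inR n p ->
   [/\ inR n.+1 q, p.1 <= q.1, q.1 + w n.+1 <= p.1 + w n, p.2 <= q.2 &
      q.2 + h n.+1 <= p.2 + h n] /\ L n p <= 4 * L n.+1 q.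
  case: (pselect (inR n p)) => [|np]; last by exists p.
  case: p => x y [/= ax xa cy yc].
  have E : L n (x, y) <= L n.+1 (x, y) + L n.+1 (x + w n.+1, y) +
     L n.+1 (x, y + h n.+1) + L n.+1 (x + w n.+1, y + h n.+1).
    rewrite /L /= wS hS (rectint_quarter (ltW (w0 _)) (ltW (h0 _))); last first.
      rewrite -wS -hS => s t /andP[? ?] /andP[? ?]; apply: gc; lra.
    by do 2 (rewrite (le_trans (cabsD _ _))// lerD2r); exact: cabsD.
  have [b1 b2 b3 b4 [b5 b6]] := bisect_itv (w0 n.+1) (wS n) ax xa.
  have [d1 d2 d3 d4 [d5 d6]] := bisect_itv (h0 n.+1) (hS n) cy yc.
  have [k1|[k1|[k1|k1]]] := quarter_le E.
  - by exists (x, y) => _; split.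
  - by exists (x + w n.+1, y) => _; split.
  - by exists (x, y + h n.+1) => _; split.
  - by exists (x + w n.+1, y + h n.+1) => _; split.
have [F HF] := choice (fun np : nat * (R * R) => step np.1 np.2).
pose P := fix P n := if n is m.+1 then F (m, P m) else (a, c).
have PR n : inR n (P n).
  elim: n => [|n IH]; last by have [[]] := HF (n, P n) IH.
  by split => //=; rewrite /w /h expr0 divr1.
have PS n := HF (n, P n) (PR n).
have Lpow n : L 0 (a, c) <= 4 ^+ n * L n (P n).
  elim: n => [|n IH]; first by rewrite expr0 mul1r.
  rewrite (le_trans IH)// exprSr -mulrA ler_wpM2l ?exprn_ge0//.
  by have [_] := PS n.
have mono n m : [/\ (P n).1 <= (P (n + m)%N).1, (P (n + m)%N).1 + w (n + m)%N <= (P n).1 + w n,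
    (P n).2 <= (P (n + m)%N).2 & (P (n + m)%N).2 + h (n + m)%N <= (P n).2 + h n].
  elim: m => [|m [i1 i2 i3 i4]]; first by rewrite addn0.
  have [[_ j1 j2 j3 j4] _] := PS (n + m)%N.
  by rewrite addnS; split; [exact: le_trans j1|exact: le_trans i2|exact: le_trans j3|exact: le_trans i4].
(* Any left edge lies to the left of any right edge: compare both with the rectangle at level
   [n + m]. Hence the suprema of the corners lie in all the rectangles. *)
have bd1 n m : (P m).1 <= (P n).1 + w n.
  have [i1 _ _ _] := mono m n; have [_ j2 _ _] := mono n m.
  rewrite addnC in j2; have := w0 (m + n)%N; lra.
have bd2 n m : (P m).2 <= (P n).2 + h n.
  have [_ _ i1 _] := mono m n; have [_ _ _ j2] := mono n m.
  rewrite addnC in j2; have := h0 (m + n)%N; lra.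
pose X := sup (range (fun n => (P n).1)); pose Y := sup (range (fun n => (P n).2)).
have sX : has_sup (range (fun n => (P n).1)).
  by split; [exists (P 0).1; exists 0|exists ((P 0).1 + w 0) => _ [m _ <-]].
have sY : has_sup (range (fun n => (P n).2)).
  by split; [exists (P 0).2; exists 0|exists ((P 0).2 + h 0) => _ [m _ <-]].
have X1 n : (P n).1 <= X by apply: ub_le_sup; [case: sX|exists n].
have Y1 n : (P n).2 <= Y by apply: ub_le_sup; [case: sY|exists n].
have X2 n : X <= (P n).1 + w n by apply: ge_sup; [case: sX|move=> _ [m _ <-]].
have Y2 n : Y <= (P n).2 + h n by apply: ge_sup; [case: sY|move=> _ [m _ <-]].
have XR : a <= X <= a + W.
  by have := X1 0; have := X2 0; rewrite /= /w expr0 divr1 => -> ->.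
have YR : c <= Y <= c + H.
  by have := Y1 0; have := Y2 0; rewrite /= /h expr0 divr1 => -> ->.
have [A dA] := dg _ _ XR YR.
suff small e : 0 < e -> L 0 (a, c) <= e * (4 * (W + H) ^+ 2).
  apply/eqP; rewrite -cabs_eq0 eq_le cabs_ge0 andbT.
  have -> : cabs (rectint g a c W H) = L 0 (a, c) by rewrite /L /w /h /= expr0 !divr1.
  apply/ler_addgt0Pl => e e0; rewrite addr0.
  have K0 : 0 < 4 * (W + H) ^+ 2 by rewrite mulr_gt0// exprn_gt0// addr_gt0.
  by have := small _ (divr_gt0 e0 K0); rewrite divfK ?gt_eqF.
move=> e0; have [d d0 Hd] := dA e e0.
(* At this level the rectangle fits into the range where the affine approximation at [(X, Y)] is
   valid. Its half-perimeter is [(W + H) / 2 ^+ n], whose square cancels the factor [4 ^+ n]. *)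
have [n nlt] := two_pow_gt ((W + H) / d).
have whd : w n + h n < d.
  by rewrite -mulrDl ltr_pdivrMr// mulrC -ltr_pdivrMr.
have [ax xa cy yc] := PR n.
have gcn : rcont g (P n).1 (P n).2 (w n) (h n).
  move=> s t /andP[? ?] /andP[? ?]; apply: gc; lra.
have := X1 n; have := X2 n; have := Y1 n; have := Y2 n => y2 y1 x2 x1.
have := w0 n; have := h0 n => hn wn.
have Ln : L n (P n) <= 4 * (e * (w n + h n)) * (w n + h n).
  apply: (@rectint_small g (g X Y - A * Complex X Y) A _ _ _ _ _ (ltW wn) (ltW hn) gcn).
  move=> s t /andP[s1 s2] /andP[t1 t2].
  have sX' : `|s - X| <= w n by rewrite ler_norml; lra.
  have tY' : `|t - Y| <= h n by rewrite ler_norml; lra.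
  have := Hd (s - X) (t - Y).
  rewrite (le_lt_trans sX') ?(le_lt_trans tY'); try lra.
  move=> /(_ isT isT); rewrite ![_ + (_ - _)]addrC !subrK => Hd'.
  have -> : g s t - (g X Y - A * Complex X Y + A * Complex s t) =
     g s t - g X Y - A * Complex (s - X) (t - Y).
    have -> : Complex (s - X) (t - Y) = Complex s t - Complex X Y :> C by [].
    ring.
  rewrite (le_trans Hd')// ler_pM2l//; lra.
rewrite (le_trans (Lpow n))//.
have -> : e * (4 * (W + H) ^+ 2) = 4 ^+ n * (4 * (e * (w n + h n)) * (w n + h n)).
  rewrite /w /h -mulrDl; have -> : 4 = 2 * 2 :> R by ring.
  rewrite exprMn; field; rewrite gt_eqF//.
by rewrite ler_wpM2l ?exprn_ge0.
Qed.

End Goursat.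

(** * The complex exponential and Cauchy's formula for the derivative at the centre of a circle *)

Section CauchyFormula.
Variable R : realType.
Local Notation C := (R[i]).
Implicit Types phi psi : C -> C.

Lemma is_derive_epsdelta (f : R -> R) (x d : R) : is_derive x (1 : R) f d ->
  forall e, 0 < e -> exists2 r : R, 0 < r &
    forall h, `|h| < r -> `|f (x + h) - f x - d * h| <= e * `|h|.
Proof.
move=> [df <-] e e0; have /cvgrPdist_le /(_ _ e0) := df.
move=> /nbhs_ballP [r r0 H].
exists r => // h hr; have [->|h0] := eqVneq h 0.
  by rewrite addr0 subrr mulr0 subr0 normr0 mulr0.
have : ball (0 : R) r h by rewrite /ball /= sub0r normrN.
move=> /H /(_ h0).
rewrite /GRing.scale /= mulr1 distrC [h + x]addrC => H1.
have -> : f (x + h) - f x - 'D_1 f x * h = h * (h^-1 * (f (x + h) - f x) - 'D_1 f x).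
  by rewrite mulrBr mulrA divff// mul1r [h * _]mulrC.
by rewrite normrM mulrC ler_wpM2r.
Qed.

(** The exponential of [s + it]; it maps the vertical line [s = ln rho] onto the circle of radius
    [rho] about 0. *)
Definition cexp (s t : R) : C := Complex (expR s * cos t) (expR s * sin t).

Lemma cabs_cexp s t : cabs (cexp s t) = expR s.
Proof.
by rewrite /cabs /= !exprMn -mulrDr cos2Dsin2 mulr1 sqrtr_sqr ger0_norm ?expR_ge0.
Qed.

Lemma cexpD s t h k : cexp (s + h) (t + k) = cexp s t * cexp h k.
Proof. by apply: complex_ext; rewrite ?cReM ?cImM /= expRD ?cosD ?sinD; ring. Qed.

Lemma cexp0 : cexp 0 0 = 1.
Proof. by rewrite /cexp expR0 cos0 sin0 mulr0 mulr1. Qed.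

Lemma cexpNK s t : cexp s t * cexp (- s) (- t) = 1.
Proof. by rewrite -cexpD !subrr cexp0. Qed.

Lemma cexp_periodic s : cexp s (pi *+ 2) = cexp s 0.
Proof. by rewrite /cexp cos2pi sin2pi cos0 sin0. Qed.

Lemma cexpN_periodic s : cexp s (- (pi *+ 2)) = cexp s 0.
Proof. by rewrite /cexp cosN sinN cos2pi sin2pi cos0 sin0 oppr0. Qed.

Lemma cexp_near0 e : 0 < e -> exists2 d : R, 0 < d &
  forall h k, `|h| < d -> `|k| < d ->
    cabs (cexp h k - 1 - Complex h k) <= e * (`|h| + `|k|).
Proof.
(* The bound [e' <= 1] keeps [expR h] below 2; the total error is then at most
   [e' * |h| + 5 * e' * |k|], which [e / 8] absorbs. *)
move=> e0; pose e' := Num.min 1 (e / 8).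
have e'0 : 0 < e' by rewrite lt_min ltr01 divr_gt0.
have [d1 d10 H1] := is_derive_epsdelta (is_derive_expR 0) e'0.
have [d2 d20 H2] := is_derive_epsdelta (is_derive_cos 0) e'0.
have [d3 d30 H3] := is_derive_epsdelta (is_derive_sin 0) e'0.
exists (Num.min (Num.min d1 (e' / 2)) (Num.min d2 d3)).
  by rewrite !lt_min d10 d20 d30 divr_gt0.
move=> h k; rewrite !lt_min => /andP[/andP[hd1 he] _] /andP[_ /andP[kd2 kd3]].
have := H1 _ hd1; have := H2 _ kd2; have := H3 _ kd3.
rewrite !add0r expR0 cos0 sin0 oppr0 !mul0r ?addr0 !subr0 ?addr0 !mul1r => s3 c2 e1.
have e1' : e' <= 1 by rewrite ge_min lexx.
have e8 : e' <= e / 8 by rewrite ge_min lexx orbT.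
have h0 := normr_ge0 h; have k0 := normr_ge0 k.
have E1 : `|expR h - 1| <= e'.
  have -> : expR h - 1 = (expR h - 1 - h) + h by ring.
  rewrite (le_trans (ler_normD _ _))//.
  have : e' * `|h| <= 1 * `|h| by rewrite ler_wpM2r.
  lra.
have E2 : `|expR h| <= 2.
  have -> : expR h = (expR h - 1) + 1 by ring.
  rewrite (le_trans (ler_normD _ _))// normr1; lra.
rewrite (le_trans (cabs_le_ReIm _))// !cReB !cImB /= subr0.
have -> : expR h * cos k - 1 - h = expR h * (cos k - 1) + (expR h - 1 - h) by ring.
have -> : expR h * sin k - k = expR h * (sin k - k) + (expR h - 1) * k by ring.
have B1 : `|expR h * (cos k - 1)| <= 2 * (e' * `|k|) by rewrite normrM ler_pM.
have B2 : `|expR h * (sin k - k)| <= 2 * (e' * `|k|) by rewrite normrM ler_pM.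
have B3 : `|(expR h - 1) * k| <= e' * `|k| by rewrite normrM ler_wpM2r.
have B4 := ler_normD (expR h * (cos k - 1)) (expR h - 1 - h).
have B5 := ler_normD (expR h * (sin k - k)) ((expR h - 1) * k).
have B6 : e' * `|h| <= e / 8 * `|h| by rewrite ler_wpM2r.
have B7 : e' * `|k| <= e / 8 * `|k| by rewrite ler_wpM2r.
have B8 : 0 <= e * `|h| by rewrite mulr_ge0// ltW.
have B9 : 0 <= e * `|k| by rewrite mulr_ge0// ltW.
lra.
Qed.

Lemma cderat_cexp s t : cderat cexp s t (cexp s t).
Proof.
move=> e e0; have [d d0 H] := cexp_near0 (divr_gt0 e0 (expR_gt0 s)).
exists d => // h k hd kd.
have -> : cexp (s + h) (t + k) - cexp s t - cexp s t * Complex h k =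
  cexp s t * (cexp h k - 1 - Complex h k) by rewrite cexpD; ring.
rewrite cabsM cabs_cexp -ler_pdivlMl ?expR_gt0// mulrA [_^-1 * _]mulrC.
exact: H.
Qed.

Lemma cderat_neg (g : R -> R -> C) s t A : cderat g (- s) (- t) A ->
  cderat (fun s t => g (- s) (- t)) s t (- A).
Proof.
move=> dg e e0; have [d d0 H] := dg e e0; exists d => // h k hd kd.
have := H (- h) (- k); rewrite !normrN => /(_ hd kd).
rewrite !opprD; congr (cabs (_ - _) <= _).
have -> : Complex (- h) (- k) = - Complex h k :> C by [].
by rewrite mulrN mulNr.
Qed.

Lemma cabs_Complex_le (h k : R) : cabs (Complex h k) <= `|h| + `|k|.
Proof. exact: cabs_le_ReIm. Qed.

Lemma cderat_lip g s t A : cderat g s t A -> exists2 d : R, 0 < d &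
  forall h k, `|h| < d -> `|k| < d -> cabs (g (s + h) (t + k) - g s t) <=
     (1 + cabs A) * (`|h| + `|k|).
Proof.
move=> /(_ 1 ltr01)[d d0 H]; exists d => // h k hd kd.
have -> : g (s + h) (t + k) - g s t =
  (g (s + h) (t + k) - g s t - A * Complex h k) + A * Complex h k by rewrite subrK.
rewrite (le_trans (cabsD _ _))// mulrDl lerD ?H// cabsM.
by rewrite ler_wpM2l ?cabs_ge0 ?cabs_Complex_le.
Qed.

Lemma cderatM (f g : R -> R -> C) s t A B : cderat f s t A -> cderat g s t B ->
  cderat (fun s t => f s t * g s t) s t (A * g s t + f s t * B).
Proof.
move=> df dg e e0.
have [d1 d10 L1] := cderat_lip df; have [d2 d20 L2] := cderat_lip dg.
pose K := (1 + cabs A) * (1 + cabs B).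
have K0 : 0 < K by rewrite mulr_gt0// ltr_wpDr ?cabs_ge0.
pose F := 1 + cabs (f s t); have F0 : 0 < F by rewrite ltr_wpDr ?cabs_ge0.
pose G := 1 + cabs (g s t); have G0 : 0 < G by rewrite ltr_wpDr ?cabs_ge0.
have [d3 d30 H3] := df (e / 3 / G) (divr_gt0 (divr_gt0 e0 (ltr0Sn _ 2)) G0).
have [d4 d40 H4] := dg (e / 3 / F) (divr_gt0 (divr_gt0 e0 (ltr0Sn _ 2)) F0).
(* Keeping both [|h|] and [|k|] below this value makes their sum at most [e / 3 / K], so the product
   of the two increments uses up a third of [e]. *)
have e6 : 0 < e / 6 / K by rewrite !divr_gt0.
exists (Num.min (Num.min (Num.min d1 d2) (Num.min d3 d4)) (e / 6 / K)).
  by rewrite !lt_min d10 d20 d30 d40.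
move=> h k; rewrite !lt_min => /andP[/andP[/andP[h1 h2] /andP[h3 h4]] h5].
move=> /andP[/andP[/andP[k1 k2] /andP[k3 k4]] k5].
have l1 := L1 _ _ h1 k1; have l2 := L2 _ _ h2 k2.
have l3 := H3 _ _ h3 k3; have l4 := H4 _ _ h4 k4.
set z := Complex h k in l3 l4 *.
set f' := f (s + h) (t + k) in l1 l3 *; set g' := g (s + h) (t + k) in l2 l4 *.
have -> : f' * g' - f s t * g s t - (A * g s t + f s t * B) * z =
  (f' - f s t) * (g' - g s t) + (f' - f s t - A * z) * g s t + f s t * (g' - g s t - B * z).
  by ring.
set N := `|h| + `|k|; have N0 : 0 <= N by rewrite addr_ge0.
rewrite (le_trans (cabsD _ _))//.
have b1 : cabs (f s t * (g' - g s t - B * z)) <= F * (e / 3 / F * N).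
  by rewrite cabsM ler_pM ?cabs_ge0// /F lerDr.
have b2 : cabs ((f' - f s t - A * z) * g s t) <= (e / 3 / G * N) * G.
  by rewrite cabsM ler_pM ?cabs_ge0// /G lerDr.
have b3 : cabs ((f' - f s t) * (g' - g s t)) <= K * N * N.
  have -> : K * N * N = ((1 + cabs A) * N) * ((1 + cabs B) * N) by rewrite /K; ring.
  by rewrite cabsM ler_pM ?cabs_ge0.
have b4 : K * N * N <= e / 3 * N.
  rewrite ler_wpM2r// mulrC -ler_pdivlMr//.
  have : e / 3 / K = e / 6 / K + e / 6 / K by field; rewrite gt_eqF.
  by rewrite /N => ->; apply/ltW/ltrD.
have b5 : F * (e / 3 / F * N) = e / 3 * N by field; rewrite gt_eqF.
have b6 : (e / 3 / G * N) * G = e / 3 * N by field; rewrite gt_eqF.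
rewrite b5 in b1; rewrite b6 in b2.
have := cabsD ((f' - f s t) * (g' - g s t)) ((f' - f s t - A * z) * g s t).
lra.
Qed.

Definition cder phi (z A : C) := forall e : R, 0 < e -> exists2 d : R, 0 < d &
  forall h, cabs h < d -> cabs (phi (z + h) - phi z - A * h) <= e * cabs h.

Lemma cderat_comp phi (g : R -> R -> C) s t A B : cderat g s t B -> cder phi (g s t) A ->
  cderat (fun s t => phi (g s t)) s t (A * B).
Proof.
move=> dg dp e e0; have [d1 d10 L1] := cderat_lip dg.
pose K := 1 + cabs B; have K0 : 0 < K by rewrite ltr_wpDr ?cabs_ge0.
pose F := 1 + cabs A; have F0 : 0 < F by rewrite ltr_wpDr ?cabs_ge0.
have [d2 d20 H2] := dp (e / 2 / K) (divr_gt0 (divr_gt0 e0 (ltr0Sn _ 1)) K0).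
have [d3 d30 H3] := dg (e / 2 / F) (divr_gt0 (divr_gt0 e0 (ltr0Sn _ 1)) F0).
have d20' : 0 < d2 / 2 / K by rewrite !divr_gt0.
exists (Num.min (Num.min d1 d3) (d2 / 2 / K)); first by rewrite !lt_min d10 d30.
move=> h k; rewrite !lt_min => /andP[/andP[h1 h3] h2] /andP[/andP[k1 k3] k2].
have l1 := L1 _ _ h1 k1; have l3 := H3 _ _ h3 k3.
set z := Complex h k in l3 *; set g' := g (s + h) (t + k) in l1 l3 *.
set N := `|h| + `|k| in l1 l3 *; have N0 : 0 <= N by rewrite addr_ge0.
have lt2 : cabs (g' - g s t) < d2.
  rewrite (le_lt_trans l1)// mulrC -ltr_pdivlMr//.
  have : d2 / K = d2 / 2 / K + d2 / 2 / K by field; rewrite gt_eqF.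
  by rewrite -/K /N => ->; exact: ltrD.
have := H2 _ lt2; rewrite [g s t + _]addrC subrK => l2.
have -> : phi g' - phi (g s t) - A * B * z =
  (phi g' - phi (g s t) - A * (g' - g s t)) + A * (g' - g s t - B * z) by ring.
rewrite (le_trans (cabsD _ _))//.
have b1 : e / 2 / K * cabs (g' - g s t) <= e / 2 / K * (K * N).
  by rewrite ler_wpM2l// !divr_ge0// ltW.
have b2 : cabs (A * (g' - g s t - B * z)) <= F * (e / 2 / F * N).
  by rewrite cabsM ler_pM ?cabs_ge0// /F lerDr.
have b5 : e / 2 / K * (K * N) = e / 2 * N by field; rewrite gt_eqF.
have b6 : F * (e / 2 / F * N) = e / 2 * N by field; rewrite gt_eqF.
rewrite b5 in b1; rewrite b6 in b2; lra.
Qed.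

Lemma cderat_cexpN s t : cderat (fun s t => cexp (- s) (- t)) s t (- cexp (- s) (- t)).
Proof. exact: cderat_neg (cderat_cexp _ _). Qed.

Lemma Rint_cos : \int[@lebesgue_measure R]_(t in `[0, pi *+ 2]) cos t = 0.
Proof.
have p0 : 0 <= pi *+ 2 :> R by rewrite mulrn_wge0// pi_ge0.
by rewrite (Rint_FTC p0 (@continuous_cos R) (@is_derive_sin R)) sin2pi sin0 subr0.
Qed.

Lemma Rint_sin : \int[@lebesgue_measure R]_(t in `[0, pi *+ 2]) sin t = 0.
Proof.
have p0 : 0 <= pi *+ 2 :> R by rewrite mulrn_wge0// pi_ge0.
have dc (x : R) : is_derive x (1 : R) (- cos) (sin x).
  by apply: is_derive_eq (is_deriveN (is_derive_cos x)) _; rewrite opprK.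
rewrite (Rint_FTC p0 (@continuous_sin R) dc).
by transitivity (- cos (pi *+ 2) - - cos 0 : R); [by []|rewrite cos2pi cos0 subrr].
Qed.

(** Over a full period the contribution of the constant term [phi 0] vanishes, which is why the
    formula below sees only the derivative. *)
Lemma cint_cexpN s : cint (fun t => cexp (- s) (- t)) 0 (pi *+ 2) = 0 :> C.
Proof.
have ci (x y : R) (f : R -> R) : continuous f -> (@lebesgue_measure R).-integrable `[x, y] (EFin \o f).
  by move=> cf; apply: integrable_itv_cont => t _; exact: cf.
apply: complex_ext => /=.
- rewrite RintegralZl//; last by apply: ci => t; apply: continuous_comp;
    [exact: opp_continuous|exact: continuous_cos].
  by under eq_Rintegral do rewrite cosN; rewrite Rint_cos mulr0.
- under eq_Rintegral do rewrite sinN mulrN -mulNr.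
  by rewrite RintegralZl//; [rewrite Rint_sin mulr0|exact: ci (@continuous_sin R)].
Qed.

Definition circ_cont phi (rho : R) := forall t, ccontat (fun t => phi (cexp (ln rho) t)) t.

(* (1 / 2 pi rho) \int_0^{2 pi} phi(rho e^{it}) e^{-it} dt *)
Definition cauchy_int phi (rho : R) : C :=
  (((pi *+ 2)^-1)%:C)%C *
  cint (fun t => phi (cexp (ln rho) t) * cexp (- ln rho) (- t)) 0 (pi *+ 2).

Lemma cder_uniq_cont phi z A : cder phi z A -> forall e, 0 < e -> exists2 d : R, 0 < d &
  forall h, cabs h < d -> cabs (phi (z + h) - phi z) < e.
Proof.
move=> dp e e0; have [d d0 H] := dp 1 ltr01.
pose K := 1 + cabs A; have K0 : 0 < K by rewrite ltr_wpDr ?cabs_ge0.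
exists (Num.min d (e / K)); first by rewrite lt_min d0 divr_gt0.
move=> h; rewrite lt_min => /andP[hd he].
rewrite -[_ - _](subrK (A * h)) (le_lt_trans (cabsD _ _))//.
rewrite (@le_lt_trans _ _ (K * cabs h))//; last by rewrite mulrC -ltr_pdivlMr.
by rewrite mulrDl mul1r -[cabs h in X in _ <= X + _]mul1r cabsM lerD2r H.
Qed.

Lemma circ_cont_ext phi rho : 0 < rho ->
  (forall z e, cabs z = rho -> 0 < e -> exists2 d : R, 0 < d &
    forall h, cabs h < d -> cabs (phi (z + h) - phi z) < e) -> circ_cont phi rho.
Proof.
move=> r0 H t e e0.
have cz : cabs (cexp (ln rho) t) = rho by rewrite cabs_cexp lnK.
have [d d0 Hd] := H _ _ cz e0.
have [d' d'0 Hd'] := cderat_contt (cderat_cexp (ln rho) t) d0.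
by exists d' => // y /Hd' /Hd; rewrite [cexp _ t + _]addrC subrK.
Qed.

Lemma circ_integrand_cont phi rho : circ_cont phi rho ->
  ccont (fun t => phi (cexp (ln rho) t) * cexp (- ln rho) (- t)) 0 (pi *+ 2).
Proof.
move=> cp t _; apply: ccontatM; first exact: cp.
exact: cderat_contt (cderat_cexpN (ln rho) t).
Qed.

Lemma cauchy_int_bound phi rho M : 0 < rho -> circ_cont phi rho ->
  (forall z, cabs z = rho -> cabs (phi z) <= M) ->
  cabs (cauchy_int phi rho) <= 2 * M / rho.
Proof.
move=> r0 cp pM; have p0 : 0 < pi *+ 2 :> R by rewrite mulrn_wgt0// pi_gt0.
rewrite /cauchy_int cabsM cabsR ger0_norm ?invr_ge0 ?(ltW p0)//.
rewrite mulrC ler_pdivrMr//.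
have := cint_bound (ltW p0) (circ_integrand_cont cp) (M := M / rho).
rewrite subr0 mulrA; apply => t _.
rewrite cabsM cabs_cexp expRN lnK// ler_wpM2r ?invr_ge0 ?(ltW r0)//.
by apply: pM; rewrite cabs_cexp lnK.
Qed.

Lemma cauchy_intB phi psi rho : circ_cont phi rho -> circ_cont psi rho ->
  cauchy_int (fun z => phi z - psi z) rho = cauchy_int phi rho - cauchy_int psi rho.
Proof.
move=> c1 c2; rewrite /cauchy_int -mulrBr -cintB; try exact: circ_integrand_cont.
by congr (_ * _); apply: eq_cint => t _; rewrite mulrBl.
Qed.

Lemma cauchy_intZ (c : C) phi rho : circ_cont phi rho ->
  cauchy_int (fun z => c * phi z) rho = c * cauchy_int phi rho.
Proof.
move=> c1; rewrite /cauchy_int mulrCA -(cintZ c (circ_integrand_cont c1)).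
by congr (_ * _); apply: eq_cint => t _; rewrite mulrA.
Qed.

(* In the coordinate w = log z the integrand phi(e^w) e^{-w} is holomorphic and
   2 pi i-periodic, so Goursat makes its integral over a period independent of
   Re w; letting Re w -> -oo identifies it as 2 pi phi'(0). *)
Theorem cauchy_formula phi (r rho : R) A0 : 0 < rho -> rho < r ->
  (forall z, cabs z < r -> exists A, cder phi z A) -> cder phi 0 A0 ->
  cauchy_int phi rho = A0.
Proof.
move=> rho0 rhor dphi d0.
have p0 : 0 < pi *+ 2 :> R by rewrite mulrn_wgt0// pi_gt0.
have i0 : ('i%C : C) != 0.
  by rewrite -cabs_eq0 /cabs /= expr0n add0r expr1n sqrtr1 oner_eq0.
pose g s t : C := phi (cexp s t) * cexp (- s) (- t).
pose I s := cint (g s) 0 (pi *+ 2).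
have dg s t : s <= ln rho -> exists A, cderat g s t A.
  move=> sr; have [|A dA] := dphi (cexp s t).
    by rewrite cabs_cexp (le_lt_trans _ rhor)// -[leRHS]lnK ?posrE// ler_expR.
  by eexists; exact: cderatM (cderat_comp (cderat_cexp s t) dA) (cderat_cexpN s t).
have cI s : s <= ln rho -> ccont (g s) 0 (pi *+ 2).
  by move=> sr t _; have [A dA] := dg s t sr; exact: cderat_contt dA.
have Iconst s : s < ln rho -> I s = I (ln rho).
  move=> sr.
  have W0 : 0 < ln rho - s by rewrite subr_gt0.
  have := @goursat _ g s 0 _ _ W0 p0.
  rewrite /rectint add0r [s + _]addrC subrK => G.
  have {G} := G (fun s' t' (h : s <= s' <= ln rho) _ => dg s' t' (proj2 (andP h))).
  (* By periodicity the two horizontal sides of the rectangle cancel. *)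
  have -> : cint (fun s0 => g s0 (pi *+ 2)) s (ln rho) = cint (fun s0 => g s0 0) s (ln rho).
    by apply: eq_cint => x _; rewrite /g cexp_periodic cexpN_periodic oppr0.
  rewrite subrr add0r => /eqP; rewrite mulf_eq0 (negPf i0) subr_eq0 => /eqP H.
  exact: esym H.
suff : I (ln rho) = ((pi *+ 2)%:C)%C * A0.
  rewrite /cauchy_int -/(I (ln rho)) => ->.
  by rewrite mulrA -rmorphM /= mulVf ?gt_eqF// mul1r.
apply/eqP; rewrite -subr_eq0 -cabs_eq0 eq_le cabs_ge0 andbT.
apply/ler_addgt0Pl => e e0; rewrite addr0.
pose e' := e / (2 * (pi *+ 2)).
have e'0 : 0 < e' by rewrite divr_gt0// mulr_gt0.
have [d dpos Hd] := d0 _ e'0.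
(* The circle of radius [expR s] lies inside the circle of radius [rho] and inside the disc where
   the expansion of [phi] at 0 holds. *)
pose s := Num.min (ln rho) (ln d) - 1.
have sr : s < ln rho.
  by rewrite /s ltrBlDr (le_lt_trans _ (ltr_pwDr _ (lexx _)))// ge_min lexx.
have sd : expR s < d.
  rewrite -[ltRHS]lnK ?posrE// ltr_expR /s ltrBlDr.
  by rewrite (le_lt_trans _ (ltr_pwDr _ (lexx _)))// ge_min lexx orbT.
(* The function [f] below is the first-order expansion [phi 0 + A0 * e^w] times [e^(-w)]; its
   integral over a period is exactly [2 pi A0]. *)
rewrite -(Iconst s sr).
pose f t := phi 0 * cexp (- s) (- t) + A0.
have c1 : ccont (fun t => phi 0 * cexp (- s) (- t)) 0 (pi *+ 2).
  move=> t _; apply: ccontatM; first exact: ccontat_cst.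
  exact: cderat_contt (cderat_cexpN s t).
have cf : ccont f 0 (pi *+ 2).
  by move=> t h; apply: ccontatD; [exact: c1|exact: ccontat_cst].
have If : cint f 0 (pi *+ 2) = ((pi *+ 2)%:C)%C * A0.
  rewrite cintD ?cint_cst ?ltW// ?cintZ ?cint_cexpN ?mulr0 ?add0r ?subr0//.
  - by move=> t _; exact: cderat_contt (cderat_cexpN s t).
  - by move=> t _; exact: ccontat_cst.
rewrite -If /I -cintB//; last exact: cI (ltW sr).
have := @cint_bound _ (fun t => g s t - f t) 0 (pi *+ 2) e' (ltW p0).
rewrite subr0 /e' => H; apply: le_trans (H _ _) _.
- by move=> t h; apply: ccontatB; [exact: cI (ltW sr) _ h|exact: cf].
- move=> t _; rewrite /g /f.
  have -> : phi (cexp s t) * cexp (- s) (- t) - (phi 0 * cexp (- s) (- t) + A0) =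
    (phi (0 + cexp s t) - phi 0 - A0 * cexp s t) * cexp (- s) (- t).
    rewrite add0r !mulrBl -[A0 * _ * _]mulrA cexpNK mulr1; ring.
  rewrite cabsM cabs_cexp expRN ler_pdivrMr ?expR_gt0//.
  by have := Hd (cexp s t); rewrite cabs_cexp; apply.
- move: (pi *+ 2) (p0) => P P0.
  by have -> : 2 * (e / (2 * P)) * P = e by field; rewrite gt_eqF.
Qed.

End CauchyFormula.

(** * Cauchy estimates *)

Section OneVariable.
Variable R : realType.
Local Notation C := (R[i]).
Implicit Types phi psi : C -> C.

Lemma epsdelta_is_derive (f : R -> R) (x d : R) :
  (forall e : R, 0 < e -> exists2 r : R, 0 < r &
    forall h, `|h| < r -> `|f (x + h) - f x - d * h| <= e * `|h|) ->
  is_derive x (1 : R) f d.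
Proof.
move=> H.
have L : h^-1 *: ((f \o shift x) (h *: (1 : R)) - f x) @[h --> (0 : R)^'] --> d.
  apply/cvgrPdist_le => e e0; have [r r0 Hr] := H e e0.
  apply/nbhs_ballP; exists r => // h.
  rewrite /ball /= sub0r normrN => hr h0.
  rewrite /GRing.scale /= mulr1 distrC [h + x]addrC.
  have -> : h^-1 * (f (x + h) - f x) - d = h^-1 * (f (x + h) - f x - d * h).
    by rewrite [RHS]mulrBr [d * h]mulrC mulKf.
  rewrite normrM normrV ?unitfE// mulrC ler_pdivrMr ?normr_gt0//.
  exact: Hr.
apply: DeriveDef; first by apply/cvg_ex; exists d.
exact: cvg_lim L.
Qed.

Definition rder (u : R -> C) (t : R) (A : C) := forall e : R, 0 < e ->
  exists2 d : R, 0 < d & forall h, `|h| < d ->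
    cabs (u (t + h) - u t - A * (h%:C)%C) <= e * `|h|.

Lemma rder_Re u t A : rder u t A -> is_derive t (1 : R) (fun x => complex.Re (u x)) (complex.Re A).
Proof.
move=> du; apply: epsdelta_is_derive => e /du[d d0 H]; exists d => // h /H.
apply: le_trans; apply: le_trans (Re_le_cabs _).
by rewrite !cReB cReM /= mulr0 subr0.
Qed.

Lemma rder_Im u t A : rder u t A -> is_derive t (1 : R) (fun x => complex.Im (u x)) (complex.Im A).
Proof.
move=> du; apply: epsdelta_is_derive => e /du[d d0 H]; exists d => // h /H.
apply: le_trans; apply: le_trans (Im_le_cabs _).
by rewrite !cImB cImM /= mulr0 add0r.
Qed.

Lemma mean_value_le (f df : R -> R) (M : R) :
  (forall t : R, 0 <= t <= 1 -> is_derive t (1 : R) f (df t)) ->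
  (forall t : R, 0 <= t <= 1 -> `|df t| <= M) -> `|f 1 - f 0| <= M.
Proof.
move=> Df fM.
have dI (t : R) : t \in `]0, 1[ -> is_derive t (1 : R) f (df t).
  by rewrite in_itv /= => /andP[/ltW t0 /ltW t1]; apply: Df; rewrite t0.
have cf : {within `[0, 1], continuous f}.
  apply: continuous_in_subspaceT => x; rewrite inE /= in_itv /= => /Df dx.
  by apply: differentiable_continuous; apply/derivable1_diffP; case: dx.
have [c /[!in_itv]/= /andP[/ltW c0 /ltW c1] ->] := MVT ltr01 dI cf.
by rewrite subr0 mulr1 fM// c0.
Qed.

(** The mean value equality fails for complex values; it is applied to real and imaginary parts, at
    the cost of a factor 2. *)
Lemma cmean_value_le (u : R -> C) (du : R -> C) (M : R) :
  (forall t : R, 0 <= t <= 1 -> rder u t (du t)) ->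
  (forall t : R, 0 <= t <= 1 -> cabs (du t) <= M) -> cabs (u 1 - u 0) <= 2 * M.
Proof.
move=> Du uM; rewrite (le_trans (cabs_le_ReIm _))// mulr2n mulrDl mul1r.
rewrite cReB cImB; apply: lerD.
- apply: (@mean_value_le (fun x => complex.Re (u x)) (fun x => complex.Re (du x))).
    by move=> t /Du; exact: rder_Re.
  by move=> t /uM; apply: le_trans; exact: Re_le_cabs.
- apply: (@mean_value_le (fun x => complex.Im (u x)) (fun x => complex.Im (du x))).
    by move=> t /Du; exact: rder_Im.
  by move=> t /uM; apply: le_trans; exact: Im_le_cabs.
Qed.

Lemma cder_rder phi (z v A : C) (t : R) : cder phi (z + (t%:C)%C * v) A ->
  rder (fun t => phi (z + (t%:C)%C * v)) t (A * v).
Proof.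
move=> dp e e0; pose K := 1 + cabs v; have K0 : 0 < K by rewrite ltr_wpDr ?cabs_ge0.
have [d d0 H] := dp _ (divr_gt0 e0 K0).
exists (d / K); first exact: divr_gt0.
move=> h; rewrite ltr_pdivlMr// => hd.
have hv : cabs ((h%:C)%C * v) <= `|h| * K.
  by rewrite cabsM cabsR ler_wpM2l// /K lerDr.
have := H _ (le_lt_trans hv hd).
rewrite rmorphD /= mulrDl addrA => {}H.
have -> : A * v * (h%:C)%C = A * ((h%:C)%C * v) by ring.
rewrite (le_trans H)//.
rewrite [leRHS](_ : _ = e / K * (`|h| * K)); last by field; rewrite gt_eqF.
by rewrite ler_wpM2l ?divr_ge0 ?(ltW e0) ?(ltW K0).
Qed.

Definition hol_disc phi (r : R) := forall z, cabs z < r -> exists A, cder phi z A.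

Lemma cder_shift phi z A : cder phi z A -> cder (fun w => phi (z + w)) 0 A.
Proof.
move=> dp e /dp[d d0 H]; exists d => // h /H; by rewrite add0r addr0.
Qed.

Lemma cder_shiftr phi z w A : cder phi (z + w) A -> cder (fun w => phi (z + w)) w A.
Proof. by move=> dp e /dp[d d0 H]; exists d => // h /H; rewrite addrA. Qed.

Lemma hol_disc_shift phi (r s : R) z : hol_disc phi r -> cabs z + s <= r ->
  hol_disc (fun w => phi (z + w)) s.
Proof.
move=> hp zs w ws; have [|A dA] := hp (z + w).
  by rewrite (le_lt_trans (cabsD _ _))// (lt_le_trans _ zs)// ltrD2l.
by exists A; exact: cder_shiftr.
Qed.

Lemma hol_disc_circ_cont phi (r rho : R) : 0 < rho -> rho < r -> hol_disc phi r -> circ_cont phi rho.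
Proof.
move=> r0 rr hp; apply: circ_cont_ext => // z e zr e0.
by have [|A dA] := hp z; [rewrite zr|exact: cder_uniq_cont dA _ e0].
Qed.

(** Cauchy's formula is used on the circle of radius [r / 2]; halving the radius and the factor 2 of
    [cauchy_int_bound] give the constant 4. *)
Lemma cauchy_estimate phi (r M : R) A : 0 < r -> hol_disc phi r ->
  (forall z, cabs z < r -> cabs (phi z) <= M) -> cder phi 0 A -> cabs A <= 4 * M / r.
Proof.
move=> r0 hp pM dA.
have r2 : 0 < r / 2 by rewrite divr_gt0.
have rr : r / 2 < r by rewrite ltr_pdivrMr// mulrC mulr_natl mulr2n ltrDl.
rewrite -(cauchy_formula r2 rr hp dA).
rewrite (le_trans (cauchy_int_bound (M := M) r2 _ _))//.
- exact: hol_disc_circ_cont rr hp.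
- by move=> z zr; apply: pM; rewrite zr.
- by rewrite [leLHS](_ : _ = 4 * M / r)//; field; rewrite gt_eqF.
Qed.

(** The disc of radius [r / 2] about a point of the smaller disc stays in the larger one, so the
    derivative is at most [8 * M / r]; the mean value inequality along the segment doubles this. *)
Lemma cauchy_lipschitz phi (r M : R) x y : 0 < r -> hol_disc phi r ->
  (forall z, cabs z < r -> cabs (phi z) <= M) ->
  cabs x < r / 2 -> cabs y < r / 2 -> cabs (phi x - phi y) <= 16 * M / r * cabs (x - y).
Proof.
move=> r0 hp pM xr yr.
have r2 : 0 < r / 2 by rewrite divr_gt0.
pose P t := y + (t%:C)%C * (x - y).
have Pr t : 0 <= t <= 1 -> cabs (P t) < r / 2.
  move=> /andP[t0 t1]; rewrite /P.
  have -> : y + (t%:C)%C * (x - y) = (t%:C)%C * x + ((1 - t)%:C)%C * y.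
    by rewrite rmorphB /=; ring.
  rewrite (le_lt_trans (cabsD _ _))// !cabsM !cabsR !ger0_norm ?subr_ge0//.
  (* Strictness comes from [y] when [t = 0] and from the term in [x] otherwise. *)
  have [->|tn0] := eqVneq t 0; first by rewrite mul0r add0r subr0 mul1r.
  have tp : 0 < t by rewrite lt_neqAle eq_sym tn0.
  rewrite [ltRHS](_ : _ = t * (r / 2) + (1 - t) * (r / 2)); last by ring.
  by rewrite ltr_leD ?ltr_pM2l// ler_wpM2l ?subr_ge0// ltW.
have dP t : 0 <= t <= 1 -> exists A, cder phi (P t) A /\ cabs A <= 8 * M / r.
  move=> /Pr tr; have [|A dA] := hp (P t).
    by rewrite (lt_le_trans tr)// ler_pdivrMr// mulrC mulr_natl mulr2n lerDl ltW.
  exists A; split => //.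
  have rE : r / 2 + r / 2 = r by field.
  have h1 : hol_disc (fun w => phi (P t + w)) (r / 2).
    by apply: hol_disc_shift hp _; rewrite -[leRHS]rE lerD2r ltW.
  have := cauchy_estimate r2 h1 _ (cder_shift dA).
  have -> : 8 * M / r = 4 * M / (r / 2) by field; rewrite gt_eqF.
  apply => z zr; apply: pM; rewrite (le_lt_trans (cabsD _ _))//.
  by rewrite -[ltRHS]rE ltrD.
(* Outside [[0, 1]] the derivative gets the default value 0, so that [choice] gives a function on
   all of [R]. *)
have /choice[A HA] : forall t, exists A, 0 <= t <= 1 -> cder phi (P t) A /\ cabs A <= 8 * M / r.
  move=> t; case: (boolP (0 <= t <= 1)) => [/dP[A HA]|nt]; first by exists A.
  by exists 0.
have := @cmean_value_le (fun t => phi (P t)) (fun t => A t * (x - y)) (8 * M / r * cabs (x - y)).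
have -> : P 1 = x by rewrite /P mul1r addrC subrK.
have -> : P 0 = y by rewrite /P mul0r addr0.
rewrite [2 * _](_ : _ = 16 * M / r * cabs (x - y)); last by field; rewrite gt_eqF.
apply => t t01; have [h1 h2] := HA t t01; first exact: cder_rder.
by rewrite cabsM ler_wpM2r// cabs_ge0.
Qed.

(** The derivative is Lipschitz: derivatives at [w] and at 0 are Cauchy integrals over the same
    circle of radius [r / 8], applied to translates of [phi] that differ by at most
    [16 * M / r * cabs w]. This gives the constant 256, and the mean value inequality for
    [phi (t z) - A t z] doubles it. *)
Lemma taylor2 phi (r M : R) A z : 0 < r -> hol_disc phi r ->
  (forall z, cabs z < r -> cabs (phi z) <= M) -> cder phi 0 A -> cabs z < r / 4 ->
  cabs (phi z - phi 0 - A * z) <= 512 * M / r ^+ 2 * cabs z ^+ 2.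
Proof.
move=> r0 hp pM dA zr.
have r8 : 0 < r / 8 by rewrite divr_gt0.
have r82 : r / 8 < r / 2 by rewrite ltr_pM2l// ltf_pV2 ?posrE// ltr_nat.
have dP w : cabs w < r / 4 -> exists B, cder phi w B /\ cabs (B - A) <= 256 * M / r ^+ 2 * cabs w.
  move=> wr; have [|B dB] := hp w.
    by rewrite (lt_le_trans wr)// ler_pdivrMr// ler_peMr ?(ltW r0)// ler1n.
  exists B; split => //.
  have r42 : r / 4 + r / 4 = r / 2 by field.
  have wr2 : cabs w + r / 2 <= r.
    rewrite (@le_trans _ _ (r / 4 + r / 2)) ?lerD2r ?(ltW wr)//.
    have -> : r / 4 + r / 2 = r * (3 / 4) by field.
    by rewrite ler_piMr ?(ltW r0)// ler_pdivrMr// mul1r ler_nat.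
  have h1 := hol_disc_shift hp wr2.
  have r2r : r / 8 < r by rewrite (lt_le_trans r82)// ler_pdivrMr// ler_peMr ?(ltW r0)// ler1n.
  have c1 := hol_disc_circ_cont r8 r82 h1; have c2 := hol_disc_circ_cont r8 r2r hp.
  rewrite -(cauchy_formula r8 r82 h1 (cder_shift dB)) -(cauchy_formula r8 r2r hp dA).
  rewrite -cauchy_intB//.
  have -> : 256 * M / r ^+ 2 * cabs w = 2 * (16 * M / r * cabs w) / (r / 8).
    by field; rewrite gt_eqF.
  apply: cauchy_int_bound => //.
    by move=> t; apply: ccontatB; [exact: c1|exact: c2].
  move=> x xr; have -> : cabs w = cabs (w + x - x) by rewrite addrK.
  apply: (cauchy_lipschitz r0 hp pM); last by rewrite xr.
  rewrite (le_lt_trans (cabsD _ _))// -r42 ltrD// xr; move: r0; clear; lra.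
have tz t : 0 <= t <= 1 -> cabs ((t%:C)%C * z) <= cabs z.
  by move=> /andP[t0 t1]; rewrite cabsM cabsR ger0_norm// ler_piMl ?cabs_ge0.
have /choice[B HB] : forall t, exists B, 0 <= t <= 1 ->
    cder phi ((t%:C)%C * z) B /\ cabs (B - A) <= 256 * M / r ^+ 2 * cabs ((t%:C)%C * z).
  move=> t; case: (boolP (0 <= t <= 1)) => [/tz tr|nt]; last by exists 0.
  by have [|B dB] := dP ((t%:C)%C * z); [exact: le_lt_trans zr|exists B].
have M0 : 0 <= M by rewrite (le_trans (cabs_ge0 (phi 0)))// pM// cabs0.
have K0 : 0 <= 256 * M / r ^+ 2 by apply: divr_ge0; [exact: mulr_ge0 (ler0n _ _) M0|exact: exprn_ge0 (ltW r0)].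
have := @cmean_value_le (fun t => phi (0 + (t%:C)%C * z) - A * ((t%:C)%C * z))
  (fun t => (B t - A) * z) (256 * M / r ^+ 2 * cabs z * cabs z).
rewrite !mul1r !mul0r !mulr0 !addr0 add0r subr0.
have -> : phi z - A * z - phi 0 = phi z - phi 0 - A * z by ring.
rewrite [2 * _](_ : _ = 512 * M / r ^+ 2 * cabs z ^+ 2); last by field; rewrite gt_eqF.
apply => t t01; have [h1 h2] := HB t t01.
- have := @cder_rder phi 0 z (B t) t; rewrite add0r => /(_ h1) dB e e0.
  have [d d0 H] := dB e e0; exists d => // h /H.
  congr (_ <= _); congr cabs; rewrite rmorphD /=; ring.
- rewrite cabsM ler_wpM2r ?cabs_ge0// (le_trans h2)// ler_wpM2l// tz//.
Qed.

End OneVariable.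

(** * Estimates along complex lines and in polydiscs *)

Section SeveralVariables.
Variable R : realType.
Local Notation C := (R[i]).
Variable n : nat.
Local Notation Cn := ('rV[C^o]_n).
Implicit Types (f : Cn -> C) (z w u : Cn).

Lemma cder_of_derivable (g : C -> C) (A : C) :
  (fun h : C^o => h^-1 *: ((g h : C^o) - g 0)) @ (0 : C^o)^' --> (A : C^o) -> cder g 0 A.
Proof.
move=> /cvgrPdist_le H e e0.
have e0' : 0 < ((e%:C)%C : C) by rewrite ltcR.
have /nbhs_ballP [d d0 Hd] := H _ e0'.
have dE : d = ((complex.Re d)%:C)%C.
  by move: d0; rewrite /= ltcE /= => /andP[/eqP d1 _]; rewrite (complexE d) d1 mulr0 addr0.
exists (complex.Re d); first by move: d0; rewrite dE /= ltcR.
move=> h hd; rewrite add0r; have [->|h0] := eqVneq h 0.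
  by rewrite subrr mulr0 subr0 !cabs0 mulr0.
have bh : ball (0 : C^o) d h.
  by rewrite -ball_normE /ball_ /= sub0r normrN cabsE dE ltcR.
have := Hd _ bh h0; rewrite cabsE lecR cabs_distC.
rewrite /GRing.scale /= => H1.
have -> : g h - g 0 - A * h = h * (h^-1 * (g h - g 0) - A) by rewrite mulrBr mulrA divff// mul1r [h * A]mulrC.
by rewrite cabsM mulrC ler_wpM2r ?cabs_ge0.
Qed.

Lemma gradu_diff f z u : cdiff f z -> gradu f z u = 'd (f : Cn -> C^o) z u.
Proof.
move=> df; rewrite {2}(row_sum_delta u) linear_sum /=.
apply: eq_bigr => j _; rewrite linearZ /= /pderiv deriveE// /GRing.scale /= mulrC//.
Qed.

Lemma cdiff_line0 f z u : cdiff f z -> cder (fun x => f (z + x *: u)) 0 (gradu f z u).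
Proof.
move=> df; rewrite gradu_diff// -deriveE//; apply: cder_of_derivable.
have := @diff_derivable _ _ _ (f : Cn -> C^o) z u df.
rewrite /derivable => /cvg_ex[l Hl].
rewrite /derive (cvg_lim _ Hl)//=.
under eq_fun do rewrite scale0r addr0 [z + _]addrC.
exact: Hl.
Qed.

Lemma cdiff_line f z u (x : C) : cdiff f (z + x *: u) ->
  cder (fun x : C => f (z + x *: u)) x (gradu f (z + x *: u) u).
Proof.
move=> /(@cdiff_line0 _ _ u) df e /df[d d0 H]; exists d => // h /H.
by rewrite scale0r addr0 add0r [(x + h) *: u]scalerDl addrA.
Qed.

(** The polydisc with equal radii, which is the ball of the norm of [Cn], with its radius taken in
    [R] instead of [R[i]]. *)
Definition inball (p : Cn) (r : R) : set Cn :=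
  [set z | forall j, cabs (z 0 j - p 0 j) < r].

Lemma inballW p (r s : R) : r <= s -> inball p r `<=` inball p s.
Proof. by move=> rs z zr j; exact: lt_le_trans (zr j) rs. Qed.

Lemma inball_center p (r : R) : 0 < r -> inball p r p.
Proof. by move=> r0 j; rewrite subrr cabs0. Qed.

Lemma complex_gt0E (e : C) : 0 < e -> e = ((complex.Re e)%:C)%C /\ 0 < complex.Re e.
Proof.
rewrite ltcE /= => /andP[/eqP d1 d2]; split=> //.
by rewrite (complexE e) d1 mulr0 addr0.
Qed.

Lemma ball_inball p z (r : R) : 0 < r -> ball p ((r%:C)%C : C) z <-> inball p r z.
Proof.
move=> r0; split.
  move=> [_ H] j; have := H 0 j.
  by rewrite -ball_normE /ball_ /= cabsE ltcR cabs_distC.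
move=> H; split; first by rewrite ltcR.
by move=> i j; rewrite ord1 -ball_normE /ball_ /= cabsE ltcR cabs_distC.
Qed.

Lemma open_inballP (A : set Cn) :
  open A <-> (forall p, A p -> exists2 r : R, 0 < r & inball p r `<=` A).
Proof.
rewrite openE; split=> [oA p /oA|H p /H[r r0 rA]].
  rewrite /interior => /nbhs_ballP[e e0 eA].
  have [eE e0'] := complex_gt0E e0.
  exists (complex.Re e) => // z /ball_inball => /(_ e0'); rewrite -eE; exact: eA.
apply/nbhs_ballP; exists ((r%:C)%C : C); first by rewrite /= ltcR.
by move=> z /(ball_inball _ _ r0); exact: rA.
Qed.

Lemma cdiff_cont f z : cdiff f z -> forall e : R, 0 < e -> exists2 d : R, 0 < d &
  forall w, inball z d w -> cabs (f w - f z) < e.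
Proof.
move=> /differentiable_continuous /cvgrPdist_lt H e e0.
have e0' : 0 < ((e%:C)%C : C) by rewrite ltcR.
have /nbhs_ballP[d d0 Hd] := H _ e0'.
have [dE d0'] := complex_gt0E d0.
exists (complex.Re d) => // w /(ball_inball _ _ d0'); rewrite -dE => /Hd /=.
by rewrite cabsE ltcR cabs_distC.
Qed.

Lemma inball_line p z (r : R) (k : 'I_n) (x : C) : inball p r z ->
  inball p (r + cabs x) (z + x *: ebasis R k).
Proof.
move=> zr j; rewrite !mxE eqxx /=.
have -> : z 0 j + x * (j == k)%:R - p 0 j = (z 0 j - p 0 j) + x * (j == k)%:R by ring.
rewrite (le_lt_trans (cabsD _ _))// ltr_leD// cabsM.
by case: (j == k); rewrite ?cabs1 ?cabs0 ?mulr1 ?mulr0 ?cabs_ge0.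
Qed.

Lemma gradu_ebasis f z k : gradu f z (ebasis R k) = pderiv f k z.
Proof.
rewrite /gradu (bigD1 k)//= big1 ?addr0 => [|j jk]; first by rewrite mxE !eqxx mulr1.
by rewrite mxE (negPf jk) andbF mulr0.
Qed.

Lemma cdiff_coord f z k (x : C) : cdiff f (z + x *: ebasis R k) ->
  cder (fun x : C => f (z + x *: ebasis R k)) x (pderiv f k (z + x *: ebasis R k)).
Proof. by move=> /cdiff_line; rewrite gradu_ebasis. Qed.

Section Estimates.
Variables (f : Cn -> C) (p : Cn) (r M : R).
Hypotheses (r0 : 0 < r) (df : forall z, inball p r z -> cdiff f z)
  (fM : forall z, inball p r z -> cabs (f z) <= M).

Lemma line_hol z (s : R) k : inball p s z ->
  hol_disc (fun x : C => f (z + x *: ebasis R k)) (r - s).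
Proof.
move=> zs x xr; exists (pderiv f k (z + x *: ebasis R k)); apply: cdiff_coord.
apply: df; apply: inballW (inball_line k x zs); rewrite -lerBrDl; exact: ltW.
Qed.

Lemma line_bound z (s : R) k x : inball p s z -> cabs x < r - s ->
  cabs (f (z + x *: ebasis R k)) <= M.
Proof.
move=> zs xr; apply: fM; apply: inballW (inball_line k x zs).
by rewrite -lerBrDl; exact: ltW.
Qed.

Lemma line_der0 z k : inball p r z -> cder (fun x : C => f (z + x *: ebasis R k)) 0 (pderiv f k z).
Proof.
move=> zr; have := @cdiff_coord f z k 0; rewrite scale0r addr0; apply; exact: df.
Qed.

Lemma pderiv_bound z k : inball p (r / 2) z -> cabs (pderiv f k z) <= 8 * M / r.
Proof.
move=> zs; have r2 : r - r / 2 = r / 2 by field.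
have h2 : 0 < r / 2 by rewrite divr_gt0.
have -> : 8 * M / r = 4 * M / (r / 2) by field; rewrite gt_eqF.
apply: (@cauchy_estimate _ (fun x : C => f (z + x *: ebasis R k))) => //.
- by rewrite -[X in hol_disc _ X]r2; exact: line_hol.
- by move=> x; rewrite -[X in _ < X]r2; exact: line_bound.
- apply: line_der0; apply: inballW zs; lra.
Qed.

Lemma taylor2_coord z k x : inball p (r / 2) z -> cabs x < r / 8 ->
  cabs (f (z + x *: ebasis R k) - f z - pderiv f k z * x) <= 2048 * M / r ^+ 2 * cabs x ^+ 2.
Proof.
move=> zs xr; have r2 : r - r / 2 = r / 2 by field.
have h2 : 0 < r / 2 by rewrite divr_gt0.
have -> : 2048 * M / r ^+ 2 = 512 * M / (r / 2) ^+ 2 by field; rewrite gt_eqF.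
have := @taylor2 _ (fun x : C => f (z + x *: ebasis R k)) (r / 2) M (pderiv f k z) x h2.
rewrite scale0r addr0; apply.
- by rewrite -[X in hol_disc _ X]r2; exact: line_hol.
- by move=> y; rewrite -[X in _ < X]r2; exact: line_bound.
- apply: line_der0; apply: inballW zs; lra.
- by have -> : r / 2 / 4 = r / 8 by field.
Qed.

Lemma lipschitz_coord z k x : inball p (r / 2) z -> cabs x < r / 4 ->
  cabs (f (z + x *: ebasis R k) - f z) <= 32 * M / r * cabs x.
Proof.
move=> zs xr; have r2 : r - r / 2 = r / 2 by field.
have h2 : 0 < r / 2 by rewrite divr_gt0.
have -> : 32 * M / r = 16 * M / (r / 2) by field; rewrite gt_eqF.
have := @cauchy_lipschitz _ (fun x : C => f (z + x *: ebasis R k)) (r / 2) M x 0 h2.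
rewrite scale0r addr0 subr0; apply.
- by rewrite -[X in hol_disc _ X]r2; exact: line_hol.
- by move=> y; rewrite -[X in _ < X]r2; exact: line_bound.
- by have -> : r / 2 / 2 = r / 4 by field.
- by rewrite cabs0 divr_gt0.
Qed.

(** As Cauchy integrals over a fixed circle, partial derivatives inherit estimates for [f] by
    linearity. From a point within [3 / 8 * r] of [p] the circle of radius [r / 8] stays within
    [r / 2], where the coordinate estimates hold. *)
Lemma pderiv_cauchy z k : inball p (3 / 8 * r) z ->
  circ_cont (fun x : C => f (z + x *: ebasis R k)) (r / 8) /\
  cauchy_int (fun x : C => f (z + x *: ebasis R k)) (r / 8) = pderiv f k z.
Proof.
move=> zs; have r8 : 0 < r / 8 by rewrite divr_gt0.
have rr : r / 8 < r - 3 / 8 * r by lra.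
have h := line_hol k zs.
split; first exact: hol_disc_circ_cont rr h.
have r38 : 3 / 8 * r <= r by lra.
apply: (cauchy_formula r8 rr h); apply: line_der0; exact: inballW zs.
Qed.

Lemma pderiv_lipschitz z j k (x : C) : inball p (3 / 8 * r) z -> inball p (3 / 8 * r) (z + x *: ebasis R k) ->
  cabs x < r / 4 ->
  cabs (pderiv f j (z + x *: ebasis R k) - pderiv f j z) <= 512 * M / r ^+ 2 * cabs x.
Proof.
move=> z1 z2 xr.
have [c1 <-] := pderiv_cauchy j z1; have [c2 <-] := pderiv_cauchy j z2.
have r8 : 0 < r / 8 by rewrite divr_gt0.
rewrite -cauchy_intB//.
have -> : 512 * M / r ^+ 2 * cabs x = 2 * (32 * M / r * cabs x) / (r / 8) by field; rewrite gt_eqF.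
apply: cauchy_int_bound => //; first by move=> t; apply: ccontatB; [exact: c2|exact: c1].
move=> y yr; rewrite addrAC; apply: lipschitz_coord xr.
by apply: inballW (inball_line j y z1); rewrite yr; lra.
Qed.

(** The coefficient [b] is the mixed second derivative, obtained as the Cauchy integral in direction
    [k] of the partial derivative in direction [j]. The remainder is the Cauchy integral in
    direction [k] of the remainder in [taylor2_coord] for direction [j]. *)
Lemma pderiv_taylor2 z j k : inball p (r / 8) z -> exists b : C, forall x : C, cabs x < r / 8 ->
  cabs (pderiv f k (z + x *: ebasis R j) - pderiv f k z - b * x) <=
    16 * (2048 * M / r ^+ 3) * cabs x ^+ 2.
Proof.
move=> zr; have r8 : 0 < r / 8 by rewrite divr_gt0.
pose g (y : C) : C := pderiv f j (z + y *: ebasis R k).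
have M0 : 0 <= M by apply: le_trans (cabs_ge0 (f p)) (fM (inball_center _ r0)).
have cg : circ_cont g (r / 8).
  apply: circ_cont_ext => // y e yr e0.
  pose K := 512 * M / r ^+ 2 + 1.
  have K0 : 0 < K.
    by apply: (ltr_wpDl _ ltr01); apply: divr_ge0; [exact: mulr_ge0 (ler0n _ _) M0|exact: exprn_ge0 (ltW r0)].
  (* Any radius up to [r / 8] would do: the points used must stay within [3 / 8 * r] of [p], and [z]
     and [y] already take up [r / 4]. *)
  have r100 : 0 < r / 100 by rewrite divr_gt0.
  exists (Num.min (r / 100) (e / K)); first by rewrite lt_min r100 divr_gt0.
  move=> h; rewrite lt_min => /andP[h1 h2]; rewrite /g scalerDl addrA.
  have z0 := inball_line k y zr; rewrite yr in z0.
  have z1 : inball p (3 / 8 * r) (z + y *: ebasis R k) by apply: inballW z0; lra.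
  have z2 : inball p (3 / 8 * r) (z + y *: ebasis R k + h *: ebasis R k).
    by apply: inballW (inball_line k h z0); lra.
  have h4 : cabs h < r / 4 by lra.
  rewrite (le_lt_trans (pderiv_lipschitz j z1 z2 h4))//.
  rewrite (@le_lt_trans _ _ (K * cabs h))//.
    by rewrite ler_wpM2r ?cabs_ge0// /K lerDl.
  by rewrite mulrC -ltr_pdivlMr.
exists (cauchy_int g (r / 8)) => x xr.
have z1 : inball p (3 / 8 * r) z by apply: inballW zr; lra.
have z2 : inball p (3 / 8 * r) (z + x *: ebasis R j).
  by apply: inballW (inball_line j x zr); lra.
have [c1 <-] := pderiv_cauchy k z1; have [c2 <-] := pderiv_cauchy k z2.
rewrite [cauchy_int g _ * x]mulrC -cauchy_intB// -cauchy_intZ// -cauchy_intB//; last 2 first.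
- by move=> t; apply: ccontatB; [exact: c2|exact: c1].
- by move=> t; apply: ccontatM; [exact: ccontat_cst|exact: cg].
have -> : 16 * (2048 * M / r ^+ 3) * cabs x ^+ 2 = 2 * (2048 * M / r ^+ 2 * cabs x ^+ 2) / (r / 8).
  by field; rewrite gt_eqF.
apply: cauchy_int_bound => //.
  move=> t; apply: ccontatB; last by apply: ccontatM; [exact: ccontat_cst|exact: cg].
  by apply: ccontatB; [exact: c2|exact: c1].
move=> y yr; have y1 : inball p (r / 2) (z + y *: ebasis R k).
  by apply: inballW (inball_line k y zr); rewrite yr; lra.
have := taylor2_coord j y1 xr.
have -> : z + y *: ebasis R k + x *: ebasis R j = z + x *: ebasis R j + y *: ebasis R k.
  by rewrite addrAC.
by rewrite -/(g y) [g y * x]mulrC.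
Qed.

End Estimates.

(* The constant 2 comes from treating real and imaginary parts separately. *)
Lemma mean_value_segment f z u (M : R) :
  (forall t : R, 0 <= t <= 1 -> cdiff f (z + (t%:C)%C *: u)) ->
  (forall t : R, 0 <= t <= 1 -> cabs (gradu f (z + (t%:C)%C *: u) u) <= M) ->
  cabs (f (z + u) - f z) <= 2 * M.
Proof.
move=> df fM.
have := @cmean_value_le _ (fun t => f (z + (t%:C)%C *: u)) (fun t => gradu f (z + (t%:C)%C *: u) u) M.
rewrite scale1r scale0r addr0; apply => // t t01.
have := @cder_rder _ (fun x : C => f (z + x *: u)) 0 1 (gradu f (z + (t%:C)%C *: u) u) t.
rewrite add0r mulr1 mulr1 => /(_ (cdiff_line (df _ t01))).
by under [X in rder X]eq_fun do rewrite add0r mulr1.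
Qed.

End SeveralVariables.

(** * Lebesgue integrals over C^n and the L2 evaluation bound *)

Section IteratedIntegralBounds.
Variable R : realType.
Local Notation C := (R[i]).
Notation mu := (@lebesgue_measure R).

Local Open Scope ereal_scope.

(* No measurability is needed here: the integral of a nonnegative function is the
   supremum over the simple functions below it. *)
Lemma ge0_le_integralT (f g : R -> \bar R) : (forall x, 0 <= f x) ->
  (forall x, f x <= g x) -> \int[mu]_x f x <= \int[mu]_x g x.
Proof.
move=> f0 fg; have g0 x : 0 <= g x by apply: le_trans (f0 x) (fg x).
rewrite !ge0_integralTE//; apply: ub_ereal_sup => _ [h hf <-].
by apply: ereal_sup_ubound; exists h => // x; apply: le_trans (hf x) (fg x).
Qed.

Lemma integral_ge_itv (f : R -> \bar R) (c a l : R) : (0 <= c)%R -> (0 <= l)%R ->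
  (forall x, 0 <= f x) -> (forall x, (a <= x <= a + l)%R -> c%:E <= f x) ->
  (c * l)%:E <= \int[mu]_x f x.
Proof.
move=> c0 l0 f0 fc.
have -> : (c * l)%:E = \int[mu]_(x in `[a, (a + l)%R]%classic) (cst c%:E) x.
  rewrite integral_cst//= lebesgue_measure_itv /= lte_fin ltrDl.
  case: ltP => [l1|l1]; first by rewrite -EFinD -EFinM addrAC subrr add0r.
  by rewrite (@le_anti _ _ l 0%R) ?l1 ?l0// mulr0 mule0.
rewrite integral_mkcond; apply: ge0_le_integralT => x; rewrite patchE.
- by case: ifPn => // _; rewrite lee_fin.
- by case: ifPn => // ; rewrite inE /= in_itv /= => /fc.
Qed.

Lemma integral_le_itv (f : R -> \bar R) (c B : R) : (0 <= c)%R -> (0 <= B)%R ->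
  (forall x, 0 <= f x) -> (forall x, f x <= c%:E) -> (forall x, (B < `|x|)%R -> f x = 0) ->
  \int[mu]_x f x <= (c * (2 * B))%:E.
Proof.
move=> c0 B0 f0 fc fB.
have -> : (c * (2 * B))%:E = \int[mu]_(x in `[(- B)%R, B]%classic) (cst c%:E) x.
  rewrite integral_cst//= lebesgue_measure_itv /= lte_fin.
  case: ltP => [l1|l1]; first by rewrite -EFinD -EFinM; congr (_ * _)%:E; ring.
  have -> : B = 0%R by move: l1 B0; clear; lra.
  by rewrite !mulr0 mule0.
rewrite [leRHS]integral_mkcond; apply: ge0_le_integralT => x //; rewrite patchE.
case: ifPn => //; rewrite notin_setE /= in_itv /= -ler_norml => /negP.
by rewrite -ltNge => /fB ->.
Qed.

Lemma iint_ge0 k (g : (nat -> C) -> \bar R) : (forall v, 0 <= g v) -> 0 <= iint k g.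
Proof.
elim: k g => [|k IH] g g0 /=; first exact: g0.
by apply: integral_ge0 => x _; apply: integral_ge0 => y _; apply: IH => v; exact: g0.
Qed.

(** Comparison with [c] times the indicator of the cube with corner [a] and side [l]; each complex
    coordinate contributes the area [l * l]. *)
Lemma iint_ge k (g : (nat -> C) -> \bar R) (a : nat -> C) (c l : R) :
  (0 <= c)%R -> (0 <= l)%R -> (forall v, 0 <= g v) ->
  (forall v, (forall j, (j < k)%N ->
     (complex.Re (a j) <= complex.Re (v j) <= complex.Re (a j) + l)%R /\
     (complex.Im (a j) <= complex.Im (v j) <= complex.Im (a j) + l)%R) -> c%:E <= g v) ->
  (c * (l * l) ^+ k)%:E <= iint k g.
Proof.
move=> c0 l0; elim: k g => [|k IH] g g0 H /=.
  by rewrite expr0 mulr1; apply: H.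
have K0 : (0 <= c * (l * l) ^+ k)%R by rewrite mulr_ge0// exprn_ge0// mulr_ge0.
rewrite exprSr mulrA mulrA.
apply: (integral_ge_itv (a := complex.Re (a k))) => //.
- exact: mulr_ge0.
- by move=> x; apply: integral_ge0 => y _; exact: iint_ge0.
move=> x xk; apply: (integral_ge_itv (a := complex.Im (a k))) => //.
  by move=> y; exact: iint_ge0.
move=> y yk; apply: IH => // v Hv; apply: H => j; rewrite ltnS leq_eqVlt.
by case: eqVneq => [->//|_ /=]; exact: Hv.
Qed.

Lemma iint_le k (g : (nat -> C) -> \bar R) (c B : R) :
  (0 <= c)%R -> (0 <= B)%R -> (forall v, 0 <= g v) -> (forall v, g v <= c%:E) ->
  (forall v j, (j < k)%N -> (B < `|complex.Re (v j)|)%R \/ (B < `|complex.Im (v j)|)%R ->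
     g v = 0) ->
  iint k g <= (c * ((2 * B) * (2 * B)) ^+ k)%:E.
Proof.
move=> + B0; elim: k g c => [|k IH] g c c0 g0 gc H /=.
  by rewrite expr0 mulr1.
have K0 : (0 <= c * (2 * B * (2 * B)) ^+ k)%R.
  by rewrite mulr_ge0// exprn_ge0// !mulr_ge0.
have in0 x y : (B < `|x|)%R \/ (B < `|y|)%R ->
    iint k (fun v : nat -> C => g (fun j => if j == k then Complex x y else v j)) = 0.
  (* Once the outermost coordinate leaves the box the integrand is 0, and the induction hypothesis
     with the bound 0 makes the inner integral vanish. *)
  move=> xy; apply/eqP; rewrite eq_le iint_ge0// andbT.
  rewrite (le_trans (IH _ 0%R (lexx _) _ _ _))//.
  - by move=> v; rewrite (H _ k)//= eqxx.
  - by move=> v j jk _; rewrite (H _ k)//= eqxx.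
  - by rewrite mul0r.
rewrite exprSr mulrA mulrA; apply: integral_le_itv => //.
- by rewrite mulr_ge0// mulr_ge0.
- by move=> x; apply: integral_ge0 => y _; exact: iint_ge0.
- move=> x; apply: integral_le_itv => //.
  + by move=> y; exact: iint_ge0.
  + move=> y; apply: IH => // v j jk vj; apply: (H _ j) => //; first exact: leqW.
    by rewrite ltn_eqF.
  + by move=> y By; apply: in0; right.
- by move=> x Bx; apply: integral0_eq => y _; apply: in0; left.
Qed.

End IteratedIntegralBounds.

(** * Point evaluations are locally bounded by the L2 norm *)

Section L2bounds.
Variable R : realType.
Local Notation C := (R[i]).
Variable n : nat.
Local Notation Cn := ('rV[C^o]_n).
Implicit Types (f : Cn -> C) (D : set Cn) (p z w : Cn).

Lemma L2sq_ge0 D f : (0 <= L2sq D f)%E.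
Proof. by apply: iint_ge0 => v; rewrite lee_fin mulr_ge0// ?exprn_ge0 ?cabs_ge0. Qed.

(* The constant is the volume of a cube of side r contained in the polydisc. *)
Lemma L2sq_ge_inball D f p (r c : R) : 0 < r -> 0 <= c -> inball p (3 * r) `<=` D ->
  (forall z, inball p (3 * r) z -> c <= cabs (f z)) ->
  ((c ^+ 2 * (r * r) ^+ n)%:E <= L2sq D f)%E.
Proof.
move=> r0 c0 pD fc.
(* [iint] works with sequences indexed by [nat]; entries from [n] on get the default 0. *)
pose a (j : nat) : C := if insub j is Some i then p 0 i else 0.
apply: (iint_ge (a := a)) => //.
- exact: exprn_ge0.
- exact: ltW.
- by move=> v; rewrite lee_fin mulr_ge0// ?exprn_ge0 ?cabs_ge0.
move=> v Hv; set z := \row_j _.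
(* The cube has its lower corner at [p]: real and imaginary offsets of at most [r] give a modulus of
   at most [2 * r], below the radius. *)
have zp : inball p (3 * r) z.
  move=> j; rewrite mxE; have := Hv j (ltn_ord j); rewrite /a valK => -[/andP[a1 a2] /andP[b1 b2]].
  rewrite (le_lt_trans (cabs_le_ReIm _))// cReB cImB.
  by rewrite !ger0_norm ?subr_ge0//; move: a2 b2 r0; clear; lra.
rewrite lee_fin indicE mem_set ?mul1r; last exact: pD.
by rewrite ler_pXn2r ?nnegrE ?cabs_ge0//; exact: fc.
Qed.

Lemma L2sq_bounded_lty D f (B M : R) : 0 <= B -> (forall z, D z -> forall j, cabs (z 0 j) <= B) ->
  (forall z, D z -> cabs (f z) <= M) -> (L2sq D f < +oo)%E.
Proof.
move=> B0 DB fM; have gpos (v : nat -> C) : (0 <= ((\1_D (\row_(j < n) v j : Cn) : R) *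
    cabs (f (\row_(j < n) v j)) ^+ 2)%:E)%E.
  by rewrite lee_fin mulr_ge0// ?exprn_ge0 ?cabs_ge0.
apply: le_lt_trans (iint_le (c := M ^+ 2) (B := B) _ B0 gpos _ _) _.
- exact: sqr_ge0.
- move=> v; rewrite lee_fin indicE; case: (boolP (_ \in D)) => /=; last by rewrite mul0r sqr_ge0.
  move=> /set_mem /fM h; rewrite mul1r ler_pXn2r ?nnegrE ?cabs_ge0//.
  exact: le_trans (cabs_ge0 _) h.
- move=> v j jn vj; rewrite indicE memNset ?mul0r// => /DB /(_ (Ordinal jn)).
  rewrite mxE /= => h; have := Re_le_cabs (v j); have := Im_le_cabs (v j).
  by case: vj; move: h; clear; lra.
- exact: ltry.
Qed.

Lemma cabs_sum (I : finType) (F : I -> C) : cabs (\sum_i F i) <= \sum_i cabs (F i).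
Proof.
elim/big_rec2: _ => [|i x y _ h]; first by rewrite cabs0.
by rewrite (le_trans (cabsD _ _))// lerD2l.
Qed.

(** The max norm as a real number, since the norm of [Cn] is an element of [R[i]] with zero
    imaginary part. *)
Definition nrm z : R := complex.Re (`|z| : C).

Lemma normE z : (`|z| : C) = ((nrm z)%:C)%C.
Proof.
have := normr_ge0 z; rewrite /nrm lecE /= => /andP[/eqP h _].
by rewrite [LHS]complexE h mulr0 addr0.
Qed.

Lemma nrm_inball p z (r : R) : 0 < r -> nrm (z - p) < r <-> inball p r z.
Proof.
move=> r0; rewrite -(ball_inball _ _ r0) mx_norm_ball /ball_ /= distrC normE ltcR //.
Qed.

Lemma nrmD z w : nrm (z + w) <= nrm z + nrm w.
Proof. by rewrite -lecR rmorphD /= -!normE; exact: ler_normD. Qed.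

Lemma nrm0 : nrm 0 = 0.
Proof. by rewrite /nrm normr0. Qed.

Lemma nrm_distC z w : nrm (z - w) = nrm (w - z).
Proof. by rewrite /nrm distrC. Qed.

Lemma epsdelta_continuous_at (F : Cn -> R) z : (forall e : R, 0 < e ->
  exists2 d : R, 0 < d & forall w, inball z d w -> `|F w - F z| < e) ->
  {for z, continuous F}.
Proof.
move=> H A /nbhs_ballP[e e0 eA]; have [d d0 Hd] := H e e0.
change (nbhs z (F @^-1` A)); apply/nbhs_ballP; exists ((d%:C)%C : C); first by rewrite /= ltcR.
by move=> w /(ball_inball _ _ d0) /Hd wd; apply: eA; rewrite /ball /= distrC.
Qed.

Lemma nrm_continuous p : continuous (fun z : Cn => nrm (z - p)).
Proof.
move=> z; apply: epsdelta_continuous_at => e e0; exists e => // w /(nrm_inball _ _ e0) zw.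
have h1 := nrmD (z - w) (w - p); have h2 := nrmD (w - z) (z - p).
rewrite addrA subrK in h1; rewrite addrA subrK in h2; rewrite (nrm_distC z w) in h1.
by rewrite ltr_norml; move: h1 h2 zw; clear; lra.
Qed.

Lemma compact_square (p : C) (r : R) :
  compact [set z : C^o | `|complex.Re z - complex.Re p| <= r /\ `|complex.Im z - complex.Im p| <= r].
Proof.
pose F (xy : R * R) : C^o := Complex xy.1 xy.2.
have -> : [set z : C^o | `|complex.Re z - complex.Re p| <= r /\ `|complex.Im z - complex.Im p| <= r] =
   F @` (`[complex.Re p - r, complex.Re p + r]%classic `*` `[complex.Im p - r, complex.Im p + r]%classic).
  apply/seteqP; split=> [z [h1 h2]|_ [[x y] /= [/= h1 h2] <-]].
    exists (complex.Re z, complex.Im z); last by case: z {h1 h2}.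
    by split; rewrite /= in_itv /=; [move: h1|move: h2]; rewrite ler_distl.
  by split; rewrite /= ler_distl; [move: h1|move: h2]; rewrite in_itv.
apply: continuous_compact; last by apply: compact_setX; exact: segment_compact.
apply: continuous_subspaceT => -[x y]; apply/cvgrPdist_lt => e e0.
have [eE e0'] := complex_gt0E e0.
have e2 : 0 < complex.Re e / 2 by rewrite divr_gt0.
exists (ball x (complex.Re e / 2), ball y (complex.Re e / 2)).
  by split; exact: nbhsx_ballx.
move=> -[x' y'] [/= h1 h2].
rewrite /F /= cabsE eE ltcR (le_lt_trans (cabs_le_ReIm _))// cReB cImB /=.
by rewrite [ltRHS](splitr (complex.Re e)) ltrD.
Qed.

(** The ball is a closed subset of a product of compact squares, one for each coordinate. *)
Lemma compact_closed_ball p (r : R) : compact [set z : Cn | nrm (z - p) <= r].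
Proof.
apply: (subclosed_compact (B := [set v : Cn | forall i, [set z : C^o |
   `|complex.Re z - complex.Re (p 0 i)| <= r /\ `|complex.Im z - complex.Im (p 0 i)| <= r] (v ord0 i)])).
- have -> : [set z : Cn | nrm (z - p) <= r] = (fun z => nrm (z - p)) @^-1` [set x | x <= r] by [].
  by apply: closed_comp => [z _|]; [exact: nrm_continuous|exact: closed_le].
- move: (@rV_compact ((R[i])^o : ptopologicalType) n _ (fun i => @compact_square (p 0 i) r)) => H.
  exact H.
- move=> z /= zr i.
  suff : cabs (z 0 i - p 0 i) <= r.
    move=> h; rewrite -cReB -cImB; split; apply: le_trans h; [exact: Re_le_cabs|exact: Im_le_cabs].
  apply/ler_addgt0Pr => e e0.
  have r0 : 0 < r + e.
    rewrite (le_lt_trans (le_trans _ zr)) ?ltrDl//.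
    by rewrite -lecR -normE normr_ge0.
  have : nrm (z - p) < r + e by rewrite (le_lt_trans zr)// ltrDl.
  by move=> /(nrm_inball _ _ r0) /(_ i) /ltW.
Qed.

Lemma nrm_ge0 z : 0 <= nrm z.
Proof. by rewrite -lecR -normE; exact: normr_ge0. Qed.

Lemma continuous_cabs f z : cdiff f z -> {for z, continuous (fun w : Cn => cabs (f w))}.
Proof.
move=> df; apply: epsdelta_continuous_at => e e0.
have [d d0 H] := cdiff_cont df e0; exists d => // w /H h.
have := cabsD (f w - f z) (f z); have := cabsD (f z - f w) (f w).
rewrite !subrK cabs_distC ltr_norml; move: h; clear; lra.
Qed.

(** Since |f| grows at most by the factor [2 ^+ n], Cauchy's estimates control its partial
    derivatives. The radius is chosen so that the mean value inequality moves [f] by at most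
    [n / n.+1] times [cabs (f z) / 2]. *)
Lemma half_lower_bound f z (s : R) : 0 < s -> (forall w, inball z s w -> cdiff f w) ->
  (forall w, inball z s w -> cabs (f w) <= 2 ^+ n * cabs (f z)) ->
  forall w, inball z (s / (32 * (n.+1)%:R * 2 ^+ n)) w -> cabs (f z) / 2 <= cabs (f w).
Proof.
move=> s0 df fM w zw; set N := 32 * (n.+1)%:R * 2 ^+ n in zw *.
have n1 : 1 <= (n.+1)%:R :> R by rewrite ler1n.
have p1 : 1 <= 2 ^+ n :> R by rewrite exprn_ege1// ler1n.
have n0 : 0 < (n.+1)%:R :> R by rewrite ltr0n.
have p0 : 0 < 2 ^+ n :> R by rewrite exprn_gt0.
have N32 : 32 <= N.
  by rewrite /N -[leLHS]mulr1 -[leLHS]mulr1 ler_pM// ?mulr_ge0 ?ler0n// ler_pM// ler0n.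
have N0 : 0 < N by rewrite (lt_le_trans _ N32).
have sN : s / N <= s / 2.
  by rewrite ler_pM2l// lef_pV2 ?posrE// (le_trans _ N32)// ler_nat.
set A := 2 ^+ n * cabs (f z) in fM.
have seg (t : R) : 0 <= t <= 1 -> inball z (s / N) (z + (t%:C)%C *: (w - z)).
  move=> /andP[t0 t1] j; rewrite !mxE.
  have -> : z 0 j + (t%:C)%C * (w 0 j - z 0 j) - z 0 j = (t%:C)%C * (w 0 j - z 0 j) by ring.
  rewrite cabsM cabsR ger0_norm//.
  by rewrite (le_lt_trans _ (zw j))// ler_piMl ?cabs_ge0.
have seg2 (t : R) : 0 <= t <= 1 -> inball z (s / 2) (z + (t%:C)%C *: (w - z)).
  by move=> /seg; exact: inballW.
have s2s : s / 2 <= s by rewrite ler_pdivrMr// ler_peMr ?(ltW s0)// ler1n.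
have := @mean_value_segment _ _ f z (w - z) (n%:R * (8 * A / s * (s / N))).
rewrite [z + (w - z)]addrC subrK => mv.
have {}mv : cabs (f w - f z) <= 2 * (n%:R * (8 * A / s * (s / N))).
  apply: mv => t t01.
    by apply: df; apply: inballW (seg2 _ t01).
  rewrite /gradu (le_trans (cabs_sum _))//.
  rewrite -[n in n%:R]card_ord -sum1_card natr_sum mulr_suml.
  apply: ler_sum => j _; rewrite mul1r cabsM ler_pM ?cabs_ge0//.
    exact: (pderiv_bound s0 df fM j (seg2 _ t01)).
  by rewrite !mxE ltW//; exact: zw.
have E : 2 * (n%:R * (8 * A / s * (s / N))) <= cabs (f z) / 2.
  have -> : 2 * (n%:R * (8 * A / s * (s / N))) = (n%:R / n.+1%:R) * (cabs (f z) / 2).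
    by rewrite /A /N; field; rewrite !gt_eqF.
  rewrite ler_piMl ?divr_ge0 ?cabs_ge0// ler_pdivrMr// mul1r ler_nat leqnSn//.
have := cabsD (f z - f w) (f w); rewrite subrK cabs_distC.
move: mv E; clear; lra.
Qed.

(* [half_lower_bound] is applied at a maximum point of |f(w)| d(w)^n, where d is the distance to the
   boundary of a polydisc: there |f| is at most 2^n times its value on the ball of radius d/2. *)
Theorem evaluation_bound D p : (0 < n)%N -> open D -> D p -> exists r K : R, [/\ 0 < r, 0 < K,
  inball p r `<=` D &
  forall f, holo D f -> forall z, inball p r z -> ((cabs (f z) ^+ 2)%:E <= K%:E * L2sq D f)%E].
Proof.
move=> n0 /open_inballP oD /oD [r0 r00 rD].
(* A radius smaller than [r0] keeps the closed polydisc, over which the maximum is taken, inside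
   [D]. *)
pose rho := r0 / 2; have rho0 : 0 < rho by rewrite divr_gt0.
have rhor : rho < r0 by rewrite /rho ltr_pdivrMr// ltr_pMr// ltr1n.
pose kap : R := (32 * (n.+1)%:R * 2 ^+ n)^-1.
have kap0 : 0 < kap by rewrite invr_gt0 !mulr_gt0// exprn_gt0.
have kap1 : kap <= 1.
  rewrite invf_le1 ?mulr_gt0 ?exprn_gt0//.
  have n1 : 1 <= (n.+1)%:R :> R by rewrite ler1n.
  have p1 : 1 <= 2 ^+ n :> R by rewrite exprn_ege1// ler1n.
  by rewrite -[leLHS]mulr1 ler_pM// -[leLHS]mulr1 ler_pM// ler1n.
(* The 4 undoes the squared loss of one half in [half_lower_bound], [rho / 2] bounds the weight from
   below on the small polydisc, and [kap / 6] is the ratio of the cube side [s * kap / 3] to the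
   weight [2 * s] at the maximum point. *)
pose K := 4 * ((rho / 2) ^+ n) ^- 2 * ((kap / 6) ^+ n) ^- 2.
have K0 : 0 < K by rewrite /K !mulr_gt0// invr_gt0 !exprn_gt0// divr_gt0.
have r2 : rho / 2 <= rho by rewrite ler_pdivrMr// ler_peMr ?(ltW rho0)// ler1n.
exists (rho / 2), K; split=> //; first by rewrite divr_gt0.
  by apply: subset_trans rD; apply: inballW; exact: le_trans r2 (ltW rhor).
move=> f hf z zp.
pose F w := cabs (f w) * (rho - nrm (w - p)) ^+ n.
pose B := [set w : Cn | nrm (w - p) <= rho].
have BD w : B w -> D w.
  by move=> wB; apply: rD; apply/(nrm_inball _ _ r00); exact: le_lt_trans wB rhor.
have cF : {within B, continuous F}.
  apply: continuous_in_subspaceT => w; rewrite inE => /BD /hf df.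
  apply: (@continuousM _ _ (fun w => cabs (f w)) (fun w => (rho - nrm (w - p)) ^+ n)).
    exact: continuous_cabs df.
  apply: (@continuous_comp _ _ _ (fun w : Cn => rho - nrm (w - p)) (fun x : R => x ^+ n)).
    apply: (@continuousB _ _ _ (fun=> rho) (fun w : Cn => nrm (w - p))).
      exact: cst_continuous.
    exact: nrm_continuous.
  exact: exprn_continuous.
have B0 : B !=set0 by exists p; rewrite /B /= subrr nrm0 ltW.
have [c cB cmax] := compact_EVT_max B0 (@compact_closed_ball p rho) cF.
have {}cB : B c by move: cB; rewrite inE.
have {}cmax w : B w -> F w <= F c by move=> wB; apply: cmax; rewrite inE.
have zB : nrm (z - p) < rho / 2 by apply/nrm_inball; [rewrite divr_gt0|].
have Fz : cabs (f z) * (rho / 2) ^+ n <= F c.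
  apply: le_trans (cmax z _); last by rewrite /B /= (le_trans (ltW zB)).
  rewrite /F ler_wpM2l ?cabs_ge0// (ler_pXn2r n0) ?nnegrE; move: zB rho0; clear; lra.
have Fz0 : 0 <= F c by rewrite (le_trans _ Fz)// mulr_ge0 ?cabs_ge0// exprn_ge0// divr_ge0// ltW.
suff FL : ((F c ^+ 2 * ((kap / 6) ^+ n) ^+ 2 / 4)%:E <= L2sq D f)%E.
  apply: le_trans (_ : (K%:E * (F c ^+ 2 * ((kap / 6) ^+ n) ^+ 2 / 4)%:E <= _)%E); last first.
    by rewrite lee_wpmul2l// lee_fin ltW.
  rewrite -EFinM lee_fin.
  have -> : K * (F c ^+ 2 * ((kap / 6) ^+ n) ^+ 2 / 4) = (F c / (rho / 2) ^+ n) ^+ 2.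
    rewrite /K; field.
    by rewrite !gt_eqF ?exprn_gt0 ?divr_gt0.
  rewrite ler_pXn2r ?nnegrE ?cabs_ge0//; last by rewrite divr_ge0// exprn_ge0// divr_ge0// ltW.
  by rewrite ler_pdivlMr// exprn_gt0// divr_gt0.
have [Fc0|Fc0] := eqVneq (F c) 0.
  by rewrite Fc0 expr0n !mul0r L2sq_ge0.
pose s := (rho - nrm (c - p)) / 2.
have s0 : 0 < s.
  rewrite divr_gt0// subr_gt0 lt_neqAle cB andbT.
  by apply: contra_neq Fc0 => h; rewrite /F h subrr expr0n eqn0Ngt n0 mulr0.
have sE : rho - nrm (c - p) = 2 * s by rewrite /s; field.
have inB w : inball c s w -> B w /\ s <= rho - nrm (w - p).
  move=> /(nrm_inball _ _ s0) ws.
  have := nrmD (w - c) (c - p); rewrite addrA subrK.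
  by rewrite /B /=; move: ws sE s0; clear; lra.
have dfc w : inball c s w -> cdiff f w by move=> /inB[/BD /hf].
have fM w : inball c s w -> cabs (f w) <= 2 ^+ n * cabs (f c).
  move=> /inB[/cmax h1 h2]; have sn : 0 < s ^+ n by rewrite exprn_gt0.
  rewrite -(ler_pM2r sn).
  apply: le_trans (_ : F w <= _).
    by rewrite /F ler_wpM2l ?cabs_ge0// (ler_pXn2r n0) ?nnegrE ?(ltW s0)//; exact: le_trans (ltW s0) h2.
  by rewrite (le_trans h1)// /F sE exprMn mulrCA mulrA.
have := half_lower_bound s0 dfc fM; rewrite -/kap => low.
have := @L2sq_ge_inball D f c (s * kap / 3) (cabs (f c) / 2).
have -> : 3 * (s * kap / 3) = s * kap by field.
have -> : (cabs (f c) / 2) ^+ 2 * (s * kap / 3 * (s * kap / 3)) ^+ n =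
   F c ^+ 2 * ((kap / 6) ^+ n) ^+ 2 / 4.
  have -> : s * kap / 3 * (s * kap / 3) = (2 * s) ^+ 2 * (kap / 6) ^+ 2 by field.
  rewrite /F sE (exprMn n ((2 * s) ^+ 2)) (exprAC (2 * s) 2 n) (exprAC (kap / 6) 2 n); by field.
apply => //.
- by rewrite divr_gt0// mulr_gt0.
- by rewrite divr_ge0// cabs_ge0.
- move=> w wc; apply: BD; have [] // := inB w; apply: inballW wc.
  by rewrite ler_piMr// ltW.
Qed.

End L2bounds.

(** * Measurability of iterated integrals *)

Section JointMeasurability.
Variable R : realType.
Local Notation C := (R[i]).
Notation mu := (@lebesgue_measure R).
Local Notation mR := (measurableTypeR R).

(* Says that F t v is jointly measurable in t and the first k coordinates of v; these are moved into the
   parameter one complex coordinate at a time, mirroring the recursion of [iint]. *)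
Fixpoint jmeas (k : nat) : forall d (T : measurableType d),
    (T -> (nat -> C) -> \bar R) -> Prop :=
  match k with
  | 0 => fun d T F => measurable_fun [set: T] (fun t => F t (fun=> 0))
  | k'.+1 => fun d T F => @jmeas k' _ (T * mR * mR)%type
      (fun p v => F p.1.1 (fun j => if j == k' then Complex (p.1.2 : R) p.2 else v j))
  end.

(** Tonelli's theorem, applied twice per level, integrates the two real coordinates out of the
    parameter space again. *)
Lemma jmeas_iint k d (T : measurableType d) (F : T -> (nat -> C) -> \bar R) :
  (forall t v, 0 <= F t v)%E -> jmeas k F -> measurable_fun [set: T] (fun t => iint k (F t)).
Proof.
elim: k d T F => [|k IH] d T F F0 mF //=.
have m1 := IH _ _ _ (fun p v => F0 _ _) mF.
have m2 := @measurable_fun_fubini_tonelli_F _ _ (T * mR)%type mR R mu _ m1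
  (fun p => iint_ge0 k (fun v => F0 _ _)).
have m3 := @measurable_fun_fubini_tonelli_F _ _ T mR R mu _ m2
  (fun p => integral_ge0 _ (fun y _ => iint_ge0 k (fun v => F0 _ _))).
exact: m3.
Qed.

(** These are the measurability conditions under which the two outermost real integrals are additive
    and homogeneous. *)
Lemma jmeas_sections k d (T : measurableType d) (F : T -> (nat -> C) -> \bar R) t :
  (forall t v, 0 <= F t v)%E -> jmeas k.+1 F ->
  (forall x : R, measurable_fun [set: mR] (fun y : R =>
     iint k (fun v => F t (fun j => if j == k then Complex x y else v j)))) /\
  measurable_fun [set: mR] (fun x : R => (\int[mu]_y
     iint k (fun v => F t (fun j => if j == k then Complex x y else v j)))%E).
Proof.
move=> F0 mF; have m1 := @jmeas_iint k _ (T * mR * mR)%type _ (fun p v => F0 _ _) mF.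
split=> [x|].
  exact: (measurableT_comp m1 (pair1_measurable ((t, x) : (T * mR)%type))).
have m2 := @measurable_fun_fubini_tonelli_F _ _ (T * mR)%type mR R mu _ m1
  (fun p => iint_ge0 k (fun v => F0 _ _)).
exact: (measurableT_comp m2 (pair1_measurable t)).
Qed.

Local Open Scope ereal_scope.

(** The parameter carries the induction: with the outermost coordinate fixed at [x + iy], what
    remains is a family of the same kind at the parameter [((t, x), y)]. *)
Lemma iintD k d (T : measurableType d) (F G : T -> (nat -> C) -> \bar R) t :
  (forall t v, 0 <= F t v) -> (forall t v, 0 <= G t v) -> jmeas k F -> jmeas k G ->
  iint k (fun v => F t v + G t v) = iint k (F t) + iint k (G t).
Proof.
elim: k d T F G t => [|k IH] d T F G t F0 G0 mF mG //=.
have [F1 F2] := jmeas_sections t F0 mF; have [G1 G2] := jmeas_sections t G0 mG.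
rewrite -ge0_integralD//; try by move=> x _; apply: integral_ge0 => y _; apply: iint_ge0.
apply: eq_integral => x _.
rewrite -ge0_integralD//; try by move=> y _; apply: iint_ge0.
apply: eq_integral => y _.
exact: (IH _ _ _ _ ((t, x), y) (fun p v => F0 _ _) (fun p v => G0 _ _) mF mG).
Qed.

Lemma iintZ k d (T : measurableType d) (F : T -> (nat -> C) -> \bar R) t (c : R) :
  (0 <= c)%R -> (forall t v, 0 <= F t v) -> jmeas k F ->
  iint k (fun v => c%:E * F t v) = c%:E * iint k (F t).
Proof.
move=> c0; elim: k d T F t => [|k IH] d T F t F0 mF //=.
have [F1 F2] := jmeas_sections t F0 mF.
rewrite -ge0_integralZl//; try by move=> x _; apply: integral_ge0 => y _; apply: iint_ge0.
apply: eq_integral => x _.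
rewrite -ge0_integralZl//; try by move=> y _; apply: iint_ge0.
apply: eq_integral => y _.
exact: (IH _ _ _ ((t, x), y) (fun p v => F0 _ _) mF).
Qed.

End JointMeasurability.

(** * Measurability of the L2 integrand and the parallelogram law of the L2 norm *)

Section BorelL2.
Variable R : realType.
Local Notation C := (R[i]).
Variable n : nat.
Local Notation Cn := ('rV[C^o]_n).
Notation mu := (@lebesgue_measure R).
Local Notation mR := (measurableTypeR R).
Implicit Types (f g : Cn -> C) (D : set Cn) (p z w : Cn).

Definition coord_meas d (T : measurableType d) (H : T -> nat -> C) :=
  forall j, measurable_fun [set: T] (fun t => complex.Re (H t j) : mR) /\
            measurable_fun [set: T] (fun t => complex.Im (H t j) : mR).

Lemma rat_approx (x e : R) : 0 < e -> exists q : rat, `|x - ratr q| < e.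
Proof.
move=> e0; have [|q] := @rat_in_itvoo R (x - e) (x + e).
  by move: e0; clear; lra.
by rewrite in_itv /= => /andP[q1 q2]; exists q; rewrite ltr_norml; move: q1 q2; clear; lra.
Qed.

(** An open set is the union of the boxes with rational data that it contains. There are countably
    many of them, and membership in a box is a finite conjunction of measurable coordinate
    conditions. *)
Lemma open_preimage_meas d (T : measurableType d) (H : T -> nat -> C) (U : set Cn) :
  coord_meas H -> open U -> measurable [set t | U (\row_(j < n) H t j)].
Proof.
move=> mH /open_inballP oU.
pose I := ({ffun 'I_n -> rat * rat} * rat)%type.
pose box (i : I) := [set z : Cn | forall j,
  `|complex.Re (z 0 j) - ratr (i.1 j).1| < ratr i.2 /\
  `|complex.Im (z 0 j) - ratr (i.1 j).2| < ratr i.2].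
pose V (i : I) : set T := [set t | box i `<=` U /\ forall j : 'I_n,
  `|complex.Re (H t j) - ratr (i.1 j).1| < ratr i.2 /\
  `|complex.Im (H t j) - ratr (i.1 j).2| < ratr i.2].
have -> : [set t | U (\row_(j < n) H t j)] = \bigcup_i V i.
  apply/seteqP; split=> [t /oU[r r0 rU]|t [i _ [bU Hb]]]; last first.
    by apply: bU => j; rewrite mxE; exact: Hb.
  (* A point of the box differs from [H t] by less than [2 * q] in each real and imaginary part,
     hence by less than [4 * q < r] in modulus. *)
  have [q] := @rat_in_itvoo R 0 (r / 4) (divr_gt0 r0 (ltr0Sn _ 3)).
  rewrite in_itv /= => /andP[q0 qr].
  have /choice[c Hc] : forall j : 'I_n, exists c : rat * rat,
      `|complex.Re (H t j) - ratr c.1| < ratr q /\ `|complex.Im (H t j) - ratr c.2| < ratr q.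
    move=> j; have [c1 h1] := rat_approx (complex.Re (H t j)) q0.
    by have [c2 h2] := rat_approx (complex.Im (H t j)) q0; exists (c1, c2).
  exists ([ffun j => c j], q) => //; split=> [z zb|j]; last by rewrite ffunE; exact: Hc.
  apply: rU => j; have := zb j; rewrite /= ffunE => -[h1 h2]; have [h3 h4] := Hc j.
  rewrite mxE (le_lt_trans (cabs_le_ReIm _))// cReB cImB.
  have := ler_distD (ratr (c j).1) (complex.Re (z 0 j)) (complex.Re (H t j)).
  have := ler_distD (ratr (c j).2) (complex.Im (z 0 j)) (complex.Im (H t j)).
  rewrite ![`|ratr _ - _|]distrC; move: h1 h2 h3 h4 qr; clear; lra.
apply: countable_bigcupT_measurable => [|i]; first exact: countableP.
have [bU|nbU] := pselect (box i `<=` U); last first.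
  by rewrite (_ : V i = set0)//; apply/seteqP; split=> [t []|].
have -> : V i = \bigcap_(j in [set: 'I_n]) (
   [set t | `|complex.Re (H t j) - ratr (i.1 j).1| < ratr i.2] `&`
   [set t | `|complex.Im (H t j) - ratr (i.1 j).2| < ratr i.2]).
  apply/seteqP; split=> [t [_ Hb] j _|t Hb]; first exact: Hb.
  by split=> // j; exact: Hb.
have meas1 (h : T -> mR) (a b : R) : measurable_fun [set: T] h -> measurable [set t | `|h t - a| < b].
  move=> mh; rewrite (_ : [set t | _] = h @^-1` `]a - b, a + b[%classic).
    by rewrite -[X in measurable X]setTI; apply: mh => //; exact: measurable_itv.
  by apply/seteqP; split=> t /=; rewrite in_itv /= ltr_distl.
apply: fin_bigcap_measurable => //= j _.
by have [m1 m2] := mH j; apply: measurableI; exact: meas1.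
Qed.

Definition sqfun D f (z : Cn) : \bar R := ((\1_D z : R) * cabs (f z) ^+ 2)%:E.

Lemma sqfun_ge0 D f z : (0 <= sqfun D f z)%E.
Proof. by rewrite lee_fin mulr_ge0// exprn_ge0// cabs_ge0. Qed.

(** For [a >= 0] the points where the integrand exceeds [a] form an open set, because [D] is open
    and |f| is continuous on it; for [a < 0] they are all points. *)
Lemma sqfun_meas D f d (T : measurableType d) (H : T -> nat -> C) : open D -> holo D f ->
  coord_meas H -> measurable_fun [set: T] (fun t => sqfun D f (\row_(j < n) H t j)).
Proof.
move=> oD hf mH; apply/measurable_EFinP.
move=> mT; apply: (measurability _ (RGenOInfty.measurableE R)) => //.
move=> /= _ [_ [a ->] <-]; rewrite setTI.
have [a0|a0] := ltP a 0.
  rewrite (_ : _ @^-1` _ = setT)//; apply/seteqP; split=> // t _ /=.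
  by rewrite in_itv /= andbT (lt_le_trans a0)// mulr_ge0// exprn_ge0// cabs_ge0.
rewrite (_ : _ @^-1` _ = [set t | [set z | D z /\ a < cabs (f z) ^+ 2] (\row_(j < n) H t j)]).
  apply: open_preimage_meas => //; apply/open_inballP => z [Dz az].
  have /open_inballP/(_ _ Dz)[r r0 rD] := oD.
  have /cvgrPdist_lt := continuous_cabs (hf z Dz).
  move/(_ ((cabs (f z) - Num.sqrt a))).
  have sz : Num.sqrt a < cabs (f z).
    by rewrite -[ltRHS](ger0_norm (cabs_ge0 _)) -sqrtr_sqr ltr_sqrt// (le_lt_trans a0).
  rewrite subr_gt0 sz => /(_ isT) /nbhs_ballP[e e0 He].
  have [eE e0'] := complex_gt0E e0.
  exists (Num.min r (complex.Re e)); first by rewrite lt_min r0.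
  move=> w zw; split; first by apply: rD; apply: inballW zw; rewrite ge_min lexx.
  have wr : inball z (complex.Re e) w by apply: inballW zw; rewrite ge_min lexx orbT.
  move/(ball_inball _ _ e0') : wr; rewrite -eE => /He /=.
  rewrite ltr_norml => /andP[_ h].
  have h2 : Num.sqrt a < cabs (f w) by move: h; clear; lra.
  by rewrite -[ltLHS](sqr_sqrtr a0) ltr_pXn2r ?nnegrE ?sqrtr_ge0 ?cabs_ge0.
apply/seteqP; split=> t /=; rewrite in_itv /= andbT indicE.
- case: (boolP (_ \in D)) => [/set_mem h|_]; first by rewrite mul1r.
  by rewrite mul0r ltNge a0.
- by move=> [h1 h2]; rewrite mem_set// mul1r.
Qed.

(** The coordinates from [k] on have already moved into the parameter, through [G]; this form is
    preserved by the recursion of [jmeas]. *)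
Lemma sqfun_jmeas D f k d (T : measurableType d) (G : T -> nat -> C) : open D -> holo D f ->
  coord_meas G ->
  jmeas k (fun t v => sqfun D f (\row_(j < n) (if (j < k)%N then v j else G t j))).
Proof.
move=> oD hf; elim: k d T G => [|k IH] d T G mG /=; first exact: sqfun_meas.
pose G' (q : (T * mR * mR)%type) (j : nat) : C := if j == k then Complex (q.1.2 : R) q.2 else G q.1.1 j.
have -> : (fun (q : T * mR * mR) (v : nat -> C) => sqfun D f (\row_(j < n) (if (j < k.+1)%N then
    (if (j : nat) == k then Complex (q.1.2 : R) q.2 else v j) else G q.1.1 j))) =
  (fun q (v : nat -> C) => sqfun D f (\row_(j < n) (if (j < k)%N then v j else G' q j))).
  apply/funext => q; apply/funext => v; congr sqfun; apply/rowP => j; rewrite !mxE /G' ltnS leq_eqVlt.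
  by case: eqVneq => [->|_] /=; rewrite ?ltnn.
apply: IH => j; rewrite /G'; case: (j == k); first by split=> /=; do ?exact: measurableT_comp.
have [m1 m2] := mG j; split.
- exact: (measurableT_comp m1 (measurableT_comp measurable_fst measurable_fst)).
- exact: (measurableT_comp m2 (measurableT_comp measurable_fst measurable_fst)).
Qed.

Lemma L2sq_jmeas D f : open D -> holo D f ->
  jmeas n (fun (_ : mR) (v : nat -> C) => sqfun D f (\row_(j < n) v j)).
Proof.
move=> oD hf.
have -> : (fun (_ : mR) (v : nat -> C) => sqfun D f (\row_(j < n) v j)) =
  (fun (_ : mR) (v : nat -> C) => sqfun D f (\row_(j < n) (if (j < n)%N then v j else 0))).
  by apply/funext => t; apply/funext => v; congr sqfun; apply/rowP => j; rewrite !mxE ltn_ord.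
apply: (@sqfun_jmeas D f n _ mR (fun _ _ => 0) oD hf).
by move=> j; split; exact: measurable_cst.
Qed.

Lemma holoD D f g : holo D f -> holo D g -> holo D (fun z => f z + g z).
Proof. by move=> hf hg z Dz; apply: differentiableD; [exact: hf|exact: hg]. Qed.

Lemma holoZ D f (c : C) : holo D f -> holo D (fun z => c * f z).
Proof. by move=> hf z Dz; apply: (@differentiableZ _ _ _ (f : Cn -> C^o) c); exact: hf. Qed.

Lemma holoB D f g : holo D f -> holo D g -> holo D (fun z => f z - g z).
Proof. by move=> hf hg z Dz; apply: differentiableB; [exact: hf|exact: hg]. Qed.

Lemma cabs_parallelogram (z w : C) :
  cabs (z + w) ^+ 2 + cabs (z - w) ^+ 2 = 2 * (cabs z ^+ 2 + cabs w ^+ 2).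
Proof. by rewrite !sqr_cabs !cReD !cImD !cReN !cImN; ring. Qed.

Lemma L2sqE D f : L2sq D f = iint n (fun v => sqfun D f (\row_(j < n) v j)).
Proof. by []. Qed.

Lemma L2sqZ D f (c : C) : open D -> holo D f ->
  L2sq D (fun z => c * f z) = ((cabs c ^+ 2)%:E * L2sq D f)%E.
Proof.
move=> oD hf; rewrite !L2sqE.
rewrite -(iintZ (T := mR) 0 (exprn_ge0 2 (cabs_ge0 c)) (fun _ v => sqfun_ge0 D f _) (L2sq_jmeas oD hf)).
congr iint; apply/funext => v; rewrite /sqfun -EFinM cabsM exprMn; congr EFin; ring.
Qed.

Lemma L2sq_parallelogram D f g : open D -> holo D f -> holo D g ->
  (L2sq D (fun z => f z + g z)%R + L2sq D (fun z => f z - g z)%R =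
   2%:E * (L2sq D f + L2sq D g))%E.
Proof.
move=> oD hf hg; rewrite !L2sqE.
have p (h : Cn -> C) : forall (t : mR) (v : nat -> C), (0 <= sqfun D h (\row_(j < n) v j))%E.
  by move=> t v; exact: sqfun_ge0.
rewrite -(iintD (T := mR) 0 (p _) (p _) (L2sq_jmeas oD (holoD hf hg)) (L2sq_jmeas oD (holoB hf hg))).
have -> : (fun v : nat -> C => sqfun D (fun z => f z + g z)%R (\row_(j < n) v j) +
    sqfun D (fun z => f z - g z)%R (\row_(j < n) v j))%E =
  (fun v => (2%:E * sqfun D f (\row_(j < n) v j)) + (2%:E * sqfun D g (\row_(j < n) v j)))%E.
  apply/funext => v; rewrite /sqfun -!EFinM -!EFinD -mulrDr cabs_parallelogram; congr EFin; ring.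
have jm2 (h : Cn -> C) : holo D h -> jmeas n (fun (_ : mR) (v : nat -> C) => (2%:E * sqfun D h (\row_(j < n) v j))%E).
  (* Twice |h|^2 is the squared modulus of [sqrt 2 * h], again an integrand whose measurability is
     known. *)
  move=> hh; pose c : C := ((Num.sqrt 2)%:C)%C.
  have := L2sq_jmeas oD (holoZ c hh).
  congr (jmeas n _); apply/funext => t; apply/funext => v; rewrite /sqfun -EFinM cabsM exprMn.
  rewrite /c cabsR ger0_norm ?sqrtr_ge0// sqr_sqrtr//; congr EFin; ring.
have p2 (h : Cn -> C) : forall (t : mR) (v : nat -> C), (0 <= 2%:E * sqfun D h (\row_(j < n) v j))%E.
  by move=> t v; apply: mule_ge0; [rewrite lee_fin|exact: sqfun_ge0].
rewrite (iintD (T := mR) 0 (p2 f) (p2 g) (jm2 _ hf) (jm2 _ hg)).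
rewrite (iintZ (T := mR) 0 (ler0n _ 2) (p f) (L2sq_jmeas oD hf)).
rewrite (iintZ (T := mR) 0 (ler0n _ 2) (p g) (L2sq_jmeas oD hg)).
by rewrite ge0_muleDr//; apply: iint_ge0 => v; exact: sqfun_ge0.
Qed.

End BorelL2.

Lemma conj_mulR (R : realType) (z : R[i]) (r : R) :
  Num.conj (z * (r%:C)%C) = Num.conj z * (r%:C)%C.
Proof. by case: z => a b; apply: complex_ext => /=; ring. Qed.

(** * Quadratic forms satisfying the parallelogram law *)

(** [W] is a predicate, so that [E] can be a full function space; [q] is a squared seminorm and may
    vanish on nonzero vectors. *)
Record prehilbert (R : realType) (E : lmodType R[i]) (W : E -> Prop) (q : E -> R) : Prop := {
  prehilbertD : forall x y, W x -> W y -> W (x + y);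
  prehilbertZ : forall (c : R[i]) x, W x -> W (c *: x);
  prehilbert_ge0 : forall x, W x -> 0 <= q x;
  prehilbert_scale : forall (c : R[i]) x, W x -> q (c *: x) = cabs c ^+ 2 * q x;
  prehilbert_parallelogram : forall x y, W x -> W y -> q (x + y) + q (x - y) = 2 * (q x + q y) }.

Section JordanVonNeumann.
Variable R : realType.
Local Notation C := (R[i]).
Variables (E : lmodType C) (W : E -> Prop) (q : E -> R).
Hypothesis Hq : prehilbert W q.
Let WD := prehilbertD Hq.
Let WZ := prehilbertZ Hq.
Let q_ge0 := prehilbert_ge0 Hq.
Let qZ := prehilbert_scale Hq.
Let qP := prehilbert_parallelogram Hq.
Implicit Types x y z : E.

Lemma memWN x : W x -> W (- x).
Proof. by rewrite -scaleN1r; exact: WZ. Qed.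

Lemma memWB x y : W x -> W y -> W (x - y).
Proof. by move=> Wx Wy; apply: WD => //; exact: memWN. Qed.

Lemma memW0 x : W x -> W 0.
Proof. by move=> Wx; rewrite -(scale0r x); exact: WZ. Qed.

Lemma qN x : W x -> q (- x) = q x.
Proof. by move=> Wx; rewrite -scaleN1r qZ// cabsN cabs1 expr1n mul1r. Qed.

Lemma q0 x : W x -> q 0 = 0.
Proof. by move=> Wx; rewrite -(scale0r x) qZ// cabs0 expr0n mul0r. Qed.

Definition polar x y : R := (q (x + y) - q (x - y)) / 4.

Lemma polarC x y : W x -> W y -> polar x y = polar y x.
Proof.
by move=> Wx Wy; rewrite /polar [y + x]addrC -(qN (memWB Wx Wy)) opprB.
Qed.

Lemma polarxx x : W x -> polar x x = q x.
Proof.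
move=> Wx; rewrite /polar subrr (q0 Wx) -mulr2n -scaler_nat qZ//.
have -> : (2%:R : C) = ((2%:R)%:C)%C by rewrite rmorph_nat.
by rewrite cabsR ger0_norm//; field.
Qed.

Lemma qBpolar x y : W x -> W y -> q (x - y) = q x - 2 * polar x y + q y.
Proof. by move=> Wx Wy; have := qP Wx Wy; rewrite /polar; lra. Qed.

Lemma polar_bound x y : W x -> W y -> `|polar x y| <= (q x + q y) / 2.
Proof.
move=> Wx Wy; have := qP Wx Wy; have := q_ge0 (WD Wx Wy); have := q_ge0 (memWB Wx Wy).
by rewrite /polar ler_norml; lra.
Qed.

Lemma polar0l x : W x -> polar 0 x = 0.
Proof. by move=> Wx; rewrite /polar add0r sub0r qN// subrr mul0r. Qed.

Lemma polarD2 x z y : W x -> W z -> W y -> polar (x + z) y + polar (x - z) y = 2 * polar x y.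
Proof.
move=> Wx Wz Wy; rewrite /polar.
have h1 := qP (WD Wx Wy) Wz; have h2 := qP (memWB Wx Wy) Wz.
have -> : x + z + y = x + y + z by rewrite addrAC.
have -> : x - z + y = x + y - z by rewrite addrAC.
have -> : x + z - y = x - y + z by rewrite addrAC.
have -> : x - z - y = x - y - z by rewrite addrAC.
by lra.
Qed.

Lemma scaler2C x : x + x = (2%:R : C) *: x.
Proof. by rewrite scaler_nat mulr2n. Qed.

Lemma half_half x : (2%:R^-1 : C) *: x + (2%:R^-1 : C) *: x = x.
Proof. by rewrite scaler2C scalerA divff ?scale1r// pnatr_eq0. Qed.

(** With [a = x / 2] and [b = z / 2] both sides equal [2 * polar (a + b) y]: [polarD2] at [a + b]
    with increment [a - b] gives the right side, with increment [a + b] the left side. *)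
Lemma polarDl x z y : W x -> W z -> W y -> polar (x + z) y = polar x y + polar z y.
Proof.
move=> Wx Wz Wy.
pose a := (2%:R^-1 : C) *: x; pose b := (2%:R^-1 : C) *: z.
have Wa : W a := WZ _ Wx; have Wb : W b := WZ _ Wz.
have h1 := polarD2 (WD Wa Wb) (memWB Wa Wb) Wy.
have e1 : a + b + (a - b) = x by rewrite addrACA subrr addr0 half_half.
have e2 : a + b - (a - b) = z by rewrite opprB [b - a]addrC addrACA subrr add0r half_half.
have h2 := polarD2 (WD Wa Wb) (WD Wa Wb) Wy.
rewrite subrr polar0l// addr0 addrACA half_half half_half in h2.
by rewrite e1 e2 -h2 in h1.
Qed.

Lemma polarNl x y : W x -> W y -> polar (- x) y = - polar x y.
Proof.
move=> Wx Wy; have := polarDl Wx (memWN Wx) Wy.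
by rewrite subrr polar0l//; lra.
Qed.

Lemma polarDr x y z : W x -> W y -> W z -> polar x (y + z) = polar x y + polar x z.
Proof.
move=> Wx Wy Wz; rewrite polarC ?polarDl//; try exact: WD.
by rewrite [polar y x]polarC// [polar z x]polarC.
Qed.

Lemma additive_bounded_linear (A : R -> R) (M : R) :
  (forall s t, A (s + t) = A s + A t) -> (forall t, 0 <= t <= 1 -> `|A t| <= M) ->
  forall t, A t = t * A 1.
Proof.
move=> AD AM t; pose d t := A t - t * A 1.
have dD s u : d (s + u) = d s + d u by rewrite /d AD mulrDl; ring.
have A0 : A 0 = 0 by have := AD 0 0; rewrite addr0; lra.
have d1 : d 1 = 0 by rewrite /d mul1r subrr.
have d0 : d 0 = 0 by rewrite /d A0 mul0r subrr.
have dn k : d k%:R = 0.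
  by elim: k => [//|k IH]; rewrite -natr1 dD IH d1 addr0.
have dN s : d (- s) = - d s by have := dD s (- s); rewrite subrr d0; lra.
have db s : 0 <= s -> `|d s| <= M + `|A 1|.
  move=> s0; have /andP[k1 k2] := truncn_itv s0.
  have -> : s = (s - (Num.truncn s)%:R) + (Num.truncn s)%:R by rewrite subrK.
  rewrite dD dn addr0; set u := s - _.
  have u01 : 0 <= u <= 1.
    by move: k2; rewrite -natr1 /u => k2; lra.
  rewrite (le_trans (ler_normB _ _))// lerD ?AM// normrM ler_piMl//.
  by case/andP: u01 => u0 u1; rewrite ger0_norm.
have dMn s k : d (k%:R * s) = k%:R * d s.
  elim: k => [|k IH]; first by rewrite !mul0r.
  by rewrite -natr1 !mulrDl !mul1r dD IH.
have dpos s : 0 <= s -> d s = 0.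
  move=> s0; apply/eqP; rewrite -normr_le0 leNgt; apply/negP => ds.
  have [k] : exists k : nat, (M + `|A 1|) / `|d s| < k%:R.
    by exists (Num.truncn ((M + `|A 1|) / `|d s|)).+1; rewrite truncnS_gt.
  have M0 : 0 <= M + `|A 1| := le_trans (normr_ge0 _) (db 0 (lexx 0)).
  rewrite ltr_pdivrMr// ltNge => /negP; apply.
  by have := db (k%:R * s); rewrite dMn normrM normr_nat; apply; rewrite mulr_ge0.
apply/eqP; rewrite -subr_eq0 -/(d t).
have [t0|t0] := leP 0 t; first by rewrite dpos.
by rewrite -[t]opprK dN dpos ?oppr0// oppr_ge0 ltW.
Qed.

Lemma polarZl (t : R) x y : W x -> W y -> polar ((t%:C)%C *: x) y = t * polar x y.
Proof.
move=> Wx Wy.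
have := @additive_bounded_linear (fun t => polar ((t%:C)%C *: x) y) ((q x + q y) / 2).
rewrite scale1r; apply.
- by move=> s u; rewrite rmorphD /= scalerDl polarDl//; exact: WZ.
- move=> s /andP[s0 s1]; rewrite (le_trans (polar_bound (WZ _ Wx) Wy))// qZ//.
  have s2 : cabs (s%:C)%C ^+ 2 <= 1 by rewrite cabsR ger0_norm// expr_le1.
  by rewrite ler_pM2r// lerD2r ler_piMl// q_ge0.
Qed.

Lemma polarZr (t : R) x y : W x -> W y -> polar x ((t%:C)%C *: y) = t * polar x y.
Proof.
by move=> Wx Wy; rewrite polarC ?polarZl//; [rewrite polarC|exact: WZ].
Qed.

Lemma polarii x y : W x -> W y -> polar ('i%C *: x) ('i%C *: y) = polar x y.
Proof.
move=> Wx Wy; have ci : cabs ('i%C : C) = 1 by rewrite /cabs /= expr0n add0r expr1n sqrtr1.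
rewrite /polar -scalerDr -scalerBr !qZ ?ci ?expr1n ?mul1r//; [exact: memWB|exact: WD].
Qed.

Lemma scaleii x : ('i%C : C) *: ('i%C *: x) = - x.
Proof. by rewrite scalerA -expr2 sqr_i scaleN1r. Qed.

Lemma polarNr x y : W x -> W y -> polar x (- y) = - polar x y.
Proof. by move=> Wx Wy; rewrite polarC ?polarNl//; [rewrite polarC|exact: memWN]. Qed.

Lemma polarir x y : W x -> W y -> polar x ('i%C *: y) = - polar ('i%C *: x) y.
Proof.
move=> Wx Wy; rewrite -(polarii Wx (WZ _ Wy)) scaleii polarNr//; exact: WZ.
Qed.

(** The form is linear in its first argument: [<x, iy> = - i <x, y>], so the real part of [<x, iy>]
    is the imaginary part of [<x, y>]. *)
Definition herm x y : C := Complex (polar x y) (polar x ('i%C *: y)).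

Lemma hermDl x z y : W x -> W z -> W y -> herm (x + z) y = herm x y + herm z y.
Proof.
by move=> Wx Wz Wy; apply: complex_ext; rewrite ?cReD ?cImD /= polarDl//; exact: WZ.
Qed.

Lemma hermC x y : W x -> W y -> herm x y = Num.conj (herm y x).
Proof.
move=> Wx Wy; apply: complex_ext => /=; first exact: polarC.
by rewrite (polarir Wx Wy) polarC//; exact: WZ.
Qed.

Lemma hermZl (c : C) x y : W x -> W y -> herm (c *: x) y = c * herm x y.
Proof.
move=> Wx Wy; have Wiy := WZ 'i%C Wy; have Wix := WZ 'i%C Wx.
have -> : c *: x = ((complex.Re c)%:C)%C *: x + ((complex.Im c)%:C)%C *: ('i%C *: x).
  by rewrite scalerA -scalerDl [_ * 'i%C]mulrC -complexE.
apply: complex_ext; rewrite ?cReM ?cImM /= polarDl ?polarZl//; try exact: WZ.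
- by rewrite polarir// mulrN opprK.
- by rewrite polarii// addrC.
Qed.

Lemma hermZr (c : C) x y : W x -> W y -> herm x (c *: y) = Num.conj c * herm x y.
Proof.
move=> Wx Wy; rewrite hermC//; last exact: WZ.
by rewrite hermZl// rmorphM /= -hermC.
Qed.

Lemma hermxx x : W x -> herm x x = ((q x)%:C)%C.
Proof.
move=> Wx; apply: complex_ext => /=; first exact: polarxx.
have := polarir Wx Wx; rewrite [polar ('i%C *: x) x]polarC//; last exact: WZ.
by lra.
Qed.

Lemma memW_sum (I : finType) (F : I -> E) x : W x -> (forall i, W (F i)) -> W (\sum_i F i).
Proof. by move=> Wx WF; elim/big_ind: _ => //; exact: memW0 Wx. Qed.

Lemma herm_suml (I : finType) (F : I -> E) y : W y -> (forall i, W (F i)) ->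
  herm (\sum_i F i) y = \sum_i herm (F i) y.
Proof.
move=> Wy WF; suff [] : W (\sum_i F i) /\ herm (\sum_i F i) y = \sum_i herm (F i) y by [].
apply: (big_rec2 (fun a b => W a /\ herm a y = b)) => [|i a b _ [Wb <-]].
  split; first exact: memW0 Wy.
  by rewrite -(scale0r y) hermZl// mul0r.
by split; [exact: WD|rewrite hermDl].
Qed.

Lemma herm_sumr (I : finType) (F : I -> E) y : W y -> (forall i, W (F i)) ->
  herm y (\sum_i F i) = \sum_i herm y (F i).
Proof.
move=> Wy WF; rewrite hermC ?herm_suml ?rmorph_sum//; last exact: memW_sum Wy WF.
by apply: eq_bigr => i _; rewrite [RHS]hermC.
Qed.

(** Pythagoras for the orthogonal projection onto the line spanned by [y]. *)
Lemma q_proj x y : W x -> W y -> 0 < q y ->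
  q (x - (herm x y / ((q y)%:C)%C) *: y) = q x - cabs (herm x y) ^+ 2 / q y.
Proof.
move=> Wx Wy qy; set l := herm x y / _.
have Wly := WZ l Wy.
rewrite qBpolar// qZ// /l cabsM cabsV cabsR (gtr0_norm qy).
have -> : polar x (l *: y) = complex.Re (herm x (l *: y)) by [].
have cl : Num.conj l * herm x y = ((cabs (herm x y) ^+ 2 / q y)%:C)%C.
  have -> : l = herm x y * (((q y)^-1)%:C)%C by rewrite /l fmorphV.
  rewrite conj_mulR mulrAC [Num.conj _ * _]mulrC mulCconj -rmorphM //.
rewrite hermZr// cl.
rewrite /=; field; exact: lt0r_neq0.
Qed.

End JordanVonNeumann.

(** * The dual norm inherits the parallelogram law *)

Section DualNorm.
Variable R : realType.
Local Notation C := (R[i]).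
Variables (F : lmodType C) (V : F -> Prop) (N : F -> R).
Hypotheses (V0 : V 0) (VD : forall f g, V f -> V g -> V (f + g))
  (VZ : forall (c : C) f, V f -> V (c *: f))
  (N_ge0 : forall f, V f -> 0 <= N f)
  (NZ : forall (c : C) f, V f -> N (c *: f) = cabs c ^+ 2 * N f)
  (NP : forall f g, V f -> V g -> N (f + g) + N (f - g) = 2 * (N f + N g)).
Local Notation E := (F -> C^o).
Implicit Types (L M : E).

(** Linearity and boundedness are demanded on [V] only; the values outside [V] are arbitrary. *)
Definition dual L := [/\ forall f g, V f -> V g -> L (f + g) = L f + L g,
  forall (c : C) f, V f -> L (c *: f) = c * L f &
  exists K : R, forall f, V f -> cabs (L f) ^+ 2 <= K * N f].

Definition dualnorm2 L : R := sup [set cabs (L f) ^+ 2 | f in [set f | V f /\ N f <= 1]].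

Lemma N0 : N 0 = 0.
Proof. by rewrite -(scale0r 0) NZ// cabs0 expr0n mul0r. Qed.

Lemma dual_has_sup L : dual L -> has_sup [set cabs (L f) ^+ 2 | f in [set f | V f /\ N f <= 1]].
Proof.
move=> [_ _ [K HK]]; split; first by exists (cabs (L 0) ^+ 2); exists 0 => //=; rewrite N0 ler01.
exists `|K| => _ [f [Vf Nf] <-]; rewrite (le_trans (HK _ Vf))//.
rewrite (le_trans (ler_wpM2r (N_ge0 Vf) (ler_norm K)))//.
by rewrite ler_piMr.
Qed.

Lemma dualnorm2_ge0 L : dual L -> 0 <= dualnorm2 L.
Proof.
move=> /dual_has_sup[ne ub]; apply: le_trans (exprn_ge0 2 (cabs_ge0 (L 0))) _.
by apply: ub_le_sup => //; exists 0 => //=; rewrite N0 ler01.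
Qed.

Lemma dualnorm2_ub L f : dual L -> V f -> cabs (L f) ^+ 2 <= dualnorm2 L * N f.
Proof.
move=> dL Vf; have [_ LZ [K HK]] := dL; have [ne ub] := dual_has_sup dL.
(* A vector with [N f = 0] cannot be normalized; there the bound in [dual] gives [L f = 0]. *)
have := N_ge0 Vf; rewrite le_eqVlt => /predU1P[N0|Npos].
  by have := HK _ Vf; rewrite -N0 !mulr0.
have s0 : 0 < Num.sqrt (N f) by rewrite sqrtr_gt0.
pose c : C := (((Num.sqrt (N f))^-1)%:C)%C.
have c2 : cabs c ^+ 2 = (N f)^-1.
  by rewrite cabsR ger0_norm ?invr_ge0 ?sqrtr_ge0// exprVn sqr_sqrtr// ltW.
have : cabs (L (c *: f)) ^+ 2 <= dualnorm2 L.
  apply: ub_le_sup => //; exists (c *: f) => //=; split; first exact: VZ.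
  by rewrite NZ// c2 mulVf// gt_eqF.
by rewrite LZ// cabsM exprMn c2 mulrC ler_pdivrMr.
Qed.

Lemma dualnorm2_le L K : (forall f, V f -> N f <= 1 -> cabs (L f) ^+ 2 <= K) -> dualnorm2 L <= K.
Proof.
move=> H; apply: ge_sup; first by exists (cabs (L 0) ^+ 2); exists 0 => //=; rewrite N0 ler01.
by move=> _ [f [Vf Nf] <-]; exact: H.
Qed.

Lemma dualD L M : dual L -> dual M -> dual (L + M).
Proof.
move=> [L1 L2 [K HK]] [M1 M2 [K' HK']]; split.
- by move=> f g Vf Vg; rewrite !fctE /= L1// M1// addrACA.
- by move=> c f Vf; rewrite !fctE /= L2// M2// mulrDr.
- exists (2 * (K + K')) => f Vf; have := HK f Vf; have := HK' f Vf.
  have := cabs_parallelogram (L f) (M f); rewrite -[(L + M) f]/(L f + M f).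
  have := exprn_ge0 2 (cabs_ge0 (L f - M f)); rewrite -mulrA [(K + K') * _]mulrDl.
  by lra.
Qed.

Lemma dualZ (c : C) L : dual L -> dual (c *: L).
Proof.
move=> [L1 L2 [K HK]]; split.
- by move=> f g Vf Vg; rewrite -![(c *: L) _]/(c * L _) L1// mulrDr.
- by move=> a f Vf; rewrite -![(c *: L) _]/(c * L _) L2// mulrCA.
- exists (cabs c ^+ 2 * K) => f Vf; rewrite -[(c *: L) f]/(c * L f) cabsM exprMn -mulrA.
  by rewrite ler_wpM2l ?exprn_ge0 ?cabs_ge0// HK.
Qed.

Lemma dualnorm2Z (c : C) L : dual L -> dualnorm2 (c *: L) = cabs c ^+ 2 * dualnorm2 L.
Proof.
have le (a : C) M : dual M -> dualnorm2 (a *: M) <= cabs a ^+ 2 * dualnorm2 M.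
  move=> dM; apply: dualnorm2_le => f Vf Nf.
  rewrite -[(a *: M) f]/(a * M f) cabsM exprMn ler_wpM2l ?exprn_ge0 ?cabs_ge0//.
  by rewrite (le_trans (dualnorm2_ub dM Vf))// ler_piMr// dualnorm2_ge0.
move=> dL; have [->|c0] := eqVneq c 0.
  apply/eqP; rewrite eq_le le//= cabs0 expr0n mul0r.
  by apply: dualnorm2_ge0; exact: dualZ.
apply/eqP; rewrite eq_le le//=.
have := le (c^-1) (c *: L) (dualZ c dL).
rewrite scalerA mulVf// scale1r cabsV exprVn mulrC ler_pdivlMr//; first by rewrite mulrC.
by rewrite exprn_gt0// lt_neqAle cabs_ge0 eq_sym cabs_eq0 c0.
Qed.

(** For [f] and [g] in the unit ball put [a = conj ((L + M) f)] and [b = conj ((L - M) g)]. The sum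
    [S] of the two squared moduli equals [L (a f + b g) + M (a f - b g)]. By Cauchy-Schwarz and the
    parallelogram law of [N], [S ^+ 2] is at most the sum of the two squared dual norms times
    [2 * S]; divide by [S]. *)
Lemma dualnorm2_semiparallelogram L M : dual L -> dual M ->
  dualnorm2 (L + M) + dualnorm2 (L - M) <= 2 * (dualnorm2 L + dualnorm2 M).
Proof.
move=> dL dM.
have key f g : V f -> V g -> N f <= 1 -> N g <= 1 ->
  cabs ((L + M) f) ^+ 2 + cabs ((L - M) g) ^+ 2 <= 2 * (dualnorm2 L + dualnorm2 M).
  move=> Vf Vg Nf Ng.
  have [L1 L2 _] := dL; have [M1 M2 _] := dM.
  pose a : C := Num.conj ((L + M) f); pose b : C := Num.conj ((L - M) g).
  set S := _ + _.
  have Va := VZ a Vf; have Vb := VZ b Vg.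
  have VNb : V (- (b *: g)) by rewrite -scaleN1r; exact: VZ.
  have Vu := VD Va Vb; have Vv := VD Va VNb.
  have S0 : 0 <= S by rewrite addr_ge0// exprn_ge0// cabs_ge0.
  have E1 : (S%:C)%C = L (a *: f + b *: g) + M (a *: f - b *: g) :> C.
    rewrite /S rmorphD /= -!mulCconj -/a -/b.
    rewrite L1// M1// -scaleNr !L2// !M2// -[(L + M) f]/(L f + M f) -[(L - M) g]/(L g - M g).
    ring.
  pose x := cabs (L (a *: f + b *: g)); pose y := cabs (M (a *: f - b *: g)).
  have E2 : S <= x + y.
    by rewrite -[S]ger0_norm// -cabsR E1 cabsD.
  pose n1 := N (a *: f + b *: g); pose n2 := N (a *: f - b *: g).
  have x2 : x ^+ 2 <= dualnorm2 L * n1 by exact: dualnorm2_ub.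
  have y2 : y ^+ 2 <= dualnorm2 M * n2 by exact: dualnorm2_ub.
  have n12 : n1 + n2 <= 2 * S.
    rewrite /n1 /n2 NP// !NZ// /a /b !cabs_conj /S.
    have k1 : cabs ((L + M) f) ^+ 2 * N f <= cabs ((L + M) f) ^+ 2 by rewrite ler_piMr// exprn_ge0// cabs_ge0.
    have k2 : cabs ((L - M) g) ^+ 2 * N g <= cabs ((L - M) g) ^+ 2 by rewrite ler_piMr// exprn_ge0// cabs_ge0.
    by rewrite ler_pM2l// lerD.
  have n10 : 0 <= n1 := N_ge0 Vu; have n20 : 0 <= n2 := N_ge0 Vv.
  have l0 := dualnorm2_ge0 dL; have m0 := dualnorm2_ge0 dM.
  have x0 : 0 <= x := cabs_ge0 _; have y0 : 0 <= y := cabs_ge0 _.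
  have S2 : S ^+ 2 <= (dualnorm2 L + dualnorm2 M) * (n1 + n2).
    have xy2 : (x + y) ^+ 2 <= (dualnorm2 L + dualnorm2 M) * (n1 + n2).
      move: (dualnorm2 L) (dualnorm2 M) l0 m0 x2 y2 => l m l0 m0 x2 y2.
      have h : 2 * (x * y) <= l * n2 + m * n1.
        have h1 : (x * y) ^+ 2 <= (l * n1) * (m * n2).
          by rewrite exprMn ler_pM// exprn_ge0.
        have h2 : 0 <= (l * n2 - m * n1) ^+ 2 := sqr_ge0 _.
        have h3 : 0 <= l * n2 + m * n1 by rewrite addr_ge0// mulr_ge0.
        rewrite -(ler_pXn2r (n := 2)) ?nnegrE//; last by rewrite mulr_ge0// mulr_ge0.
        have -> : (l * n2 + m * n1) ^+ 2 = (l * n2 - m * n1) ^+ 2 + 4 * ((l * n1) * (m * n2)) by ring.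
        rewrite exprMn -natrX; move: h1 h2; move: (_ ^+ 2) (_ * _) => u v; clear; lra.
      have -> : (x + y) ^+ 2 = x ^+ 2 + y ^+ 2 + 2 * (x * y) by ring.
      have -> : (l + m) * (n1 + n2) = l * n1 + m * n2 + (l * n2 + m * n1) by ring.
      by apply: lerD h; exact: lerD.
    by apply: le_trans xy2; rewrite ler_pXn2r ?nnegrE ?S0 ?(addr_ge0 x0 y0).
  have S3 : S ^+ 2 <= (dualnorm2 L + dualnorm2 M) * (2 * S).
    by rewrite (le_trans S2)// ler_wpM2l// addr_ge0.
  have [->|Sn0] := eqVneq S 0; first by rewrite mulr_ge0// addr_ge0.
  have Sp : 0 < S by rewrite lt_neqAle eq_sym Sn0.
  by move: S3; rewrite expr2 mulrA ler_pM2r// mulrC.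
have dLM := dualD dL dM.
have dLM' : dual (L - M) by rewrite -scaleN1r; apply: dualD dL (dualZ _ dM).
rewrite -lerBrDr; apply: dualnorm2_le => f Vf Nf.
rewrite lerBrDl -lerBrDr; apply: dualnorm2_le => g Vg Ng.
by rewrite lerBrDl; exact: key.
Qed.

(** The inequality applied to [L + M] and [L - M], whose sum and difference are [2 L] and [2 M], is
    the reverse inequality. *)
Lemma dualnorm2_parallelogram L M : dual L -> dual M ->
  dualnorm2 (L + M) + dualnorm2 (L - M) = 2 * (dualnorm2 L + dualnorm2 M).
Proof.
move=> dL dM; have dLM := dualD dL dM.
have dLM' : dual (L - M) by rewrite -scaleN1r; apply: dualD dL (dualZ _ dM).
apply/eqP; rewrite eq_le dualnorm2_semiparallelogram//=.
have := dualnorm2_semiparallelogram dLM dLM'.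
have -> : L + M + (L - M) = (2%:R : C) *: L.
  by rewrite addrACA subrr addr0 scaler_nat mulr2n.
have -> : L + M - (L - M) = (2%:R : C) *: M.
  by rewrite opprB [L + M]addrC addrACA subrr addr0 scaler_nat mulr2n.
rewrite !dualnorm2Z//.
have -> : cabs (2%:R : C) ^+ 2 = 4.
  have -> : (2%:R : C) = ((2%:R)%:C)%C by rewrite rmorph_nat.
  by rewrite cabsR ger0_norm//; ring.
lra.
Qed.

Lemma dual_prehilbert : prehilbert dual dualnorm2.
Proof.
split; [exact: dualD|exact: dualZ|exact: dualnorm2_ge0|exact: dualnorm2Z|].
exact: dualnorm2_parallelogram.
Qed.

End DualNorm.

(** * Derivatives of the inner product along curves *)

Section QuadraticDerivative.
Variable R : realType.
Local Notation C := (R[i]).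

Lemma quad_is_derive (f : R -> R) (d del K : R) : 0 < del ->
  (forall t : R, `|t| < del -> `|f t - f 0 - d * t| <= K * t ^+ 2) -> is_derive (0 : R) (1 : R) f d.
Proof.
move=> del0 H; apply: epsdelta_is_derive => e e0.
pose K' := `|K| + 1; have K0 : 0 < K' by rewrite ltr_wpDl.
exists (Num.min del (e / K')); first by rewrite lt_min del0 divr_gt0.
move=> h; rewrite lt_min => /andP[h1 h2]; rewrite add0r (le_trans (H _ h1))//.
rewrite -[h ^+ 2]real_normK ?num_real// expr2 mulrA ler_wpM2r//.
rewrite (@le_trans _ _ (K' * `|h|))//.
  by rewrite ler_wpM2r// (le_trans (ler_norm K))// lerDl.
by rewrite mulrC -ler_pdivlMr// ltW.
Qed.

Variables (E : lmodType C) (W : E -> Prop) (q : E -> R).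
Hypothesis Hq : prehilbert W q.
Let WD := prehilbertD Hq.
Let WZ := prehilbertZ Hq.
Let qZ := prehilbert_scale Hq.
Local Notation polar := (polar q).

(** Rescaling [r] by [t ^- 2] before applying [polar_bound] yields the order [t ^+ 2] and takes the
    place of the Cauchy-Schwarz inequality. *)
Lemma polar_remainder (r y : E) (t K : R) : W r -> W y -> q r <= K * t ^+ 4 -> t != 0 ->
  `|polar r y| <= (K + q y) / 2 * t ^+ 2.
Proof.
move=> Wr Wy qr t0.
have t2 : 0 < t ^+ 2 by rewrite exprn_even_gt0.
have -> : r = ((t ^+ 2)%:C)%C *: (((t ^- 2)%:C)%C *: r).
  by rewrite scalerA -rmorphM /= divff ?scale1r// gt_eqF.
rewrite (polarZl Hq _ (WZ _ Wr) Wy) normrM gtr0_norm// mulrC ler_pM2r//.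
rewrite (le_trans (polar_bound Hq (WZ _ Wr) Wy))// ler_pM2r// lerD2r qZ//.
rewrite cabsR ger0_norm ?invr_ge0 ?(ltW t2)// exprVn mulrC ler_pdivrMr ?(exprn_gt0 2 t2)//.
by rewrite -exprM.
Qed.

(** As [q] is a squared norm, the hypotheses say that both curves have remainders of norm of order
    [t ^+ 2]; bilinear expansion then leaves the product rule up to terms of that order. *)
Lemma polar_is_derive (x y : R -> E) (x' y' : E) (del K : R) : 0 < del ->
  (forall t : R, `|t| < del -> W (x t)) -> (forall t : R, `|t| < del -> W (y t)) -> W x' -> W y' ->
  (forall t : R, `|t| < del -> q (x t - x 0 - ((t%:C)%C *: x')) <= K * t ^+ 4) ->
  (forall t : R, `|t| < del -> q (y t - y 0 - ((t%:C)%C *: y')) <= K * t ^+ 4) ->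
  is_derive (0 : R) (1 : R) (fun t => polar (x t) (y t)) (polar x' (y 0) + polar (x 0) y').
Proof.
move=> del0 Wx Wy Wx' Wy' Hx Hy.
have Wx0 : W (x 0) by apply: Wx; rewrite normr0.
have Wy0 : W (y 0) by apply: Wy; rewrite normr0.
(* One summand for each of the six terms of order at least two in the expansion below. *)
pose K1 : R := `|polar x' y'| + (K + q (y 0)) / 2 + (K + q y') / 2 + (K + q (x 0)) / 2 + (K + q x') / 2 + `|K|.
apply: (@quad_is_derive _ _ (Num.min del 1) K1); first by rewrite lt_min del0 ltr01.
move=> t; rewrite lt_min => /andP[td t1].
have [->|t0] := eqVneq t 0; first by rewrite subrr mulr0 subr0 normr0 expr0n mulr0.
set r := x t - x 0 - ((t%:C)%C *: x'); set s := y t - y 0 - ((t%:C)%C *: y').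
have Wtx' := WZ (t%:C)%C Wx'; have Wty' := WZ (t%:C)%C Wy'.
have WB a b : W a -> W b -> W (a - b) := memWB Hq (x := a) (y := b).
have Wr : W r := WB _ _ (WB _ _ (Wx _ td) Wx0) Wtx'.
have Ws : W s := WB _ _ (WB _ _ (Wy _ td) Wy0) Wty'.
have xE : x t = x 0 + (t%:C)%C *: x' + r by rewrite /r -[x t - x 0 - _]addrA -opprD [RHS]addrC subrK.
have yE : y t = y 0 + (t%:C)%C *: y' + s by rewrite /s -[y t - y 0 - _]addrA -opprD [RHS]addrC subrK.
have qr := Hx t td; have qs := Hy t td; rewrite -/r -/s in qr qs.
have DL := polarDl Hq; have DR := polarDr Hq.
have ZL := polarZl Hq; have ZR := polarZr Hq.
have W1 := WD Wx0 Wtx'; have W2 := WD Wy0 Wty'.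
have -> : polar (x t) (y t) - polar (x 0) (y 0) - (polar x' (y 0) + polar (x 0) y') * t =
  t ^+ 2 * polar x' y' + polar r (y 0) + t * polar r y' + polar s (x 0) + t * polar s x' + polar r s.
  rewrite xE yE (DL _ _ _ W1 Wr (WD W2 Ws)) (DR _ _ _ W1 W2 Ws) (DR _ _ _ Wr W2 Ws).
  rewrite (DL _ _ _ Wx0 Wtx' W2) (DL _ _ _ Wx0 Wtx' Ws) (DR _ _ _ Wx0 Wy0 Wty').
  rewrite (DR _ _ _ Wtx' Wy0 Wty') (DR _ _ _ Wr Wy0 Wty').
  rewrite !(ZR _ _ _ _ Wy') ?(ZL _ _ _ Wx')//.
  rewrite (polarC Hq Wx0 Ws) (polarC Hq Wx' Ws); ring.
have b1 := polar_remainder Wr Wy0 qr t0; have b2 := polar_remainder Wr Wy' qr t0.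
have b3 := polar_remainder Ws Wx0 qs t0; have b4 := polar_remainder Ws Wx' qs t0.
have b5 : `|polar r s| <= `|K| * t ^+ 2.
  rewrite (le_trans (polar_bound Hq Wr Ws))//.
  have t42 : K * t ^+ 4 <= `|K| * t ^+ 2.
    rewrite (@le_trans _ _ (`|K| * t ^+ 4))//.
      by rewrite ler_wpM2r ?exprn_even_ge0// ler_norm.
    rewrite ler_wpM2l//; have -> : t ^+ 4 = t ^+ 2 * t ^+ 2 by rewrite -exprD.
    rewrite ler_piMr ?exprn_even_ge0//.
    by rewrite -real_normK ?num_real// expr_le1// ltW.
  lra.
have tl (a : R) : `|t * a| <= `|a| by rewrite normrM ler_piMl// ltW.
have -> : K1 * t ^+ 2 = `|polar x' y'| * t ^+ 2 + (K + q (y 0)) / 2 * t ^+ 2 +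
  (K + q y') / 2 * t ^+ 2 + (K + q (x 0)) / 2 * t ^+ 2 + (K + q x') / 2 * t ^+ 2 + `|K| * t ^+ 2.
  by rewrite /K1; ring.
apply: le_trans (ler_normD _ _) _; apply: lerD; last exact: b5.
apply: le_trans (ler_normD _ _) _; apply: lerD; last exact: le_trans (tl _) b4.
apply: le_trans (ler_normD _ _) _; apply: lerD; last exact: b3.
apply: le_trans (ler_normD _ _) _; apply: lerD; last exact: le_trans (tl _) b2.
apply: le_trans (ler_normD _ _) _; apply: lerD; last exact: b1.
by rewrite normrM ger0_norm ?exprn_even_ge0// mulrC.
Qed.

End QuadraticDerivative.

(** * The Bergman space and its dual *)

Section BergmanSpace.
Variable R : realType.
Local Notation C := (R[i]).
Variable n : nat.
Local Notation Cn := ('rV[C^o]_n).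
Local Notation F := (Cn -> C^o).
Variable D : set Cn.
Hypotheses (n_gt0 : (0 < n)%N) (oD : open D).
Implicit Types (f g : F) (z p : Cn).

Definition bergman_space (f : F) : Prop := holo D f /\ (L2sq D f < +oo)%E.
Definition bergman_norm2 (f : F) : R := fine (L2sq D f).
Local Notation V := bergman_space.
Local Notation N := bergman_norm2.

Lemma bergman_normE f : V f -> L2sq D f = (N f)%:E.
Proof. by move=> [_ Vf]; rewrite /N fineK// ge0_fin_numE// L2sq_ge0. Qed.

Lemma bergman_norm2_ge0 f : V f -> 0 <= N f.
Proof. by move=> _; rewrite fine_ge0// L2sq_ge0. Qed.

Lemma bergmanZ (c : C) f : V f -> V (c *: f).
Proof.
move=> Vf; have [hf _] := Vf; split; first exact: (holoZ c hf).
by rewrite (L2sqZ c oD hf) bergman_normE// -EFinM ltry.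
Qed.

Lemma bergman_norm2Z (c : C) f : V f -> N (c *: f) = cabs c ^+ 2 * N f.
Proof.
move=> Vf; have [hf _] := Vf; apply: EFin_inj.
by rewrite -(bergman_normE (bergmanZ c Vf)) (L2sqZ c oD hf) bergman_normE// EFinM.
Qed.

Lemma bergmanD f g : V f -> V g -> V (f + g).
Proof.
move=> Vf Vg; have [hf _] := Vf; have [hg _] := Vg; split; first exact: holoD.
have := L2sq_parallelogram oD hf hg.
rewrite (bergman_normE Vf) (bergman_normE Vg) -EFinD -EFinM => H.
by apply: le_lt_trans (ltry (2 * (N f + N g))); rewrite -H leeDl// L2sq_ge0.
Qed.

Lemma bergman_norm2P f g : V f -> V g -> N (f + g) + N (f - g) = 2 * (N f + N g).
Proof.
move=> Vf Vg; have [hf _] := Vf; have [hg _] := Vg.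
have Vg' : V (- g) by rewrite -scaleN1r; exact: bergmanZ.
apply: EFin_inj; rewrite EFinD -(bergman_normE (bergmanD Vf Vg)) -(bergman_normE (bergmanD Vf Vg')).
by rewrite (L2sq_parallelogram oD hf hg) (bergman_normE Vf) (bergman_normE Vg).
Qed.

Lemma holo_cst (c : C) : holo D (fun=> c).
Proof. by move=> z _; exact: differentiable_cst. Qed.

Lemma bergman0 : V 0.
Proof.
split; first exact: holo_cst.
have := L2sqZ 0 oD (holo_cst 0); rewrite cabs0 expr0n mul0e => H.
have -> : (0 : F) = (fun z => 0 * 0 : C) by apply/funext => z; rewrite mul0r.
by rewrite H.
Qed.

Local Notation E := (F -> C^o).
Local Notation W := (dual V N).
Local Notation q := (dualnorm2 V N).
Implicit Types L M : E.

Lemma bergman_dual_prehilbert : prehilbert W q.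
Proof.
exact: (dual_prehilbert bergman0 bergmanD bergmanZ bergman_norm2_ge0 bergman_norm2Z bergman_norm2P).
Qed.

Let Hq := bergman_dual_prehilbert.
Let WZ := prehilbertZ Hq.
Let q_le := dualnorm2_le bergman0 bergman_norm2Z.

Definition ev z : E := fun f => f z.
Definition evd k z : E := fun f => pderiv f k z.

Lemma bergman_eval_bound p : D p -> exists r S : R, [/\ 0 < r, 0 < S, inball p r `<=` D &
  forall f, V f -> forall z, inball p r z -> cabs (f z) <= S * Num.sqrt (N f)].
Proof.
move=> Dp; have [r [K [r0 K0 rD H]]] := evaluation_bound n_gt0 oD Dp.
exists r, (Num.sqrt K); split=> //; first by rewrite sqrtr_gt0.
move=> f Vf z zr; have [hf _] := Vf.
have := H f hf z zr; rewrite (bergman_normE Vf) -EFinM lee_fin => h.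
by rewrite -sqrtrM ?(ltW K0)// -[leLHS]ger0_norm ?cabs_ge0// -sqrtr_sqr ler_wsqrtr.
Qed.

Lemma le0_of_small (x c : R) : 0 <= c -> (forall e, 0 < e -> x <= e * c) -> x <= 0.
Proof.
move=> c0 H; apply/ler_addgt0Pl => e e0; rewrite addr0.
have c1 : 0 < c + 1 by rewrite ltr_wpDl.
apply: le_trans (H (e / (c + 1)) (divr_gt0 e0 c1)) _.
by rewrite mulrAC ler_pdivrMr// ler_pM2l// lerDl.
Qed.

(** The dual is closed under uniform limits on balls of the Bergman space, so limits of difference
    quotients of evaluations belong to it. *)
Lemma dual_approx L : (forall e : R, 0 < e -> exists2 M, W M &
  forall f, V f -> cabs (L f - M f) <= e * Num.sqrt (N f)) -> W L.
Proof.
move=> H; split.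
- move=> f g Vf Vg; apply/eqP; rewrite -subr_eq0 -cabs_eq0 eq_le cabs_ge0 andbT.
  apply: (@le0_of_small _ (Num.sqrt (N (f + g)) + Num.sqrt (N f) + Num.sqrt (N g))).
    by rewrite !addr_ge0 ?sqrtr_ge0.
  move=> e /H[M [M1 _ _] HM]; have h1 := HM _ (bergmanD Vf Vg).
  have h2 := HM _ Vf; have h3 := HM _ Vg.
  have -> : L (f + g) - (L f + L g) = (L (f + g) - M (f + g)) - (L f - M f) - (L g - M g).
    by rewrite M1//; ring.
  rewrite (le_trans (cabsB _ _))// !mulrDr lerD//.
  by rewrite (le_trans (cabsB _ _))// lerD.
- move=> c f Vf; apply/eqP; rewrite -subr_eq0 -cabs_eq0 eq_le cabs_ge0 andbT.
  apply: (@le0_of_small _ (Num.sqrt (N (c *: f)) + cabs c * Num.sqrt (N f))).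
    by rewrite addr_ge0 ?sqrtr_ge0// mulr_ge0 ?sqrtr_ge0 ?cabs_ge0.
  move=> e /H[M [_ M2 _] HM]; have h1 := HM _ (bergmanZ c Vf); have h2 := HM _ Vf.
  have -> : L (c *: f) - c * L f = (L (c *: f) - M (c *: f)) - c * (L f - M f).
    by rewrite M2//; ring.
  rewrite (le_trans (cabsB _ _))// [e * (_ + _)]mulrDr lerD// cabsM mulrCA.
  by rewrite ler_wpM2l// cabs_ge0.
- have [M [_ _ [K HK]] HM] := H 1 ltr01; exists (2 * (1 + K)) => f Vf.
  have h1 := HM _ Vf; rewrite mul1r in h1; have h2 := HK _ Vf.
  have h3 : cabs (L f - M f) ^+ 2 <= N f.
    by rewrite -[leRHS]sqr_sqrtr ?bergman_norm2_ge0// ler_pXn2r ?nnegrE ?cabs_ge0 ?sqrtr_ge0.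
  have := cabs_parallelogram (L f - M f) (M f); rewrite subrK.
  have := exprn_ge0 2 (cabs_ge0 (L f - M f - M f)).
  have -> : 2 * (1 + K) * N f = 2 * (N f + K * N f) by ring.
  move: h2 h3; lra.
Qed.

(** A Taylor remainder whose constant depends on [f] only through its norm is a remainder in the
    dual norm, and difference quotients converge to [L] uniformly on the unit ball. *)
Lemma quad_curve (x : R -> E) L (del K : R) : 0 < del -> 0 <= K ->
  (forall t : R, `|t| < del -> W (x t)) ->
  (forall f (t : R), V f -> `|t| < del ->
     cabs (x t f - x 0 f - (t%:C)%C * L f) <= K * t ^+ 2 * Num.sqrt (N f)) ->
  W L /\ forall t : R, `|t| < del -> q (x t - x 0 - ((t%:C)%C *: L)) <= K ^+ 2 * t ^+ 4.
Proof.
move=> del0 K0 Wx H; have Wx0 : W (x 0) by apply: Wx; rewrite normr0.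
split.
  apply: dual_approx => e e0.
  have K1 : 0 < K + 1 by rewrite ltr_wpDl.
  (* On the unit ball the difference quotient at [t] errs by at most [K * t], which is below [e]. *)
  pose t := Num.min (del / 2) (e / (K + 1)).
  have t0 : 0 < t by rewrite lt_min !divr_gt0.
  have td : `|t| < del.
    rewrite gtr0_norm// gt_min; apply/orP; left.
    by rewrite ltr_pdivrMr// ltr_pMr// ltr1n.
  exists (((t^-1)%:C)%C *: (x t - x 0)).
    by apply: WZ; exact: (memWB Hq (Wx _ td) Wx0).
  move=> f Vf; have := H f t Vf td.
  rewrite -[(_ *: (x t - x 0)) f]/(((t^-1)%:C)%C * (x t f - x 0 f)) => h.
  have -> : L f - ((t^-1)%:C)%C * (x t f - x 0 f) = - (((t^-1)%:C)%C * (x t f - x 0 f - (t%:C)%C * L f)).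
    have tt : ((t^-1)%:C)%C * ((t%:C)%C) = 1 :> C by rewrite -rmorphM /= mulVf ?gt_eqF.
    by rewrite [X in _ = - X]mulrBr mulrA tt mul1r opprB.
  rewrite cabsN cabsM cabsR ger0_norm ?invr_ge0 ?(ltW t0)// mulrC ler_pdivrMr//.
  rewrite (le_trans h)// [e * _ * t]mulrAC ler_wpM2r ?sqrtr_ge0// expr2 mulrA ler_pM2r//.
  have : t <= e / (K + 1) by rewrite /t ge_min lexx orbT.
  rewrite ler_pdivlMr// => h2; apply: le_trans h2.
  by rewrite mulrC ler_pM2l// lerDl.
move=> t td; apply: q_le => f Vf Nf.
have := H f t Vf td; rewrite -[(x t - x 0 - _) f]/(x t f - x 0 f - (t%:C)%C * L f) => h.
have kt0 : 0 <= K * t ^+ 2 := mulr_ge0 K0 (sqr_ge0 t).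
have h2 : cabs (x t f - x 0 f - (t%:C)%C * L f) <= K * t ^+ 2.
  rewrite (le_trans h)// ler_piMr//.
  by rewrite -[leRHS]sqrtr1 ler_wsqrtr.
have -> : K ^+ 2 * t ^+ 4 = (K * t ^+ 2) ^+ 2 by rewrite exprMn -exprM.
by rewrite ler_pXn2r ?nnegrE ?cabs_ge0 ?kt0.
Qed.

Lemma ev_dual z : D z -> W (ev z).
Proof.
move=> Dz; have [r [S [r0 S0 _ H]]] := bergman_eval_bound Dz; split=> //.
exists (S ^+ 2) => f Vf; have := H f Vf z (inball_center _ r0).
move=> h; rewrite -[N f]sqr_sqrtr ?bergman_norm2_ge0// -exprMn.
by rewrite ler_pXn2r ?nnegrE ?cabs_ge0 ?(mulr_ge0 (ltW S0) (sqrtr_ge0 _)).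
Qed.

(** With [c = 1] this is the line along which [dx k] differentiates, with [c = 'i] the one for
    [dy k]. *)
Definition curve p k (c : C) (t : R) : Cn := p + ((t%:C)%C * c) *: ebasis R k.

Lemma curve0 p k c : curve p k c 0 = p.
Proof. by rewrite /curve mul0r scale0r addr0. Qed.

Lemma cabs_tc (c : C) (t : R) : cabs c = 1 -> cabs ((t%:C)%C * c) = `|t|.
Proof. by move=> c1; rewrite cabsM c1 mulr1 cabsR. Qed.

Lemma curve_inball p k (c : C) (t r : R) : 0 < r -> cabs c = 1 -> `|t| < r ->
  inball p r (curve p k c t).
Proof.
move=> r0 c1 tr j; rewrite !mxE eqxx /=.
have -> : p 0 j + (t%:C)%C * c * (j == k)%:R - p 0 j = (t%:C)%C * c * (j == k)%:R by ring.
by rewrite cabsM cabs_tc//; case: (j == k); rewrite ?cabs1 ?cabs0 ?mulr1 ?mulr0.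
Qed.

Lemma ev_curve p k (c : C) : D p -> cabs c = 1 -> exists del K : R, [/\ 0 < del,
  forall t : R, `|t| < del -> D (curve p k c t), W (c *: evd k p) &
  forall t : R, `|t| < del ->
    q (ev (curve p k c t) - ev (curve p k c 0) - ((t%:C)%C *: (c *: evd k p))) <= K * t ^+ 4].
Proof.
move=> Dp c1; have [r [S [r0 S0 rD H]]] := bergman_eval_bound Dp.
have r8 : 0 < r / 8 by rewrite divr_gt0.
have r2 : 0 < r / 2 by rewrite divr_gt0.
have r8r : r / 8 <= r by rewrite ler_pdivrMr// ler_peMr ?(ltW r0)// ler1n.
have Dc t : `|t| < r / 8 -> D (curve p k c t).
  by move=> tr; apply: rD; apply: curve_inball => //; exact: lt_le_trans r8r.
have K0 : 0 <= 2048 * S / r ^+ 2.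
  by apply: divr_ge0; [exact: mulr_ge0 (ler0n _ _) (ltW S0)|exact: exprn_ge0 (ltW r0)].
have [] := @quad_curve (fun t => ev (curve p k c t)) (c *: evd k p) _ _ r8 K0.
- by move=> t /Dc; exact: ev_dual.
- move=> f t Vf tr; have [hf _] := Vf.
  have tc : cabs ((t%:C)%C * c) < r / 8 by rewrite cabs_tc.
  have := taylor2_coord r0 (fun z zr => hf z (rD z zr)) (H f Vf) k (inball_center p r2) tc.
  rewrite cabs_tc// real_normK ?num_real// /ev curve0.
  rewrite -[(c *: evd k p) f]/(c * pderiv f k p).
  have -> : pderiv f k p * ((t%:C)%C * c) = (t%:C)%C * (c * pderiv f k p) by ring.
  move=> h; apply: le_trans h _.
  by rewrite [leLHS](_ : _ = 2048 * S / r ^+ 2 * t ^+ 2 * Num.sqrt (N f))//; ring.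
- move=> WL Hquad; exists (r / 8), ((2048 * S / r ^+ 2) ^+ 2); split=> //.
Qed.

Lemma evd_dual p k : D p -> W (evd k p).
Proof.
move=> Dp; have [//|del [K [_ _ h _]]] := @ev_curve p k 1 Dp; first exact: cabs1.
by move: h; rewrite scale1r.
Qed.

(** By holomorphy one second-derivative functional [b] serves all directions [c], the derivative
    being [c *: b]; the cancellation in [polar_wirtinger] depends on this. *)
Lemma evd_curve p j k : D p -> exists2 b : E, W b & forall c : C, cabs c = 1 ->
  exists del K : R, [/\ 0 < del, forall t : R, `|t| < del -> D (curve p j c t) &
  forall t : R, `|t| < del ->
    q (evd k (curve p j c t) - evd k (curve p j c 0) - ((t%:C)%C *: (c *: b))) <= K * t ^+ 4].
Proof.
move=> Dp; have [r [S [r0 S0 rD H]]] := bergman_eval_bound Dp.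
have r8 : 0 < r / 8 by rewrite divr_gt0.
have r8r : r / 8 <= r by rewrite ler_pdivrMr// ler_peMr ?(ltW r0)// ler1n.
have Dc c t : cabs c = 1 -> `|t| < r / 8 -> D (curve p j c t).
  by move=> c1 tr; apply: rD; apply: curve_inball => //; exact: lt_le_trans r8r.
pose K := 16 * (2048 * S / r ^+ 3).
have K0 : 0 <= K.
  rewrite /K; apply: mulr_ge0 (ler0n _ _) _; apply: divr_ge0; [exact: mulr_ge0 (ler0n _ _) (ltW S0)|exact: exprn_ge0 (ltW r0)].
(* The value of [b] is chosen separately for each [f]; that it is linear follows afterwards from
   [quad_curve]. *)
have /choice[b Hb] : forall f, exists b : C, V f -> forall x : C, cabs x < r / 8 ->
    cabs (pderiv f k (p + x *: ebasis R j) - pderiv f k p - b * x) <= K * cabs x ^+ 2 * Num.sqrt (N f).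
  move=> f; case: (pselect (V f)) => [Vf|nV]; last by exists 0.
  have [hf _] := Vf.
  have [b Hb] := pderiv_taylor2 r0 (fun z zr => hf z (rD z zr)) (H f Vf) j k (inball_center p r8).
  exists b => _ x xr; apply: le_trans (Hb x xr) _.
  by rewrite [leLHS](_ : _ = K * cabs x ^+ 2 * Num.sqrt (N f))// /K; ring.
have quad c : cabs c = 1 -> forall f t, V f -> `|t| < r / 8 ->
    cabs (evd k (curve p j c t) f - evd k (curve p j c 0) f - (t%:C)%C * (c *: (b : E)) f)
      <= K * t ^+ 2 * Num.sqrt (N f).
  move=> c1 f t Vf tr; have tc : cabs ((t%:C)%C * c) < r / 8 by rewrite cabs_tc.
  have := Hb f Vf _ tc; rewrite cabs_tc// real_normK ?num_real// /evd curve0.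
  rewrite -[(c *: (b : E)) f]/(c * b f).
  by have -> : b f * ((t%:C)%C * c) = (t%:C)%C * (c * b f) by ring.
have Wc c : cabs c = 1 -> forall t, `|t| < r / 8 -> W (evd k (curve p j c t)).
  by move=> c1 t tr; apply: evd_dual; exact: Dc.
exists b.
  have [h _] := quad_curve r8 K0 (Wc _ (cabs1 _)) (quad _ (cabs1 _)).
  by move: h; rewrite scale1r.
move=> c c1; have [_ h] := quad_curve r8 K0 (Wc _ c1) (quad _ c1).
exists (r / 8), (K ^+ 2); split=> // t tr; exact: Dc.
Qed.

End BergmanSpace.

(** * The Bergman metric *)

Section DerivativeAtZero.
Variable R : realType.

Lemma is_derive_near0 (f g : R -> R) (d del : R) : 0 < del ->
  (forall t, `|t| < del -> f t = g t) ->
  is_derive (0 : R) (1 : R) g d -> is_derive (0 : R) (1 : R) f d.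
Proof.
move=> del0 fg dg; have h := is_derive_epsdelta dg.
apply: epsdelta_is_derive => e /h[r r0 Hr]; exists (Num.min r del); first by rewrite lt_min r0.
move=> x; rewrite lt_min => /andP[xr xd]; rewrite !fg ?add0r ?normr0//.
by have := Hr x xr; rewrite add0r.
Qed.

Lemma derive1_near0 (f g : R -> R) (d del : R) : 0 < del ->
  (forall t, `|t| < del -> f t = g t) -> is_derive (0 : R) (1 : R) g d -> derive1 f 0 = d.
Proof.
move=> del0 fg dg; have df := is_derive_near0 del0 fg dg.
by rewrite derive1E; exact: derive_val.
Qed.

Lemma is_derive_ln_comp (f : R -> R) (d : R) : 0 < f 0 -> is_derive (0 : R) (1 : R) f d ->
  is_derive (0 : R) (1 : R) (fun t => ln (f t)) (d / f 0).
Proof.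
move=> f0 df; have := @is_derive1_comp _ (@ln R) f 0 _ _ (is_derive1_ln f0) df.
by rewrite mulrC.
Qed.

Lemma is_derive_quot (f g : R -> R) (df dg : R) : g 0 != 0 ->
  is_derive (0 : R) (1 : R) f df -> is_derive (0 : R) (1 : R) g (2 * dg) ->
  is_derive (0 : R) (1 : R) (fun t => 2 * f t / g t) (2 * df / g 0 - 4 * f 0 * dg / g 0 ^+ 2).
Proof.
move=> g0 Hf Hg; have Hv := is_deriveV g0 Hg.
have := is_deriveZ 2 (is_deriveM Hf Hv) => H.
have -> : (fun t => 2 * f t / g t) = 2 \*: (f * (fun t => (g t)^-1)).
  by apply/funext => t; rewrite -mulrA.
apply: is_derive_eq H _; rewrite /GRing.scale /=; field; exact: g0.
Qed.

End DerivativeAtZero.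

Section WirtingerCurves.
Variable R : realType.
Local Notation C := (R[i]).
Variable n : nat.
Local Notation Cn := ('rV[C^o]_n).

Lemma real_mul_i (t : R) : Complex 0 t = (t%:C)%C * 'i%C :> C.
Proof. by apply: complex_ext; rewrite ?cReM ?cImM /=; ring. Qed.

Lemma dx_curve (h : Cn -> R) j p : dx j h p = derive1 (fun t : R => h (curve p j 1 t)) 0.
Proof.
have H (t : R) : h (p + (t%:C)%C *: ebasis R j) = h (curve p j 1 t) by rewrite /curve mulr1.
exact: (congr1 (fun G : R -> R => derive1 G 0) (funext H)).
Qed.

Lemma dy_curve (h : Cn -> R) j p : dy j h p = derive1 (fun t : R => h (curve p j 'i%C t)) 0.
Proof.
have H (t : R) : h (p + Complex 0 t *: ebasis R j) = h (curve p j 'i%C t).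
  by rewrite /curve real_mul_i.
exact: (congr1 (fun G : R -> R => derive1 G 0) (funext H)).
Qed.

Lemma wirt2_eq (h : Cn -> R) j k p (a b c d : R) : dx j (dx k h) p = a -> dy j (dy k h) p = b ->
  dx j (dy k h) p = c -> dy j (dx k h) p = d ->
  wirt2 h j k p = ((a + b) +i* (c - d))%C / 4%:R.
Proof. by move=> <- <- <- <-. Qed.

End WirtingerCurves.

Section PolarWirtinger.
Variables (R : realType) (E : lmodType R[i]) (W : E -> Prop) (q : E -> R).
Local Notation C := (R[i]).
Hypothesis Hq : prehilbert W q.
Local Notation polar := (polar q).
Local Notation herm := (herm q).

(** [P c' c] has the shape of a second real derivative of [log Q] in directions [c'] and [c]. The
    second-derivative functional [b] drops out of the combination because [1 + 'i ^+ 2 = 0] and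
    [1 * 'i = 'i * 1]; only products of first derivatives remain. *)
Lemma polar_wirtinger (a a' e b : E) (Q : R) : W a -> W a' -> W e -> W b -> Q != 0 ->
  let P (c' c : C) := 2 * (polar ((c * c') *: b) e + polar (c *: a') (c' *: a)) / Q
    - 4 * polar (c *: a') e * polar (c' *: a) e / Q ^+ 2 in
  ((P 1 1 + P 'i%C 'i%C) +i* (P 1 'i%C - P 'i%C 1))%C / 4%:R =
  herm a a' / (Q%:C)%C - herm a e * Num.conj (herm a' e) / ((Q%:C)%C ^+ 2).
Proof.
move=> Wj Wk We Wb Q0 P; have WZ := prehilbertZ Hq; rewrite /P.
rewrite mulr1 mul1r (mulr1 'i%C) -expr2 sqr_i scaleN1r !scale1r.
have Wie := WZ 'i%C _ We; have Wia := WZ 'i%C _ Wj; have Wia' := WZ 'i%C _ Wk.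
rewrite (polarNl Hq Wb We) (polarii Hq Wk Wj).
have s1 : polar a' a = polar a a' := polarC Hq Wk Wj.
have s2 : polar ('i%C *: a') a = polar a ('i%C *: a') := polarC Hq Wia' Wj.
have s3 : polar a' ('i%C *: a) = - polar a ('i%C *: a').
  by rewrite (polarir Hq Wk Wj) s2.
have s4 : polar a ('i%C *: e) = - polar ('i%C *: a) e := polarir Hq Wj We.
have s5 : polar a' ('i%C *: e) = - polar ('i%C *: a') e := polarir Hq Wk We.
rewrite s1 s2 s3 /herm s4 s5.
have -> : (4%:R : C) = ((4%:R)%:C)%C by rewrite rmorph_nat.
rewrite -!fmorphV -rmorphXn /= -fmorphV /=.
apply: complex_ext; rewrite ?cReB ?cImB ?cReM ?cImM /=; field; exact: Q0.
Qed.

End PolarWirtinger.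

(** * The Bergman metric as a squared distance in the dual *)

Section BergmanMetric.
Variable R : realType.
Local Notation C := (R[i]).
Variable n : nat.
Local Notation Cn := ('rV[C^o]_n).
Local Notation F := (Cn -> C^o).
Variable D : set Cn.
Variable B : R.
Hypotheses (n_gt0 : (0 < n)%N) (oD : open D) (B_ge0 : 0 <= B)
  (DB : forall z, D z -> forall j, cabs (z 0 j) <= B).
Implicit Types (f g : F) (z p u : Cn).

Local Notation V := (bergman_space D).
Local Notation N := (bergman_norm2 D).
Local Notation E := (F -> C^o).
Local Notation W := (dual V N).
Local Notation q := (dualnorm2 V N).
Local Notation polar := (polar q).
Local Notation herm := (herm q).

Let V0 := bergman0 oD.
Let VZ := @bergmanZ _ _ _ oD.
Let N0 := @bergman_norm2_ge0 R n D.
Let NZ := @bergman_norm2Z _ _ _ oD.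
Let Hq := bergman_dual_prehilbert oD.
Let WZ := prehilbertZ Hq.
Let q_ge0 := prehilbert_ge0 Hq.
Let qZ := prehilbert_scale Hq.
Let q_ub := dualnorm2_ub V0 VZ N0 NZ.

Definition kernel_diag z : R := q (ev z).
Local Notation Q := kernel_diag.

Lemma bergman_diagE z : D z -> bergman_diag D z = (Q z)%:E.
Proof.
move=> Dz; have Wz := ev_dual n_gt0 oD Dz.
have [ne ub] := dual_has_sup V0 N0 NZ Wz.
rewrite /kernel_diag /dualnorm2 -ereal_sup_EFin//; congr ereal_sup.
apply/seteqP; split=> [_ [f [hf Lf] <-]|_ [_ [f [[hf Lf] Nf] <-] <-]].
  have Vf : V f by split=> //; apply: le_lt_trans Lf _; exact: ltry.
  exists (cabs (f z) ^+ 2) => //; exists f => //; split=> //.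
  by rewrite -lee_fin -bergman_normE.
exists f => //; split=> //; rewrite bergman_normE//; split=> //.
Qed.

Lemma bergman_bounded f (M : R) : holo D f -> (forall z, D z -> cabs (f z) <= M) -> V f.
Proof. by move=> hf fM; split=> //; exact: (L2sq_bounded_lty B_ge0 DB fM). Qed.

(** The evaluation is tested on the constant 1, which is square integrable because [D] is bounded.
    The bound is uniform in [z], as the upper bound for the metric requires. *)
Lemma kernel_diag_ge z : D z -> 1 <= Q z * N (fun=> 1).
Proof.
move=> Dz; have V1 : V (fun=> 1).
  by apply: (@bergman_bounded _ 1); [exact: holo_cst|move=> w _; rewrite cabs1].
have := q_ub (ev_dual n_gt0 oD Dz) V1.
by rewrite -[ev z (fun=> 1)]/(1 : C) cabs1 expr1n.
Qed.

Lemma kernel_diag_gt0 z : D z -> 0 < Q z.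
Proof.
move=> Dz; have h := kernel_diag_ge Dz; have q0 := q_ge0 (ev_dual n_gt0 oD Dz).
rewrite lt_neqAle q0 andbT eq_sym; apply: contraTneq h => ->.
by rewrite mul0r ler10.
Qed.

Lemma polar_evv z : D z -> polar (ev z) (ev z) = Q z.
Proof. by move=> Dz; exact: (polarxx Hq (ev_dual n_gt0 oD Dz)). Qed.

(** The real derivative of [logK] in direction [c *: ebasis k], as [logK_derive] shows for |c| =
    1. *)
Definition dlogK k (c : C) p : R := 2 * polar (c *: evd k p) (ev p) / Q p.

Lemma kernel_curve_derive p k (c : C) : D p -> cabs c = 1 ->
  exists2 del : R, 0 < del & (forall t : R, `|t| < del -> D (curve p k c t)) /\
    is_derive (0 : R) (1 : R) (fun t : R => polar (ev (curve p k c t)) (ev (curve p k c t)))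
      (2 * polar (c *: evd k p) (ev p)).
Proof.
move=> Dp c1; have [del [K [del0 Dc We He]]] := ev_curve n_gt0 oD k Dp c1.
exists del => //; split=> //.
have We0 := ev_dual n_gt0 oD Dp.
have Wc t : `|t| < del -> W (ev (curve p k c t)) by move=> /Dc; exact: (ev_dual n_gt0 oD).
have := polar_is_derive Hq del0 Wc Wc We We He He.
rewrite curve0 [polar (ev p) _](polarC Hq)//.
by rewrite mulr2n mulrDl mul1r.
Qed.

Lemma logK_derive p k (c : C) : D p -> cabs c = 1 ->
  derive1 (fun t => logK D (curve p k c t)) 0 = dlogK k c p.
Proof.
move=> Dp c1; have [del del0 [Dc dP]] := kernel_curve_derive k Dp c1.
have Pp : 0 < polar (ev (curve p k c 0)) (ev (curve p k c 0)).
  by rewrite curve0 polar_evv//; exact: kernel_diag_gt0.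
have := is_derive_ln_comp Pp dP.
rewrite curve0 polar_evv// => h.
apply: (derive1_near0 del0 _ h) => t td.
by rewrite /logK bergman_diagE ?polar_evv//; exact: Dc.
Qed.

Lemma dx_logK p k : D p -> dx k (logK D) p = dlogK k 1 p.
Proof. by move=> Dp; rewrite dx_curve; exact: (logK_derive k Dp (cabs1 _)). Qed.

Lemma cabs_i : cabs ('i%C : C) = 1.
Proof. by rewrite /cabs /= expr0n add0r expr1n sqrtr1. Qed.

Lemma dy_logK p k : D p -> dy k (logK D) p = dlogK k 'i%C p.
Proof. by move=> Dp; rewrite dy_curve; exact: (logK_derive k Dp cabs_i). Qed.

Lemma dlogK_derive p j k : D p -> exists2 b : E, W b & forall c' c : C, cabs c' = 1 -> cabs c = 1 ->
  exists2 del : R, 0 < del & (forall t : R, `|t| < del -> D (curve p j c' t)) /\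
  is_derive (0 : R) (1 : R) (fun t : R => dlogK k c (curve p j c' t))
   (2 * (polar ((c * c') *: b) (ev p) + polar (c *: evd k p) (c' *: evd j p)) / Q p
    - 4 * polar (c *: evd k p) (ev p) * polar (c' *: evd j p) (ev p) / Q p ^+ 2).
Proof.
move=> Dp; have [b Wb Hb] := evd_curve n_gt0 oD j k Dp.
exists b => // c' c c'1 c1.
have [d1 [K1 [d10 D1 H1]]] := Hb c' c'1.
have [d2 [K2 [d20 D2 We H2]]] := ev_curve n_gt0 oD j Dp c'1.
have [d3 d30 [D3 dQ]] := kernel_curve_derive j Dp c'1.
pose del := Num.min d1 d2; have del0 : 0 < del by rewrite lt_min d10.
pose K := `|K1| + `|K2|.
have K12 (t : R) : K1 * t ^+ 4 <= K * t ^+ 4 /\ K2 * t ^+ 4 <= K * t ^+ 4.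
  have t4 : 0 <= t ^+ 4 by rewrite exprn_even_ge0.
  by split; apply: ler_wpM2r => //; rewrite /K;
    [rewrite (le_trans (ler_norm K1))// lerDl|rewrite (le_trans (ler_norm K2))// lerDr].
have Dc t : `|t| < del -> D (curve p j c' t) by rewrite lt_min => /andP[/D1].
have Wx t : `|t| < del -> W (c *: evd k (curve p j c' t)).
  by move=> /Dc Dt; apply: WZ; exact: (evd_dual n_gt0 oD k Dt).
have Wy t : `|t| < del -> W (ev (curve p j c' t)) by move=> /Dc; exact: (ev_dual n_gt0 oD).
have Wx' : W ((c * c') *: b) := WZ (c * c') Wb.
have Hx t : `|t| < del -> q (c *: evd k (curve p j c' t) - c *: evd k (curve p j c' 0) -
    ((t%:C)%C *: ((c * c') *: b))) <= K * t ^+ 4.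
  move=> td; have td1 : `|t| < d1 by move: td; rewrite lt_min => /andP[].
  have -> : (t%:C)%C *: ((c * c') *: b) = c *: ((t%:C)%C *: (c' *: b)).
    by rewrite !scalerA; congr (_ *: _); ring.
  rewrite -!scalerBr qZ ?c1 ?expr1n ?mul1r.
    by apply: le_trans (H1 t td1) _; have [] := K12 t.
  apply: (memWB Hq); last by apply: WZ; exact: WZ.
  by apply: (memWB Hq); apply: (evd_dual n_gt0 oD); apply: D1; rewrite ?normr0.
have Hy t : `|t| < del -> q (ev (curve p j c' t) - ev (curve p j c' 0) -
    ((t%:C)%C *: (c' *: evd j p))) <= K * t ^+ 4.
  move=> td; have td2 : `|t| < d2 by move: td; rewrite lt_min => /andP[].
  by apply: le_trans (H2 t td2) _; have [] := K12 t.
have dP := polar_is_derive Hq del0 Wx Wy Wx' We Hx Hy.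
rewrite !curve0 in dP.
exists (Num.min del d3); first by rewrite lt_min del0.
split=> [t|]; first by rewrite lt_min => /andP[/Dc].
have Q0 := kernel_diag_gt0 Dp.
have Qc0 : polar (ev (curve p j c' 0)) (ev (curve p j c' 0)) != 0.
  by rewrite curve0 polar_evv// gt_eqF.
have := is_derive_quot Qc0 dP dQ; rewrite curve0 polar_evv// => dL.
have cE (t : R) : `|t| < del -> dlogK k c (curve p j c' t) =
    2 * polar (c *: evd k (curve p j c' t)) (ev (curve p j c' t)) /
      polar (ev (curve p j c' t)) (ev (curve p j c' t)).
  by move=> /Dc Dt; rewrite /dlogK polar_evv.
exact: (is_derive_near0 del0 cE dL).
Qed.

Lemma wirt2_logK p j k : D p ->
  wirt2 (logK D) j k p = herm (evd j p) (evd k p) / ((Q p)%:C)%C -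
    herm (evd j p) (ev p) * Num.conj (herm (evd k p) (ev p)) / (((Q p)%:C)%C ^+ 2).
Proof.
move=> Dp; have [b Wb Hb] := dlogK_derive j k Dp.
have Wj := evd_dual n_gt0 oD j Dp; have Wk := evd_dual n_gt0 oD k Dp.
have We := ev_dual n_gt0 oD Dp.
have ci := cabs_i; have c1 : cabs (1 : C) = 1 := cabs1 _.
have second (c' c : C) (h : Cn -> R) : cabs c' = 1 -> cabs c = 1 ->
   (forall z, D z -> h z = dlogK k c z) ->
   derive1 (fun t => h (curve p j c' t)) 0 =
   (2 * (polar ((c * c') *: b) (ev p) + polar (c *: evd k p) (c' *: evd j p)) / Q p
    - 4 * polar (c *: evd k p) (ev p) * polar (c' *: evd j p) (ev p) / Q p ^+ 2).
  move=> c'1 cc1 hE; have [del del0 [Dc dL]] := Hb c' c c'1 cc1.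
  by apply: (derive1_near0 del0 _ dL) => t /Dc /hE.
have X (z : Cn) : D z -> dx k (logK D) z = dlogK k 1 z by exact: dx_logK.
have Y (z : Cn) : D z -> dy k (logK D) z = dlogK k 'i%C z by exact: dy_logK.
rewrite (wirt2_eq (eq_trans (dx_curve _ j p) (second _ _ _ c1 c1 X))
  (eq_trans (dy_curve _ j p) (second _ _ _ ci ci Y)) (eq_trans (dx_curve _ j p) (second _ _ _ c1 ci Y))
  (eq_trans (dy_curve _ j p) (second _ _ _ ci c1 X))).
exact: (polar_wirtinger Hq Wj Wk We Wb (lt0r_neq0 (kernel_diag_gt0 Dp))).
Qed.

Definition evu u p : E := fun f => gradu f p u.

Lemma evuE u p : evu u p = \sum_j u 0 j *: evd j p.
Proof.
apply/funext => f; rewrite fct_sumE; apply: eq_bigr => j _.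
by rewrite -[(u 0 j *: evd j p) f]/(u 0 j * pderiv f j p) mulrC.
Qed.

Lemma evu_dual u p : D p -> W (evu u p).
Proof.
move=> Dp; rewrite evuE; apply: (memW_sum Hq (ev_dual n_gt0 oD Dp)) => j.
by apply: WZ; exact: evd_dual.
Qed.

Lemma bergman_metricE p u : D p ->
  bergman_metric D p u = ((q (evu u p - (herm (evu u p) (ev p) / ((Q p)%:C)%C) *: ev p) / Q p)%:C)%C.
Proof.
move=> Dp; have We := ev_dual n_gt0 oD Dp; have Wu := evu_dual u Dp.
have Q0 := kernel_diag_gt0 Dp.
rewrite (q_proj Hq Wu We Q0) -/(Q p).
have Wj j : W (u 0 j *: evd j p) by apply: WZ; exact: evd_dual.
have Wd j := evd_dual n_gt0 oD j Dp.
have E1 : ((q (evu u p))%:C)%C = \sum_j \sum_k u 0 j * Num.conj (u 0 k) * herm (evd j p) (evd k p).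
  rewrite -(hermxx Hq Wu) {1}evuE (herm_suml Hq Wu Wj).
  apply: eq_bigr => j _; rewrite evuE (herm_sumr Hq (Wj j) Wj).
  apply: eq_bigr => k _.
  rewrite (hermZl Hq _ (Wd j) (Wj k)) (hermZr Hq _ (Wd j) (Wd k)).
  by rewrite mulrA.
have E2 : herm (evu u p) (ev p) = \sum_j u 0 j * herm (evd j p) (ev p).
  rewrite evuE (herm_suml Hq We Wj); apply: eq_bigr => j _.
  by rewrite (hermZl Hq _ (Wd j) We).
have E3 : ((cabs (herm (evu u p) (ev p)) ^+ 2)%:C)%C =
    \sum_j \sum_k u 0 j * Num.conj (u 0 k) * (herm (evd j p) (ev p) * Num.conj (herm (evd k p) (ev p))).
  rewrite -mulCconj E2 rmorph_sum mulr_suml; apply: eq_bigr => j _.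
  rewrite mulr_sumr; apply: eq_bigr => k _; rewrite rmorphM /=; ring.
rewrite rmorphM /= rmorphB /= rmorphM /= !fmorphV E1 E3.
rewrite /bergman_metric !mulr_suml -sumrB mulr_suml; apply: eq_bigr => j _.
rewrite !mulr_suml -sumrB mulr_suml; apply: eq_bigr => k _.
rewrite wirt2_logK//; field.
by apply/eqP => /complexI /eqP; rewrite gt_eqF.
Qed.

End BergmanMetric.

Section ComplexDerivative.
Variable R : realType.
Local Notation C := (R[i]).

Lemma cder_unique (phi : C -> C) (z A B : C) : cder phi z A -> cder phi z B -> A = B.
Proof.
move=> dA dB; apply/eqP; rewrite -subr_eq0 -cabs_eq0 eq_le cabs_ge0 andbT.
apply: (@le0_of_small _ _ 2 (ler0n _ _)) => e e0.
have [d1 d10 H1] := dA e e0; have [d2 d20 H2] := dB e e0.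
pose d := Num.min d1 d2; have d0 : 0 < d by rewrite lt_min d10.
pose h : C := ((d / 2)%:C)%C.
have d2d : d / 2 < d by rewrite ltr_pdivrMr// ltr_pMr// ltr1n.
have ch : cabs h = d / 2 by rewrite cabsR gtr0_norm// divr_gt0.
have h1 : cabs h < d1 by rewrite ch (lt_le_trans d2d)// ge_min lexx.
have h2 : cabs h < d2 by rewrite ch (lt_le_trans d2d)// ge_min lexx orbT.
have ch0 : 0 < cabs h by rewrite ch divr_gt0.
rewrite -(ler_pM2r ch0) -cabsM.
have -> : (A - B) * h = (phi (z + h) - phi z - B * h) - (phi (z + h) - phi z - A * h) by ring.
have := cabsB (phi (z + h) - phi z - B * h) (phi (z + h) - phi z - A * h).
have := H1 h h1; have := H2 h h2; clear; lra.
Qed.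

End ComplexDerivative.

(** * Positivity and local boundedness of the Bergman metric *)

Section MetricBounds.
Variable R : realType.
Local Notation C := (R[i]).
Variable n : nat.
Local Notation Cn := ('rV[C^o]_n).
Local Notation F := (Cn -> C^o).
Variable D : set Cn.
Variable B : R.
Hypotheses (n_gt0 : (0 < n)%N) (oD : open D) (B_ge0 : 0 <= B)
  (DB : forall z, D z -> forall j, cabs (z 0 j) <= B).
Implicit Types (f g : F) (z p u : Cn).

Local Notation V := (bergman_space D).
Local Notation N := (bergman_norm2 D).
Local Notation W := (dual V N).
Local Notation q := (dualnorm2 V N).
Local Notation herm := (herm q).
Local Notation Q := (kernel_diag D).

Lemma cabs_coord u j : cabs (u 0 j) <= nrm u.
Proof.
apply/ler_addgt0Pl => e e0; apply: ltW.
have h : nrm (u - 0) < e + nrm u by rewrite subr0 ltrDr.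
have := (nrm_inball 0 u (ltr_wpDr (nrm_ge0 u) e0)).1 h j.
by rewrite mxE subr0.
Qed.

Definition sqsum u : R := \sum_j cabs (u 0 j) ^+ 2.

Lemma sqsum_gt0 u : u != 0 -> 0 < sqsum u.
Proof.
move=> u0; rewrite lt_neqAle sumr_ge0 ?andbT => [|j _]; last exact: sqr_ge0.
apply: contraNneq u0 => /esym/eqP; rewrite psumr_eq0 => [/allP H|j _]; last exact: sqr_ge0.
apply/eqP/rowP => j; rewrite mxE; apply/eqP; rewrite -cabs_eq0.
by have := H j (mem_index_enum _); rewrite sqrf_eq0.
Qed.

(** The Hermitian product of [z - p] with [u]: it is annihilated by [ev p], and its derivative in
    direction [u] is the squared Euclidean length of [u]. *)
Definition linear_test u p : F := fun z => \sum_j Num.conj (u 0 j) * (z 0 j - p 0 j).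

Lemma linear_test_line u p (x : C) : linear_test u p (p + x *: u) = ((sqsum u)%:C)%C * x.
Proof.
rewrite /linear_test /sqsum rmorph_sum mulr_suml; apply: eq_bigr => j _.
by rewrite !mxE -[RHS]/(((cabs (u 0 j) ^+ 2)%:C)%C * x) -mulCconj; ring.
Qed.

Lemma linear_test_holo u p : holo D (linear_test u p).
Proof.
have H (s : seq 'I_n) : holo D (fun z => \sum_(j <- s) Num.conj (u 0 j) * (z 0 j - p 0 j)).
  elim: s => [|j s IH].
    have -> : (fun z : Cn => \sum_(j <- [::]) Num.conj (u 0 j) * (z 0 j - p 0 j)) = (fun=> 0).
      by apply/funext => z; rewrite big_nil.
    exact: holo_cst.
  have -> : (fun z : Cn => \sum_(i <- j :: s) Num.conj (u 0 i) * (z 0 i - p 0 i)) =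
     (fun z : Cn => Num.conj (u 0 j) * (z 0 j - p 0 j) + \sum_(i <- s) Num.conj (u 0 i) * (z 0 i - p 0 i)).
    by apply/funext => z; rewrite big_cons.
  apply: holoD IH; apply: holoZ.
  apply: (@holoB _ _ D (fun z : Cn => z 0 j) (fun=> p 0 j) _ (@holo_cst _ _ D _)).
  by move=> z _; exact: (@differentiable_coord _ _ _ z 0 j).
exact: H.
Qed.

Lemma linear_test_mem u p : D p -> V (linear_test u p).
Proof.
move=> Dp; apply: (bergman_bounded B_ge0 DB (M := \sum_(j < n) nrm u * (B + B))) (linear_test_holo u p) _.
move=> z Dz; apply: le_trans (cabs_sum _) _; apply: ler_sum => j _.
rewrite cabsM cabs_conj; apply: ler_pM; rewrite ?cabs_ge0 ?cabs_coord//.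
by apply: le_trans (cabsB _ _) _; apply: lerD; exact: DB.
Qed.

Lemma gradu_linear_test u p : D p -> gradu (linear_test u p) p u = ((sqsum u)%:C)%C.
Proof.
move=> Dp; have d1 := cdiff_line0 u (linear_test_holo u p Dp).
apply: cder_unique d1 _ => e e0; exists 1 => // h _.
rewrite add0r !linear_test_line mulr0 subr0 subrr cabs0.
by rewrite mulr_ge0 ?cabs_ge0// ltW.
Qed.

Lemma linear_test_center u p : linear_test u p p = 0.
Proof. by have := linear_test_line u p 0; rewrite scale0r addr0 mulr0. Qed.

(** The functional in the numerator takes the value [sqsum u] at [linear_test u p], whatever the
    coefficient of [ev p], so its dual norm cannot be 0. *)
Lemma bergman_metric_gt0 p u : D p -> u != 0 -> 0 < complex.Re (bergman_metric D p u).
Proof.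
move=> Dp u0; rewrite (bergman_metricE n_gt0 oD B_ge0 DB)//=.
have Q0 := kernel_diag_gt0 n_gt0 oD B_ge0 DB Dp.
apply: divr_gt0 => //.
have Hq := bergman_dual_prehilbert oD.
set l := herm _ _ / _; set L := _ - _.
have WL : W L.
  apply: (memWB Hq); first exact: evu_dual.
  by apply: (prehilbertZ Hq); exact: ev_dual.
have Vg := linear_test_mem u Dp.
have := dualnorm2_ub (bergman0 oD) (@bergmanZ _ _ _ oD) (@bergman_norm2_ge0 _ _ D) (@bergman_norm2Z _ _ _ oD) WL Vg.
have -> : L (linear_test u p) = ((sqsum u)%:C)%C.
  rewrite /L -[LHS]/(gradu (linear_test u p) p u - l * linear_test u p p).
  by rewrite gradu_linear_test// linear_test_center mulr0 subr0.
rewrite cabsR => h; have s0 := sqsum_gt0 u0.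
rewrite lt_neqAle (prehilbert_ge0 Hq WL) andbT eq_sym.
apply: contraTneq h => ->; rewrite mul0r -ltNge; apply: exprn_gt0.
by rewrite gtr0_norm.
Qed.

Lemma gradu_le f z u (K : R) : (forall j, cabs (pderiv f j z) <= K) ->
  cabs (gradu f z u) <= n%:R * K * nrm u.
Proof.
move=> H; apply: le_trans (cabs_sum _) _.
have -> : n%:R * K * nrm u = \sum_(j < n) K * nrm u.
  by rewrite sumr_const card_ord -[RHS]mulr_natl mulrA.
apply: ler_sum => j _; rewrite cabsM.
by apply: ler_pM; rewrite ?cabs_ge0 ?cabs_coord.
Qed.

(** Dropping the projection leaves [q (evu u z) / Q z]; the numerator obeys Cauchy's estimates
    uniformly near [p], and [kernel_diag_ge] bounds [1 / Q z] by the squared norm of the constant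
    1. *)
Lemma bergman_metric_le p : D p -> exists r M : R, [/\ 0 < r, 0 <= M, inball p r `<=` D &
  forall z u, inball p r z -> complex.Re (bergman_metric D z u) <= (M * nrm u) ^+ 2].
Proof.
move=> Dp; have [r [S [r0 S0 rD H]]] := bergman_eval_bound n_gt0 oD Dp.
have r2 : 0 < r / 2 by rewrite divr_gt0.
have rr : r / 2 <= r by rewrite ler_pdivrMr// ler_peMr ?(ltW r0)// ler1n.
have N1 := bergman_norm2_ge0 (bergman_bounded B_ge0 DB (@holo_cst _ _ D 1) (M := cabs 1) (fun _ _ => lexx _)).
pose K := n%:R * (8 * S / r).
have K0 : 0 <= K.
  apply: mulr_ge0 (ler0n _ _) _; apply: divr_ge0 (ltW r0).
  exact: mulr_ge0 (ler0n _ _) (ltW S0).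
exists (r / 2), (K * Num.sqrt (N (fun=> 1))); split=> //.
- exact: mulr_ge0 K0 (sqrtr_ge0 _).
- exact: subset_trans (inballW rr) rD.
move=> z u zr; have Dz : D z by apply: rD; exact: inballW zr.
rewrite (bergman_metricE n_gt0 oD B_ge0 DB)//=.
have Q0 := kernel_diag_gt0 n_gt0 oD B_ge0 DB Dz.
have Q1 := kernel_diag_ge n_gt0 oD B_ge0 DB Dz.
have Hq := bergman_dual_prehilbert oD.
have Wu := evu_dual n_gt0 oD u Dz; have We := ev_dual n_gt0 oD Dz.
rewrite (q_proj Hq Wu We Q0) -/(Q z).
have qu : q (evu u z) <= (K * nrm u) ^+ 2.
  apply: (dualnorm2_le (bergman0 oD) (@bergman_norm2Z _ _ _ oD)) => f Vf Nf.
  have Knu : 0 <= K * nrm u := mulr_ge0 K0 (nrm_ge0 u).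
  rewrite ler_pXn2r ?nnegrE ?cabs_ge0//; apply: gradu_le => j.
  have [hf _] := Vf.
  apply: (@pderiv_bound _ _ f p r S r0 _ _ z j zr) => [w wr|w wr].
    by apply: hf; apply: rD.
  apply: le_trans (H f Vf w wr) _; rewrite ler_piMr ?(ltW S0)//.
  by rewrite -[leRHS]sqrtr1 ler_wsqrtr.
have -> : (K * Num.sqrt (N (fun=> 1)) * nrm u) ^+ 2 = (K * nrm u) ^+ 2 * N (fun=> 1).
  by rewrite -[N _ in RHS]sqr_sqrtr//; ring.
rewrite ler_pdivrMr//; apply: (@le_trans _ _ ((K * nrm u) ^+ 2)).
  by rewrite (le_trans _ qu)// gerBl divr_ge0 ?exprn_ge0 ?cabs_ge0// ltW.
rewrite -[leRHS]mulrA; apply: ler_peMr; first exact: (sqr_ge0 (K * nrm u)).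
by rewrite mulrC.
Qed.

End MetricBounds.

(** * Point evaluations on the Bloch space *)

Section PointEvaluation.
Variable R : realType.
Local Notation C := (R[i]).
Variable n : nat.
Local Notation Cn := ('rV[C^o]_n).
Local Notation F := (Cn -> C^o).
Variable D : set Cn.
Implicit Types (f g : F) (z p u : Cn).

Lemma bounded_coord : bounded_set D ->
  exists2 B : R, 0 <= B & forall z, D z -> forall j, cabs (z 0 j) <= B.
Proof.
move=> [M [Mr H]]; exists `|complex.Re (M + 1)| => // z Dz j.
have := H (M + 1); rewrite ltrDl ltr01 => /(_ isT z Dz).
rewrite /= normE lecE => /andP[_ h]; apply: le_trans (cabs_coord z j) _.
exact: le_trans h (ler_norm _).
Qed.

Hypotheses (n_gt0 : (0 < n)%N) (dD : domain D) (bD : bounded_set D) (D0 : D 0).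

Let oD : open D. Proof. by have [] := dD. Qed.

Local Notation H z u := (complex.Re (bergman_metric D z u)).

Lemma metric_gt0 z u : D z -> u != 0 -> 0 < H z u.
Proof. by have [B B0 DB] := bounded_coord bD; exact: (bergman_metric_gt0 n_gt0 oD B0 DB). Qed.

Lemma exists_nonzero : exists u : Cn, u != 0.
Proof.
exists (ebasis R (Ordinal n_gt0)); apply/eqP => /rowP /(_ (Ordinal n_gt0)).
by rewrite !mxE !eqxx => /eqP; rewrite oner_eq0.
Qed.

(** An empty supremum would be [-oo]; [n_gt0] supplies a nonzero vector. *)
Lemma Qf_ge0 f z : (0 <= Qf D f z)%E.
Proof.
have [u u0] := exists_nonzero; apply: ereal_sup_ge.
exists (cabs (gradu f z u) / Num.sqrt (H z u))%:E; first by exists u.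
by rewrite lee_fin; apply: divr_ge0 (cabs_ge0 _) (sqrtr_ge0 _).
Qed.

Lemma Qf_ub f z u : u != 0 -> ((cabs (gradu f z u) / Num.sqrt (H z u))%:E <= Qf D f z)%E.
Proof. by move=> u0; apply: ereal_sup_ubound; exists u. Qed.

Lemma Qf_le f z (a : \bar R) :
  (forall u, u != 0 -> ((cabs (gradu f z u) / Num.sqrt (H z u))%:E <= a)%E) -> (Qf D f z <= a)%E.
Proof. by move=> h; apply: ub_ereal_sup => _ [u u0 <-]; exact: h. Qed.

Lemma Qf_beta f z : D z -> (Qf D f z <= beta D f)%E.
Proof. by move=> Dz; apply: ereal_sup_ubound; exists z. Qed.

Lemma beta_ge0 f : (0 <= beta D f)%E.
Proof. exact: le_trans (Qf_ge0 f 0) (Qf_beta f D0). Qed.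

Lemma bloch_betaE f : bloch D f -> beta D f = (fine (beta D f))%:E.
Proof. by move=> [_ h]; rewrite fineK// ge0_fin_numE// beta_ge0. Qed.

Lemma gradu_bloch f z u : bloch D f -> D z ->
  cabs (gradu f z u) <= fine (beta D f) * Num.sqrt (H z u).
Proof.
move=> bf Dz; have [->|u0] := eqVneq u 0.
  have -> : gradu f z 0 = 0 by rewrite /gradu big1// => j _; rewrite mxE mulr0.
  rewrite cabs0; apply: mulr_ge0 (sqrtr_ge0 _); exact: fine_ge0 (beta_ge0 _).
have h : 0 < Num.sqrt (H z u) by rewrite sqrtr_gt0; exact: metric_gt0.
rewrite -ler_pdivrMr// -lee_fin -bloch_betaE//.
exact: le_trans (Qf_ub f z u0) (Qf_beta f Dz).
Qed.

Lemma bloch_local_bound p : D p -> exists r C : R, [/\ 0 < r, inball p r `<=` D & forall z f,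
  inball p r z -> bloch D f -> cabs (f z - f p) <= C * fine (beta D f)].
Proof.
move=> Dp; have [B B0 DB] := bounded_coord bD.
have [r [M [r0 M0 rD HM]]] := bergman_metric_le n_gt0 oD B0 DB Dp.
exists r, (2 * (M * r)); split=> // z f zr bf; have [hf _] := bf.
pose u := z - p.
have zt (t : R) : 0 <= t <= 1 -> inball p r (p + (t%:C)%C *: u).
  move=> /andP[t0 t1] j; rewrite !mxE addrAC subrr add0r cabsM cabsR ger0_norm//.
  apply: le_lt_trans (zr j); rewrite ler_piMl ?cabs_ge0//.
have b0 : 0 <= fine (beta D f) := fine_ge0 (beta_ge0 f).
have -> : z = p + u by rewrite /u addrC subrK.
have -> : 2 * (M * r) * fine (beta D f) = 2 * (fine (beta D f) * (M * r)) by ring.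
apply: mean_value_segment => t t01; first by apply: hf; apply: rD; exact: zt.
apply: le_trans (gradu_bloch _ bf (rD _ (zt t t01))) _; apply: ler_wpM2l => //.
have ur : nrm u <= r by apply: ltW; exact/(nrm_inball _ _ r0).
have Mu : 0 <= M * nrm u := mulr_ge0 M0 (nrm_ge0 u).
apply: (@le_trans _ _ (M * nrm u)); last exact: ler_wpM2l.
by rewrite -[leRHS]ger0_norm// -sqrtr_sqr ler_wsqrtr// HM//; exact: zt.
Qed.

Definition evaluable z := exists C : R, forall f, bloch D f ->
  cabs (f z - f 0) <= C * fine (beta D f).

Lemma evaluable_step z w (K : R) : (forall f, bloch D f -> cabs (f z - f w) <= K * fine (beta D f)) ->
  evaluable w -> evaluable z.
Proof.
move=> h [C' HC]; exists (K + C') => f bf.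
have -> : f z - f 0 = (f z - f w) + (f w - f 0) by ring.
by apply: le_trans (cabsD _ _) _; rewrite mulrDl; apply: lerD; [exact: h|exact: HC].
Qed.

(** The local bound has a constant independent of [f] and is symmetric in its two points, so
    evaluability spreads from a point to its neighbours and back: the evaluable points and the
    others both form open subsets of [D]. *)
Lemma bloch_evaluable z : D z -> evaluable z.
Proof.
have [_ [cD _]] := dD; pose A := [set z | D z /\ evaluable z].
suff AD : A = D by move=> Dz; have [] : A z by rewrite AD.
apply: cD.
- by exists 0; split=> //; exists 0 => f _; rewrite subrr cabs0 mul0r.
- exists A; last by rewrite setIA setIid.
  apply/open_inballP => p [Dp Ep]; have [r [K [r0 rD HK]]] := bloch_local_bound Dp.
  exists r => // w wr; split; first exact: rD.
  by apply: evaluable_step Ep => f; exact: HK.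
- exists (~` (D `\` A)); last first.
    apply/seteqP; split=> [w [Dw Ew]|w [Dw Ew]]; first by split=> // -[_ []].
    by apply: contrapT => nA; exact: Ew.
  apply: open_closedC; apply/open_inballP => p [Dp nA].
  have [r [K [r0 rD HK]]] := bloch_local_bound Dp.
  exists r => // w wr; split; first exact: rD.
  move=> [_ Ew]; apply: nA; split=> //; apply: evaluable_step Ew => f bf.
  by rewrite cabs_distC; exact: HK.
Qed.

End PointEvaluation.

(** * Multiplication operators *)

Section GraduAlgebra.
Variable R : realType.
Local Notation C := (R[i]).
Variable n : nat.
Local Notation Cn := ('rV[C^o]_n).
Implicit Types (f g : Cn -> C) (z u : Cn).

Lemma cdiffM f g z : cdiff f z -> cdiff g z -> cdiff (mult f g) z.
Proof. exact: differentiableM. Qed.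

Lemma gradu_mult f g z u : cdiff f z -> cdiff g z ->
  gradu (mult f g) z u = f z * gradu g z u + g z * gradu f z u.
Proof.
move=> df dg; rewrite !gradu_diff//; last exact: cdiffM.
by have := diffM df dg => /(congr1 (fun h => h u)).
Qed.

Lemma gradu_cst (c : C) z u : gradu (fun=> c) z u = 0.
Proof. by rewrite gradu_diff ?diff_cst//; exact: differentiable_cst. Qed.

Lemma graduZ (c : C) f z u : cdiff f z -> gradu (fun w => c * f w) z u = c * gradu f z u.
Proof.
move=> df; have := gradu_mult u (differentiable_cst (c : C^o) z) df.
by rewrite gradu_cst mulr0 addr0.
Qed.

Lemma gradu_subc (c : C) f z u : cdiff f z -> gradu (fun w => f w - c) z u = gradu f z u.
Proof.
move=> df; have dc := differentiable_cst (c : C^o) z.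
rewrite (gradu_diff u (differentiableB df dc)) (gradu_diff u df).
rewrite -[RHS]subr0 -(gradu_cst c z u) (gradu_diff u dc).
exact: (congr1 (fun h => h u) (diffB df dc)).
Qed.

End GraduAlgebra.

Section PowerBound.
Variable R : realType.

Lemma bernoulli_le (x : R) k : 0 <= x -> 1 + k%:R * x <= (1 + x) ^+ k.
Proof.
move=> x0; elim: k => [|k IH]; first by rewrite mul0r addr0 expr0.
rewrite exprSr; apply: (@le_trans _ _ ((1 + k%:R * x) * (1 + x))).
  have : 0 <= k%:R * (x * x) by rewrite !mulr_ge0.
  rewrite -natr1; lra.
by apply: ler_wpM2r => //; lra.
Qed.

(** If [a > m > 0], the powers of [a / m] exceed [K] by Bernoulli's inequality; for [m = 0] the
    exponent 1 decides. *)
Lemma le_of_powers (a m K : R) : 0 <= a -> 0 <= m -> (forall k, a ^+ k <= K * m ^+ k) -> a <= m.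
Proof.
move=> a0 m0 H; rewrite leNgt; apply/negP => ma.
have K1 : 1 <= K by have := H 0%N; rewrite !expr0 mulr1.
move: m0; rewrite le_eqVlt => /predU1P[m0|m0].
  by have := H 1%N; rewrite -m0 !expr1 mulr0 leNgt m0 ma.
pose x := a / m - 1.
have x0 : 0 < x by rewrite subr_gt0 ltr_pdivlMr// mul1r.
have Hk k : k%:R * x < K.
  apply: (@lt_le_trans _ _ (1 + k%:R * x)); first by rewrite ltrDr.
  apply: le_trans (bernoulli_le k (ltW x0)) _.
  by rewrite /x addrC subrK exprMn exprVn ler_pdivrMr ?exprn_gt0.
have := Hk (Num.truncn (K / x)).+1; apply/negP; rewrite -leNgt -ler_pdivrMr//.
by apply: ltW; apply: truncnS_gt.
Qed.

End PowerBound.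

Section MultiplicationOperator.
Variable R : realType.
Local Notation C := (R[i]).
Variable n : nat.
Local Notation Cn := ('rV[C^o]_n).
Variable D : set Cn.
Implicit Types (f g : Cn -> C) (z u : Cn).
Hypotheses (n_gt0 : (0 < n)%N) (D0 : D 0).

Local Notation H z u := (complex.Re (bergman_metric D z u)).

Lemma Qf_cst (c : C) z : Qf D (fun=> c) z = 0%E.
Proof.
apply/eqP; rewrite eq_le (Qf_ge0 D n_gt0) andbT; apply: Qf_le => u _.
by rewrite gradu_cst cabs0 mul0r.
Qed.

Lemma Qf_eq_gradu f g z : (forall u, gradu f z u = gradu g z u) -> Qf D f z = Qf D g z.
Proof.
move=> fg; apply/eqP; rewrite eq_le; apply/andP; split; apply: Qf_le => u u0.
  by rewrite fg; exact: Qf_ub.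
by rewrite -fg; exact: Qf_ub.
Qed.

Lemma QfZ_le (c : C) f z : cdiff f z -> (Qf D (fun w => c * f w)%R z <= (cabs c)%:E * Qf D f z)%E.
Proof.
move=> df; apply: Qf_le => u u0; rewrite graduZ// cabsM -mulrA EFinM.
by apply: lee_wpmul2l; [rewrite lee_fin cabs_ge0|exact: Qf_ub].
Qed.

Lemma beta_le f (a : \bar R) : (forall z, D z -> (Qf D f z <= a)%E) -> (beta D f <= a)%E.
Proof. by move=> h; apply: ub_ereal_sup => _ [z Dz <-]; exact: h. Qed.

Lemma beta_cst (c : C) : beta D (fun=> c) = 0%E.
Proof.
apply/eqP; rewrite eq_le (beta_ge0 n_gt0 D0) andbT.
by apply: beta_le => z _; rewrite Qf_cst.
Qed.

Lemma betaZ_le (c : C) f : holo D f -> (beta D (fun w => c * f w)%R <= (cabs c)%:E * beta D f)%E.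
Proof.
move=> hf; apply: beta_le => z Dz; apply: le_trans (QfZ_le c (hf z Dz)) _.
by apply: lee_wpmul2l; [rewrite lee_fin cabs_ge0|exact: Qf_beta].
Qed.

Lemma Qf_subc (c : C) f z : cdiff f z -> Qf D (fun w => f w - c) z = Qf D f z.
Proof. by move=> df; apply: Qf_eq_gradu => u; exact: gradu_subc. Qed.

Lemma beta_subc (c : C) f : holo D f -> beta D (fun w => f w - c) = beta D f.
Proof.
move=> hf; apply/eqP; rewrite eq_le; apply/andP; split; apply: beta_le => z Dz.
  by rewrite (Qf_subc c (hf z Dz)); exact: Qf_beta.
by rewrite -(Qf_subc c (hf z Dz)); exact: Qf_beta.
Qed.

Lemma cabs_combination (x y a b : C) (s : R) : 0 <= s ->
  cabs (x * a + y * b) / s <= cabs x * (cabs a / s) + cabs y * (cabs b / s).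
Proof.
move=> s0; rewrite !mulrA -mulrDl -!cabsM; apply: ler_wpM2r; last exact: cabsD.
by rewrite invr_ge0.
Qed.

Lemma Qf_mult_le f g z : cdiff f z -> cdiff g z ->
  (Qf D (mult f g) z <= (cabs (f z))%:E * Qf D g z + (cabs (g z))%:E * Qf D f z)%E.
Proof.
move=> df dg; apply: Qf_le => u u0; rewrite gradu_mult//.
apply: (@le_trans _ _ ((cabs (f z) * (cabs (gradu g z u) / Num.sqrt (H z u)) +
   cabs (g z) * (cabs (gradu f z u) / Num.sqrt (H z u)))%:E)).
  by rewrite lee_fin; apply: cabs_combination; exact: sqrtr_ge0.
have h (x : C) (k : Cn -> C) : ((cabs x * (cabs (gradu k z u) / Num.sqrt (H z u)))%:E <=
    (cabs x)%:E * Qf D k z)%E.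
  by rewrite EFinM; apply: lee_wpmul2l; [rewrite lee_fin cabs_ge0|exact: Qf_ub].
by rewrite EFinD; apply: leeD; exact: h.
Qed.

(** The closure properties shared by the two Bloch spaces, from which both halves follow at once.
    Scaling and subtraction of constants bring a function into the normalized class that defines
    [omega_gen]. *)
Record bloch_type (X : (Cn -> C) -> Prop) : Prop := {
  bloch_type_bloch : forall f, X f -> bloch D f;
  bloch_type_cst : forall c : C, X (fun=> c);
  bloch_typeZ : forall (c : C) f, X f -> X (fun z => c * f z);
  bloch_type_subc : forall (c : C) f, X f -> X (fun z => f z - c) }.

Lemma bloch_cst (c : C) : bloch D (fun=> c).
Proof. by split; [exact: holo_cst|rewrite beta_cst ltry]. Qed.

Lemma blochZ (c : C) f : bloch D f -> bloch D (fun z => c * f z).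
Proof.
move=> bf; have [hf _] := bf; split; first exact: holoZ.
apply: le_lt_trans (betaZ_le c hf) _.
by rewrite (bloch_betaE n_gt0 D0 bf) -EFinM ltry.
Qed.

Lemma bloch_subc (c : C) f : bloch D f -> bloch D (fun z => f z - c).
Proof.
move=> [hf bf]; split; last by rewrite beta_subc.
exact: (@holoB _ _ D f (fun=> c) hf (@holo_cst _ _ D c)).
Qed.

Lemma bloch_is_bloch_type : bloch_type (bloch D).
Proof. by split; [by []|exact: bloch_cst|exact: blochZ|exact: bloch_subc]. Qed.

Lemma little_bloch_is_bloch_type : bloch_type (little_bloch D).
Proof.
split=> [f [] //|c|c f [bf vf]|c f [bf vf]].
- split; first exact: bloch_cst.
  by move=> e e0; exists 1 => // z _ _; rewrite Qf_cst lte_fin.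
- split; first exact: blochZ.
  (* Adding 1 keeps the division below legitimate when [c = 0]. *)
  move=> e e0; pose K := 1 + cabs c; have K0 : 0 < K by rewrite ltr_wpDr ?cabs_ge0.
  have [d d0 Hd] := vf (e / K) (divr_gt0 e0 K0); exists d => // z Dz zb.
  have [hf _] := bf; have h := Hd z Dz zb.
  apply: le_lt_trans (QfZ_le c (hf z Dz)) _.
  apply: (@le_lt_trans _ _ ((cabs c)%:E * (e / K)%:E)%E).
    by apply: lee_wpmul2l; [rewrite lee_fin cabs_ge0|exact: ltW].
  rewrite -EFinM lte_fin mulrCA gtr_pMr// ltr_pdivrMr// mul1r /K ltrDr ltr01//.
- split; first exact: bloch_subc.
  move=> e /vf[d d0 Hd]; exists d; first exact: d0.
  by move=> z Dz zb; have [hf _] := bf; rewrite Qf_subc; [exact: Hd|exact: hf].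
Qed.

End MultiplicationOperator.

Lemma add_le_norm_mul (R : realType) (a b c K : R) : 0 <= a -> 0 <= b -> c <= K * b ->
  a + c <= (1 + `|K|) * (a + b).
Proof.
move=> a0 b0 cK; have := ler_wpM2r b0 (ler_norm K); have := mulr_ge0 (normr_ge0 K) a0; lra.
Qed.

Lemma regroup_le (R : realType) (a p x y z S s : R) : x <= S * y + a * z + y * s ->
  p * a + x <= a * (p + z) + y * (S + s).
Proof. lra. Qed.

(** * Bounds for the operator norm of a multiplication operator *)

Section OperatorNorm.
Variable R : realType.
Local Notation C := (R[i]).
Variable n : nat.
Local Notation Cn := ('rV[C^o]_n).
Variable D : set Cn.
Variable X : (Cn -> C) -> Prop.
Variable psi : Cn -> C.
Implicit Types (f g : Cn -> C) (z u : Cn).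
Hypotheses (n_gt0 : (0 < n)%N) (dD : domain D) (bD : bounded_set D) (D0 : D 0).
Hypotheses (HX : bloch_type D X) (HB : mult_bounded X D psi).

Local Notation b f := (fine (beta D f)).
Definition bloch_norm f : R := cabs (f 0) + b f.
Local Notation nb := bloch_norm.

Let XB := bloch_type_bloch HX.

Lemma fine_beta_ge0 f : 0 <= b f. Proof. exact: fine_ge0 (beta_ge0 n_gt0 D0 f). Qed.

Lemma bloch_norm_ge0 f : 0 <= nb f.
Proof. exact: addr_ge0 (cabs_ge0 _) (fine_beta_ge0 f). Qed.

Lemma bnormE f : bloch D f -> bnorm D f = (nb f)%:E.
Proof. by move=> bf; rewrite /bnorm (bloch_betaE n_gt0 D0 bf). Qed.

Lemma bloch_normZ_le (c : C) f : bloch D f -> nb (fun z => c * f z) <= cabs c * nb f.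
Proof.
move=> bf; have [hf _] := bf; have h := betaZ_le c hf.
rewrite /bloch_norm cabsM mulrDr lerD2l.
by move: h; rewrite (bloch_betaE n_gt0 D0 bf) (bloch_betaE n_gt0 D0 (blochZ n_gt0 D0 c bf)) -EFinM lee_fin.
Qed.

Lemma bloch_norm_cst (c : C) : nb (fun=> c) = cabs c.
Proof. by rewrite /bloch_norm (beta_cst n_gt0 D0) /= addr0. Qed.

Lemma mult1 : mult psi (fun=> 1) = psi.
Proof. by apply/funext => z; rewrite /mult mulr1. Qed.

Lemma psi_mem : X psi.
Proof. by have := HB.1 _ (bloch_type_cst HX 1); rewrite mult1. Qed.

Lemma bnorm_le_opnorm : (bnorm D psi <= mult_opnorm X D psi)%E.
Proof.
apply: ereal_sup_ubound; exists (fun=> 1); last by rewrite mult1.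
split; first exact: (bloch_type_cst HX).
by rewrite (bnormE (XB (bloch_type_cst HX 1))) bloch_norm_cst cabs1.
Qed.

Lemma mult_norm_le (m : R) f : mult_opnorm X D psi = m%:E -> X f -> nb (mult psi f) <= m * nb f.
Proof.
move=> Em Xf; have bf := XB Xf; have Xpf := HB.1 _ Xf; have bpf := XB Xpf.
(* A function of norm 0 cannot be scaled into use in the supremum; here the constant of
   [mult_bounded] gives the bound. *)
have [nf0|nf0] := eqVneq (nb f) 0.
  have [c /(_ f Xf)] := HB.2; rewrite (bnormE bf) (bnormE bpf) -EFinM lee_fin.
  by rewrite nf0 !mulr0.
have nf : 0 < nb f by rewrite lt_neqAle eq_sym nf0 bloch_norm_ge0.
pose k : C := (((nb f)^-1)%:C)%C; pose g z := k * f z.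
have Xg : X g by exact: (bloch_typeZ HX).
have Xpg := HB.1 _ Xg; have bpg := XB Xpg.
have ck : cabs k = (nb f)^-1 by rewrite cabsR gtr0_norm ?invr_gt0.
have ng : nb g <= 1.
  by apply: le_trans (bloch_normZ_le k bf) _; rewrite ck mulVf.
have npg : nb (mult psi g) <= m.
  rewrite -lee_fin -Em -(bnormE bpg); apply: ereal_sup_ubound; exists g => //.
  by split=> //; rewrite (bnormE (XB Xg)) lee_fin.
have -> : mult psi f = (fun z => ((nb f)%:C)%C * mult psi g z).
  apply/funext => z; rewrite /mult /g /k.
  have -> : ((nb f)%:C)%C * (psi z * ((((nb f)^-1)%:C)%C * f z)) =
     (((nb f)%:C)%C * (((nb f)^-1)%:C)%C) * (psi z * f z) :> C by ring.
  by rewrite -rmorphM /= divff ?mul1r// gt_eqF.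
apply: le_trans (bloch_normZ_le _ bpg) _.
have -> : cabs (((nb f)%:C)%C : C) = nb f by rewrite cabsR gtr0_norm.
rewrite [leRHS]mulrC; exact: ler_wpM2l (ltW nf) _ _ npg.
Qed.

Lemma supnorm_le_opnorm : (supnorm D psi <= mult_opnorm X D psi)%E.
Proof.
have op0 : (0 <= mult_opnorm X D psi)%E.
  apply: le_trans bnorm_le_opnorm; rewrite (bnormE (XB psi_mem)) lee_fin; exact: bloch_norm_ge0.
case Em : (mult_opnorm X D psi) op0 => [m| |//] m0; last exact: leey.
rewrite lee_fin in m0.
apply: ub_ereal_sup => _ [z Dz <-]; rewrite lee_fin.
have pw k : X (iter k (mult psi) (fun=> 1)) /\ nb (iter k (mult psi) (fun=> 1)) <= m ^+ k.
  elim: k => [|k [Xk Nk]]; first by split; [exact: (bloch_type_cst HX)|rewrite bloch_norm_cst cabs1].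
  rewrite iterS; split; first exact: HB.1.
  apply: le_trans (mult_norm_le Em Xk) _; rewrite exprS; exact: ler_wpM2l.
have pwE k : iter k (mult psi) (fun=> 1) z = psi z ^+ k.
  by elim: k => [//|k IH]; rewrite iterS exprS -IH.
have [K HK] := bloch_evaluable n_gt0 dD bD D0 Dz.
apply: (@le_of_powers _ _ _ (1 + `|K|) (cabs_ge0 _) m0) => k.
have [Xk Nk] := pw k; rewrite -cabsX -pwE; set f := iter k _ _ in Xk Nk *.
have -> : f z = f 0 + (f z - f 0) by ring.
apply: le_trans (cabsD _ _) _.
apply: (@le_trans _ _ ((1 + `|K|) * nb f)); last by apply: ler_wpM2l; rewrite ?addr_ge0.
exact: add_le_norm_mul (cabs_ge0 _) (fine_beta_ge0 f) (HK f (XB Xk)).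
Qed.

Local Notation om := (omega_gen X D).
Local Notation sg := (sigma_gen om D psi).

(** The function [(f - f 0) / beta_f] competes in the supremum defining [om z]. The factor
    [Qf D psi z] is included because it is the product, not [om z] itself, that [sg = s%:E] bounds
    by a real number. *)
Lemma omega_sigma_le (s : R) f z : sg = s%:E -> X f -> D z ->
  cabs (f z - f 0) * fine (Qf D psi z) <= b f * s.
Proof.
(* When [beta_f = 0] the evaluation bound gives [f z = f 0], and both sides vanish. *)
move=> Es Xf Dz; have [bf0|bf0] := eqVneq (b f) 0.
  have [K /(_ f (XB Xf))] := bloch_evaluable n_gt0 dD bD D0 Dz.
  rewrite bf0 mulr0 => h; have -> : cabs (f z - f 0) = 0.
    by apply/eqP; rewrite eq_le h cabs_ge0.
  by rewrite !mul0r.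
have bf : 0 < b f by rewrite lt_neqAle eq_sym bf0 fine_beta_ge0.
pose k : C := (((b f)^-1)%:C)%C.
have ck : cabs k = (b f)^-1 by rewrite cabsR gtr0_norm ?invr_gt0.
pose h w := f w - f 0; have Xh : X h := bloch_type_subc HX (f 0) Xf.
pose g w := k * h w; have Xg : X g := bloch_typeZ HX k Xh.
have g0 : g 0 = 0 by rewrite /g /h subrr mulr0.
have hf : holo D f by have [] := XB Xf.
have ng : (bnorm D g <= 1)%E.
  rewrite (bnormE (XB Xg)) lee_fin; apply: le_trans (bloch_normZ_le k (XB Xh)) _.
  by rewrite ck /bloch_norm /h subrr cabs0 add0r (beta_subc _ hf) mulVf.
have Qfin : Qf D psi z = (fine (Qf D psi z))%:E.
  rewrite fineK// ge0_fin_numE ?(Qf_ge0 D n_gt0)//.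
  apply: le_lt_trans (Qf_beta psi Dz) _; by have [] := XB psi_mem.
have : (((b f)^-1 * cabs (f z - f 0))%:E * Qf D psi z <= s%:E)%E.
  rewrite -Es; apply: le_trans (ereal_sup_ubound _); last by exists z.
  apply: lee_wpmul2r; first exact: Qf_ge0.
  by apply: ereal_sup_ubound; exists g => //; rewrite /g cabsM ck.
rewrite Qfin -EFinM lee_fin -mulrA ler_pdivrMl//.
Qed.

Lemma supnorm_ge0 : (0 <= supnorm D psi)%E.
Proof.
apply: le_trans (ereal_sup_ubound _); last by exists 0.
by rewrite lee_fin cabs_ge0.
Qed.

Lemma sigma_ge0 : (0 <= sg)%E.
Proof.
apply: le_trans (ereal_sup_ubound _); last by exists 0.
apply: mule_ge0 (Qf_ge0 D n_gt0 _ _).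
apply: le_trans (ereal_sup_ubound _); last first.
  exists (fun=> 0); last by [].
  split; first exact: (bloch_type_cst HX).
  split=> //; rewrite (bnormE (XB (bloch_type_cst HX 0))) bloch_norm_cst cabs0.
  by rewrite lee_fin.
by rewrite cabs0.
Qed.

(** In the product rule |f(z)| is split as [cabs (f 0) + cabs (f z - f 0)]: the first part completes
    [nb psi], the second is absorbed by [s]. *)
Lemma mult_bnorm_le (S s : R) f : supnorm D psi = S%:E -> sg = s%:E -> X f ->
  nb (mult psi f) <= cabs (f 0) * nb psi + b f * (S + s).
Proof.
move=> ES Es Xf; have bf := XB Xf; have bp := XB psi_mem.
have [hf _] := bf; have [hp _] := bp.
have bpf := XB (HB.1 _ Xf).
suff h : b (mult psi f) <= S * b f + cabs (f 0) * b psi + b f * s.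
  rewrite /bloch_norm -[mult psi f 0]/(psi 0 * f 0) cabsM.
  exact: regroup_le h.
rewrite -lee_fin -(bloch_betaE n_gt0 D0 bpf); apply: beta_le => z Dz.
apply: (le_trans (Qf_mult_le D (hp z Dz) (hf z Dz))).
have pS : cabs (psi z) <= S.
  by rewrite -lee_fin -ES; apply: ereal_sup_ubound; exists z.
have QE g : bloch D g -> Qf D g z = (fine (Qf D g z))%:E /\ 0 <= fine (Qf D g z) <= b g.
  move=> bg; have q0 := Qf_ge0 D n_gt0 g z; have qb := Qf_beta g Dz.
  have E : Qf D g z = (fine (Qf D g z))%:E.
    by rewrite fineK// ge0_fin_numE// (le_lt_trans qb)//; have [] := bg.
  split=> //; rewrite fine_ge0//=.
  by rewrite -lee_fin -E -(bloch_betaE n_gt0 D0 bg).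
have [-> /andP[qf0 qfb]] := QE _ bf; have [EQ /andP[qp0 qpb]] := QE _ bp.
have key := omega_sigma_le Es Xf Dz.
rewrite EQ -!EFinM -EFinD lee_fin.
have h2 : cabs (f z) <= cabs (f 0) + cabs (f z - f 0).
  by have := cabsD (f 0) (f z - f 0); rewrite addrC subrK.
rewrite -[leRHS]addrA; apply: lerD; first exact: ler_pM (cabs_ge0 _) qf0 pS qfb.
apply: (le_trans (ler_wpM2r qp0 h2)); rewrite mulrDl.
exact: lerD (ler_wpM2l (cabs_ge0 _) qpb) key.
Qed.

(** The bound of [mult_bnorm_le] has the weights [cabs (f 0)] and [b f], whose sum is at most 1 on
    the unit ball, so it does not exceed the maximum. If [supnorm] or [sg] is infinite, so is the
    right side. *)
Lemma opnorm_le : (mult_opnorm X D psi <= maxe (bnorm D psi) (supnorm D psi + sg))%E.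
Proof.
have S0 := supnorm_ge0; have s0 := sigma_ge0.
apply: ub_ereal_sup => _ [f [Xf nf] <-].
case ES : (supnorm D psi) S0 => [S| |//] S0; last first.
  by rewrite le_max; apply/orP; right; case: (sg) s0 => [s| |//] _; rewrite /= leey.
case Es : sg s0 => [s| |//] s0; last first.
  by rewrite le_max; apply/orP; right; rewrite /= leey.
rewrite (bnormE (XB psi_mem)) (bnormE (XB (HB.1 _ Xf))) -EFinD.
apply: (@le_trans _ _ (Num.max (nb psi) (S + s))%:E); last first.
  by rewrite EFin_max.
rewrite lee_fin; apply: le_trans (mult_bnorm_le ES Es Xf) _.
move: nf; rewrite (bnormE (XB Xf)) lee_fin /bloch_norm => nf.
set M := Num.max _ _.
have h1 : nb psi <= M by rewrite le_max lexx.
have h2 : S + s <= M by rewrite le_max lexx orbT.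
have M0 : 0 <= M := le_trans (bloch_norm_ge0 psi) h1.
apply: le_trans (lerD (ler_wpM2l (cabs_ge0 (f 0)) h1) (ler_wpM2l (fine_beta_ge0 f) h2)) _.
by rewrite -mulrDl; exact: ler_piMl.
Qed.

Lemma opnorm_bounds :
  (maxe (bnorm D psi) (supnorm D psi) <= mult_opnorm X D psi)%E /\
  (mult_opnorm X D psi <= maxe (bnorm D psi) (supnorm D psi + sg))%E.
Proof.
split; last exact: opnorm_le.
by rewrite ge_max bnorm_le_opnorm supnorm_le_opnorm.
Qed.

End OperatorNorm.

Theorem mainTheorem7 (R : realType) (n : nat) (D : set 'rV[(R[i])^o]_n)
    (psi : 'rV[(R[i])^o]_n -> R[i]) :
  (0 < n)%N ->
  domain D -> bounded_set D -> homogeneous D -> D 0 ->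
  holo D psi ->
  (mult_bounded (bloch D) D psi ->
     (maxe (bnorm D psi) (supnorm D psi) <= mult_opnorm (bloch D) D psi)%E /\
     (mult_opnorm (bloch D) D psi <=
        maxe (bnorm D psi) (supnorm D psi + sigma D psi))%E) /\
  (mult_bounded (little_bloch D) D psi ->
     (maxe (bnorm D psi) (supnorm D psi) <= mult_opnorm (little_bloch D) D psi)%E /\
     (mult_opnorm (little_bloch D) D psi <=
        maxe (bnorm D psi) (supnorm D psi + sigma0 D psi))%E).
Proof.
move=> n0 dD bD _ D0 _; split=> HB.
  exact: opnorm_bounds n0 dD bD D0 (bloch_is_bloch_type n0 D0) HB.
exact: opnorm_bounds n0 dD bD D0 (little_bloch_is_bloch_type n0 D0) HB.
Qed.
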